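(* Let $1\le d\le D$ be integers. There exist constants $c_d,c_d',C_d>0$ depending only on $d$ (with $c_d$ and $(c_d')^{-1}$ small enough) such that the following two statements hold, where $M=\mathrm{supp}(P)$, $0<f_{\min}\le f_{\max}<\infty$, and the infima range over all estimators $\hat M=\hat M(X_1,\dots,X_n)$ based on an i.i.d. $n$-sample of $P$. (Boundaryless) Let $\tau_{\min}\in(0,\infty)$ and assume that $f_{\min}\le c_d/\tau_{\min}^d$ and $c_d'/\tau_{\min}^d\le f_{\max}$. If $d\le D-1$, then for all $n\ge1$, $$\inf_{\hat M}\ \sup_{P\in\mathcal P^{d,D}_{\tau_{\min},\infty}(f_{\min},f_{\max})}\mathbb E_{P^n}\bigl[\mathrm d_{\mathrm H}(M,\hat M)\bigr]\ \ge\ C_d\,\tau_{\min}\left\{1\wedge\left(\frac1{f_{\min}\tau_{\min}^d\,n}\right)^{\frac2d}\right\}.$$ (Convex) Let $\tau_{\partial,\min}\in(0,\infty)$ and assume that $f_{\min}\le c_d/\tau_{\partial,\min}^d$ and $c_d'/\tau_{\partial,\min}^d\le f_{\max}$. Then for all $n\ge1$, $$\inf_{\hat M}\ \sup_{P\in\mathcal P^{d,D}_{\infty,\tau_{\partial,\min}}(f_{\min},f_{\max})}\mathbb E_{P^n}\bigl[\mathrm d_{\mathrm H}(M,\hat M)\bigr]\ \ge\ C_d\,\tau_{\partial,\min}\left\{1\wedge\left(\frac1{f_{\min}\tau_{\partial,\min}^d\,n}\right)^{\frac2{d+1}}\right\}.$$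
   Context: A closed $M\subset\mathbb R^D$ is a $d$-dimensional $\mathcal C^2$-submanifold with boundary if for all $p\in M$ and all small enough open neighborhoods $V_p$ of $p$ in $\mathbb R^D$ there are an open neighborhood $U_0$ of $0$ in $\mathbb R^D$ and a $\mathcal C^2$-diffeomorphism $\Psi_p:U_0\to V_p$ with $\Psi_p(0)=p$ such that either $\Psi_p(U_0\cap(\mathbb R^d\times\{0\}^{D-d}))=M\cap V_p$ (interior point), or $\Psi_p(U_0\cap(\mathbb R^{d-1}\times\mathbb R_+\times\{0\}^{D-d}))=M\cap V_p$ (boundary point). The set of boundary points is $\partial M$ (possibly empty). For closed $S\subset\mathbb R^D$, $\mathrm{Med}(S)$ is the set of points of $\mathbb R^D$ having at least two nearest points on $S$; the reach is $\tau_S=\inf_{z\in\mathrm{Med}(S)}\mathrm d(z,S)$ ($+\infty$ if $\mathrm{Med}(S)=\emptyset$; $\tau_\emptyset=\infty$). $S$ is convex if and only if $\tau_S=\infty$. $\mathcal M^{d,D}_{\tau_{\min},\tau_{\partial,\min}}$ (with $\tau_{\min},\tau_{\partial,\min}\in(0,\infty]$) is the set of compact connected $d$-dimensional $\mathcal C^2$-submanifolds $M\subset\mathbb R^D$ with (possibly empty) boundary such that $\tau_M\ge\tau_{\min}$ and $\tau_{\partial M}\ge\tau_{\partial,\min}$. The case $\tau_{\partial,\min}=\infty$ corresponds to submanifolds with empty boundary, and $\tau_{\min}=\infty$ to convex ones. $\mathcal P^{d,D}_{\tau_{\min},\tau_{\partial,\min}}(f_{\min},f_{\max})$ is the set of Borel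 probability distributions $P$ on $\mathbb R^D$ whose support $M$ belongs to $\mathcal M^{d,D}_{\tau_{\min},\tau_{\partial,\min}}$ and which have a density $f$ with respect to $\mathbf 1_M\mathcal H^d$ ($\mathcal H^d$ the $d$-dimensional Hausdorff measure) with $f_{\min}\le f(x)\le f_{\max}$ for all $x\in M$. $\mathrm d_{\mathrm H}(S,S')=\max\{\max_{x\in S}\mathrm d(x,S'),\max_{x'\in S'}\mathrm d(x',S)\}$ is the Hausdorff distance between compact subsets of $\mathbb R^D$, with $\mathrm d(z,S)=\min_{x\in S}\|z-x\|$. $a\wedge b=\min(a,b)$. *)

(* Defs.v *)
From HB Require Import structures.
From mathcomp Require Import all_boot all_order all_algebra.
From mathcomp Require Import lra zify.
From mathcomp Require Import all_classical all_reals all_analysis measurable_realfun.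

Set Implicit Arguments.
Unset Strict Implicit.
Unset Printing Implicit Defensive.

Import Order.TTheory GRing.Theory Num.Theory.
Import numFieldNormedType.Exports.

Local Open Scope classical_set_scope.
Local Open Scope ring_scope.

(* R^D is 'rV[R]_D.  The library norm on row vectors is the sup norm: it is
   used below only through the topology and the differential, never as a
   distance. *)

Definition enorm (R : realType) (D : nat) (x : 'rV[R]_D) : R :=
  Num.sqrt (\sum_(i < D) x 0 i ^+ 2).

(* d(z, S); it is +oo when S is empty. *)
Definition edist (R : realType) (D : nat) (z : 'rV[R]_D) (S : set 'rV[R]_D) :
    \bar R :=
  ereal_inf [set (enorm (z - x))%:E | x in S].

Definition hausdorff_dist (R : realType) (D : nat) (S S' : set 'rV[R]_D) :
    \bar R :=
  maxe (ereal_sup [set edist x S' | x in S])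
       (ereal_sup [set edist x S | x in S']).

Definition medial_axis (R : realType) (D : nat) (S : set 'rV[R]_D) :
    set 'rV[R]_D :=
  [set z | exists x y, [/\ S x, S y, x <> y,
     edist z S = (enorm (z - x))%:E & edist z S = (enorm (z - y))%:E]].

Definition reach (R : realType) (D : nat) (S : set 'rV[R]_D) : \bar R :=
  ereal_inf [set edist z S | z in medial_axis S].

Fixpoint Ck_on (R : realType) (D D' k : nat) (U : set 'rV[R]_D)
    (f : 'rV[R]_D -> 'rV[R]_D') : Prop :=
  if k is k'.+1 then
    (forall x, U x -> differentiable f x) /\
    (forall v : 'rV[R]_D, Ck_on k' U (fun x => 'D_v f x))
  else forall x, U x -> {for x, continuous f}.

Definition C2_diffeo (R : realType) (D : nat) (U V : set 'rV[R]_D)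
    (Psi : 'rV[R]_D -> 'rV[R]_D) : Prop :=
  exists Phi : 'rV[R]_D -> 'rV[R]_D,
    [/\ Ck_on 2 U Psi, Ck_on 2 V Phi,
        forall x, U x -> V (Psi x) /\ Phi (Psi x) = x
      & forall y, V y -> U (Phi y) /\ Psi (Phi y) = y].

(* R^d x {0}^(D-d) *)
Definition flat_model (R : realType) (D d : nat) : set 'rV[R]_D :=
  [set x | forall i : 'I_D, (d <= i)%N -> x 0 i = 0].

(* R^(d-1) x R_+ x {0}^(D-d) *)
Definition half_model (R : realType) (D d : nat) : set 'rV[R]_D :=
  [set x | flat_model d x /\ forall i : 'I_D, i.+1 = d -> 0 <= x 0 i].

Definition has_chart (R : realType) (D : nat) (model M : set 'rV[R]_D)
    (p : 'rV[R]_D) (V : set 'rV[R]_D) : Prop :=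
  exists (U : set 'rV[R]_D) (Psi : 'rV[R]_D -> 'rV[R]_D),
    [/\ open U, U 0, C2_diffeo U V Psi, Psi 0 = p
      & Psi @` (U `&` model) = M `&` V].

Definition small_open_nbhs (R : realType) (D : nat) (p : 'rV[R]_D)
    (Q : set 'rV[R]_D -> Prop) : Prop :=
  exists2 W : set 'rV[R]_D, nbhs p W &
    forall V, open V -> V p -> V `<=` W -> Q V.

Definition C2_submanifold (R : realType) (D d : nat) (M : set 'rV[R]_D) : Prop :=
  closed M /\
  forall p, M p -> small_open_nbhs p (fun V =>
    has_chart (flat_model d) M p V \/ has_chart (half_model d) M p V).

Definition boundary (R : realType) (D d : nat) (M : set 'rV[R]_D) :
    set 'rV[R]_D :=
  [set p | M p /\ small_open_nbhs p (has_chart (half_model d) M p)].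

Definition manifold_class (R : realType) (D d : nat)
    (taumin tauBmin : \bar R) : set (set 'rV[R]_D) :=
  [set M | [/\ compact M, connected M, C2_submanifold d M,
     (taumin <= reach M)%E & (tauBmin <= reach (boundary d M))%E]].

HB.instance Definition _ (R : realType) (D : nat) :=
  @isMeasurable.Build (sigma_display (@open 'rV[R]_D)) 'rV[R]_D
    <<s @open 'rV[R]_D >> (@sigma_algebra0 _ setT _) (@sigma_algebraC _ _)
    (@sigma_algebra_bigcup _ setT _).

(* Volume of the unit ball of R^d, by w_{d+2} = 2 pi w_d / (d + 2). *)
Fixpoint ball_volume (R : realType) (d : nat) : R :=
  match d with
  | 0 => 1
  | 1 => 2
  | d'.+2 => 2 * pi / d'.+2%:R * ball_volume R d'
  end.

(* [maxe 0] makes the diameter of the empty set 0. *)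
Definition diam (R : realType) (D : nat) (A : set 'rV[R]_D) : \bar R :=
  maxe 0%E (ereal_sup [set (enorm (x.1 - x.2))%:E | x in A `*` A]).

(* [diam ^+ 0] is 1, so the empty set needs its own case when d = 0.  The factor
   w_d / 2^d makes the d-dimensional Hausdorff measure agree with the Lebesgue
   measure on R^d. *)
Definition hausdorff_gauge (R : realType) (D d : nat) (A : set 'rV[R]_D) :
    \bar R :=
  if A == set0 then 0%E else
    ((ball_volume R d / 2 ^+ d)%:E * diam A ^+ d)%E.

Definition hausdorff_premeasure (R : realType) (D d : nat) (delta : R)
    (A : set 'rV[R]_D) : \bar R :=
  ereal_inf [set (\sum_(k <oo) hausdorff_gauge d (F k))%E |
    F in [set F : (set 'rV[R]_D)^nat |
      A `<=` \bigcup_k F k /\ forall k, (diam (F k) <= delta%:E)%E]].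

Definition hausdorff_measure (R : realType) (D d : nat) (A : set 'rV[R]_D) :
    \bar R :=
  ereal_sup [set hausdorff_premeasure d delta A | delta in [set e : R | 0 < e]].

(* hausdorff_measure is a metric outer measure, hence Borel sets are
   Caratheodory measurable and its restriction to them is a measure. *)
Section hausdorff_measure_is_measure.
Local Open Scope ereal_scope.
Context (R : realType) (D d : nat).
Notation E := 'rV[R]_D.
Implicit Types A B : set E.

Lemma ball_volume_ge0 n : (0 <= ball_volume R n)%R.
Proof.
suff : ((0 <= ball_volume R n) && (0 <= ball_volume R n.+1))%R by case/andP.
elim: n => [|n /andP[h0 h1]]; first by rewrite /= ler01 ler0n.
rewrite h1/=; apply: mulr_ge0 => //; apply: mulr_ge0; last by rewrite invr_ge0.
by apply: mulr_ge0 => //; exact: pi_ge0.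
Qed.

Lemma diam_ge0 A : 0 <= diam A.
Proof. by rewrite le_max lexx. Qed.

Lemma hausdorff_gauge_ge0 A : 0 <= hausdorff_gauge d A.
Proof.
rewrite /hausdorff_gauge; case: ifP => // _.
apply: mule_ge0; last exact/expe_ge0/diam_ge0.
by rewrite lee_fin divr_ge0 ?ball_volume_ge0// exprn_ge0.
Qed.

Lemma hausdorff_gauge0 : hausdorff_gauge d (set0 : set E) = 0.
Proof. by rewrite /hausdorff_gauge eqxx. Qed.

Lemma diam0 : diam (set0 : set E) = 0.
Proof. by rewrite /diam set0X image_set0 ereal_sup0 maxC /maxe ltNy0. Qed.

Lemma hausdorff_premeasure_ge0 delta A : 0 <= hausdorff_premeasure d delta A.
Proof.
apply: le_ereal_inf_tmp => _ [F _ <-]; apply: nneseries_ge0 => *.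
exact: hausdorff_gauge_ge0.
Qed.

Let T : measurableType (sigma_display [set: set E]) := g_sigma_algebraType [set: set E].

Let gauge_le (delta : R) (A : set T) : \bar R :=
  if (diam (A : set E) <= delta%:E) then hausdorff_gauge d (A : set E) else +oo.

Let gauge_le_ge0 delta A : 0 <= gauge_le delta A.
Proof. by rewrite /gauge_le; case: ifP => // _; exact: hausdorff_gauge_ge0. Qed.

Let premeasureE delta A : hausdorff_premeasure d delta A = mu_ext (gauge_le delta) (A : set T).
Proof.
apply/eqP; rewrite eq_le; apply/andP; split; apply: le_ereal_inf_tmp.
- move=> _ [F [_ AF] <-].
  have [Fd|] := pselect (forall k, diam (F k : set E) <= delta%:E).
    apply: ereal_inf_lbound; exists F => //.
    by apply: eq_eseriesr => k _; rewrite /gauge_le Fd.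
  move/existsNP => [k /negP Fk]; rewrite (@eseries_pinfty _ _ _ k) ?leey//.
  + by move=> n _; rewrite -ltNye (lt_le_trans _ (gauge_le_ge0 _ _)).
  + by rewrite /gauge_le (negbTE Fk).
- move=> _ [F [AF Fd] <-]; apply: ereal_inf_lbound; exists F.
    by split=> // k; exact: sub_sigma_algebra.
  by apply: eq_eseriesr => k _; rewrite /gauge_le Fd.
Qed.

Lemma hausdorff_premeasure_le delta A B : A `<=` B ->
  hausdorff_premeasure d delta A <= hausdorff_premeasure d delta B.
Proof. by move=> AB; rewrite !premeasureE; exact: le_mu_ext. Qed.

Lemma hausdorff_premeasure_sigma_subadditive delta :
  sigma_subadditive (@hausdorff_premeasure R D d delta).
Proof.
move=> F; rewrite premeasureE (@eq_eseriesr _ _ (mu_ext (gauge_le delta) \o F)).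
  exact: (@mu_ext_sigma_subadditive _ T R (gauge_le delta) (gauge_le_ge0 delta)).
by move=> k _; exact: premeasureE.
Qed.

Lemma hausdorff_premeasure_anti (e e' : R) A : (e <= e')%R ->
  hausdorff_premeasure d e' A <= hausdorff_premeasure d e A.
Proof.
move=> ee'; apply: ereal_inf_le_tmp => _ [F [AF Fd] <-]; exists F => //; split=> // k.
by rewrite (le_trans (Fd k))// lee_fin.
Qed.

Lemma le_hausdorff_measure_pre (e : R) A : (0 < e)%R ->
  hausdorff_premeasure d e A <= hausdorff_measure d A.
Proof. by move=> e0; apply: ereal_sup_ubound; exists e. Qed.

Lemma hausdorff_measure0 : hausdorff_measure d (set0 : set E) = 0.
Proof.
apply/eqP; rewrite eq_le; apply/andP; split; last first.
  exact: le_trans (hausdorff_premeasure_ge0 1 _) (le_hausdorff_measure_pre _ ltr01).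
apply: ge_ereal_sup => _ [e /= e0 <-]; apply: ereal_inf_lbound.
exists (fun=> set0); first by split=> // k; rewrite diam0 lee_fin ltW.
by rewrite eseries0// => *; exact: hausdorff_gauge0.
Qed.

Lemma hausdorff_measure_ge0 A : 0 <= hausdorff_measure d A.
Proof. exact: le_trans (hausdorff_premeasure_ge0 1 _) (le_hausdorff_measure_pre _ ltr01). Qed.

Lemma le_hausdorff_measure A B : A `<=` B ->
  hausdorff_measure d A <= hausdorff_measure d B.
Proof.
move=> AB; apply: ge_ereal_sup => _ [e /= e0 <-].
exact: le_trans (hausdorff_premeasure_le _ AB) (le_hausdorff_measure_pre _ e0).
Qed.

Lemma hausdorff_measure_sigma_subadditive :
  sigma_subadditive (@hausdorff_measure R D d).
Proof.
move=> F; apply: ge_ereal_sup => _ [e /= e0 <-].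
apply: le_trans (hausdorff_premeasure_sigma_subadditive e F) _.
apply: lee_nneseries => [? *|? *]; first exact: hausdorff_premeasure_ge0.
exact: le_hausdorff_measure_pre.
Qed.

HB.instance Definition _ := isOuterMeasure.Build R E (hausdorff_measure d)
  hausdorff_measure0 hausdorff_measure_ge0 le_hausdorff_measure
  hausdorff_measure_sigma_subadditive.

Lemma norm_le_enorm (x : E) : (`|x| <= enorm x)%R.
Proof.
rewrite [leLHS]mx_normrE; apply/bigmax_leP; split=> /=; first exact: sqrtr_ge0.
move=> [i j] _ /=; rewrite ord1 -sqrtr_sqr ler_wsqrtr// (bigD1 j)//=.
by rewrite lerDl sumr_ge0// => *; exact: sqr_ge0.
Qed.

Lemma enorm_diam A x y : A x -> A y -> (enorm (x - y))%:E <= diam A.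
Proof.
move=> Ax Ay; rewrite /diam le_max; apply/orP; right.
by apply: ereal_sup_ubound; exists (x, y).
Qed.

Lemma hausdorff_premeasureU_sep (e delta : R) A B : (delta < e)%R ->
  (forall x y, A x -> B y -> (e <= `|x - y|)%R) ->
  hausdorff_premeasure d delta A + hausdorff_premeasure d delta B
  <= hausdorff_premeasure d delta (A `|` B).
Proof.
move=> de AB; apply: le_ereal_inf_tmp => _ [F [ABF Fd] <-].
pose G C k := if pselect (F k `&` C !=set0) then F k else set0.
have GP C : C `<=` A `|` B -> hausdorff_premeasure d delta C <=
    \sum_(k <oo) hausdorff_gauge d (G C k).
  move=> CAB; apply: ereal_inf_lbound; exists (G C) => //; split.
    move=> x Cx; have [k _ Fx] := ABF _ (CAB _ Cx); exists k => //.
    by rewrite /G; case: pselect => // -[]; exists x.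
  move=> k; rewrite /G; case: pselect => /= [_|_]; first exact: Fd.
  by rewrite diam0; exact: le_trans (diam_ge0 (F k)) (Fd k).
apply: le_trans (leeD (GP A (@subsetUl _ _ _)) (GP B (@subsetUr _ _ _))) _.
rewrite -nneseriesD; [|by move=> *; exact: hausdorff_gauge_ge0..].
apply: lee_nneseries => [? *|k _].
  by apply: adde_ge0; exact: hausdorff_gauge_ge0.
rewrite /G; case: pselect => /= [[x [Fx Ax]]|_]; last first.
  rewrite hausdorff_gauge0 add0e; case: pselect => //= _.
  by rewrite hausdorff_gauge0 hausdorff_gauge_ge0.
case: pselect => /= [[y [Fy By]]|_]; last by rewrite hausdorff_gauge0 adde0.
have := le_trans (enorm_diam Fx Fy) (Fd k); rewrite lee_fin => xyd.
have := le_lt_trans (le_trans (norm_le_enorm _) xyd) de.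
by rewrite ltNge AB.
Qed.

Lemma hausdorff_measureU_sep (e : R) A B : (0 < e)%R ->
  (forall x y, A x -> B y -> (e <= `|x - y|)%R) ->
  hausdorff_measure d A + hausdorff_measure d B <= hausdorff_measure d (A `|` B).
Proof.
move=> e0 AB.
have H (e1 e2 : R) : (0 < e1)%R -> (0 < e2)%R ->
    hausdorff_premeasure d e1 A + hausdorff_premeasure d e2 B <=
    hausdorff_measure d (A `|` B).
  move=> e10 e20; pose m := (Num.min (e / 2) (Num.min e1 e2))%R.
  have m0 : (0 < m)%R by rewrite !lt_min e10 e20 divr_gt0.
  apply: le_trans (le_hausdorff_measure_pre _ m0).
  apply: le_trans (hausdorff_premeasureU_sep (e := e) _ AB); last first.
    by rewrite !gt_min ltr_pdivrMr// ltr_pMr// ltr1n.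
  by apply: leeD; apply: hausdorff_premeasure_anti; rewrite !ge_min lexx ?orbT.
have [->|Hoo] := eqVneq (hausdorff_measure d (A `|` B)) +oo; first exact: leey.
have Hfin C : C `<=` A `|` B -> hausdorff_measure d C \is a fin_num.
  move=> CAB; rewrite ge0_fin_numE ?hausdorff_measure_ge0//.
  by rewrite (le_lt_trans (le_hausdorff_measure CAB))// ltey.
rewrite -leeBrDr ?Hfin//; apply: ge_ereal_sup => _ [e1 /= e10 <-].
have pfin : hausdorff_premeasure d e1 A \is a fin_num.
  rewrite ge0_fin_numE ?hausdorff_premeasure_ge0//.
  rewrite (le_lt_trans (le_hausdorff_measure_pre _ e10))//.
  by rewrite -ge0_fin_numE ?hausdorff_measure_ge0// Hfin.
rewrite leeBrDr ?Hfin// addeC -leeBrDr//.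
apply: ge_ereal_sup => _ [e2 /= e20 <-].
by rewrite leeBrDr// addeC; exact: H.
Qed.

Lemma open_caratheodory (O : set E) : open O ->
  (@hausdorff_measure R D d).-caratheodory O.
Proof.
move=> oO; apply: le_caratheodory_measurable => X; rewrite -/(hausdorff_measure d _).
change (hausdorff_measure d (X `&` O) + hausdorff_measure d (X `&` ~` O) <= hausdorff_measure d X).
have [->|Xoo] := eqVneq (hausdorff_measure d X) +oo; first exact: leey.
pose A (n : nat) := X `&` [set x | forall y, ~ O y -> (n.+1%:R^-1 <= `|x - y|)%R].
have ndA m n : (m <= n)%N -> A m `<=` A n.
  move=> mn x [Xx Ax]; split=> // y Oy; apply: le_trans (Ax _ Oy).
  by rewrite lef_pV2 ?posrE ?ltr0n// ler_nat ltnS.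
have AX n : hausdorff_measure d (A n) <= hausdorff_measure d X.
  by apply: le_hausdorff_measure => x [].
pose B n := A n.+1 `\` A n.
have XO : X `&` O `<=` \bigcup_n A n.
  move=> x [Xx Ox].
  have /nbhs_ballP[e /= e0 xeO] : nbhs x O by exact: open_nbhs_nbhs.
  have [n ne] : exists n, (n.+1%:R^-1 < e)%R.
    by have [n _ /(_ n (leqnn _))] := near_infty_natSinv_lt (PosNum e0); exists n.
  exists n => //; split => // y Oy; rewrite leNgt; apply/negP => xy; apply: Oy.
  by apply: xeO; rewrite -ball_normE/=; exact: lt_trans ne.
have AB n : hausdorff_measure d (A n) + hausdorff_measure d (B n.+1) <=
    hausdorff_measure d (A n.+2).
  have e0 : (0 < n.+1%:R^-1 - n.+2%:R^-1 :> R)%R.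
    by rewrite subr_gt0 ltf_pV2 ?posrE ?ltr0n// ltr_nat.
  apply: le_trans (hausdorff_measureU_sep e0 _) _.
    move=> x y [_ Ax] [[Xy Ay]] nAy; rewrite leNgt; apply/negP => xy.
    apply: nAy; split=> // z Oz.
    have := Ax _ Oz; have := ler_normD (x - y)%R (y - z)%R.
    rewrite addrA subrK; move: xy; move: (n.+1%:R^-1)%R (n.+2%:R^-1)%R => a b; lra.
  by apply: le_hausdorff_measure => x [/ndA|[]]; [apply; lia|].
have sumB n : \sum_(k < n) hausdorff_measure d (B k.+1) <=
    hausdorff_measure d (A n) + hausdorff_measure d (A n.+1).
  elim: n => [|n IH].
    by rewrite big_ord0; apply: adde_ge0; exact: hausdorff_measure_ge0.
  rewrite big_ord_recr/=; apply: le_trans (leeD2r _ IH) _.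
  by rewrite addeAC addeC; apply: leeD2l; exact: AB.
have Xfin : hausdorff_measure d X < +oo by rewrite ltey.
have Bfin : \sum_(k <oo) hausdorff_measure d (B k) < +oo.
  rewrite nneseries_recl => [|k _|//]; last exact: (hausdorff_measure_ge0 (B k)).
  apply: lte_add_pinfty.
    by apply: le_lt_trans Xfin; apply: le_hausdorff_measure => x [[]].
  apply: (@le_lt_trans _ _ (hausdorff_measure d X + hausdorff_measure d X)); last first.
    exact: lte_add_pinfty.
  rewrite -(nneseries_addn 1); last by move=> k; exact: hausdorff_measure_ge0.
  apply: lime_le; first by apply: is_cvg_nneseries => *; exact: hausdorff_measure_ge0.
  apply: nearW => n; rewrite big_mkord; under eq_bigr do rewrite addn1.
  by apply: le_trans (sumB n) (leeD (AX _) (AX _)).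
have HN N : hausdorff_measure d (X `&` O) + hausdorff_measure d (X `&` ~` O) <=
    hausdorff_measure d X + \sum_(N <= k <oo) hausdorff_measure d (B k).
  have XON : X `&` O `<=` A N `|` \bigcup_(k in ~` `I_N) B k.
    move=> x /XO [n _]; elim: n => [|n IH] An.
      by left; apply: ndA An.
    have [/IH//|nAn] := pselect (A n x).
    have [nN|Nn] := leqP n.+1 N; first by left; apply: ndA An.
    by right; exists n => //=; apply/negP; rewrite -leqNgt.
  apply: le_trans (leeD2r _ (le_trans (le_hausdorff_measure XON) _)) _.
    exact: outer_measureU2.
  rewrite addeAC; apply: leeD.
    apply: le_trans (hausdorff_measureU_sep (e := N.+1%:R^-1) _ _) _ => //.
      by move=> x y [_ Ax] [_ Oy]; exact: Ax.
    by apply: le_hausdorff_measure => x [[]|[]].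
  exact: outer_measure_sigma_subadditive_tail.
have tail : \sum_(N <= k <oo) hausdorff_measure d (B k) @[N --> \oo] --> 0.
  by apply: nneseries_tail_cvg => // k _; exact: hausdorff_measure_ge0.
rewrite -[leRHS]adde0.
have lim : (fun N => hausdorff_measure d X +
    \sum_(N <= k <oo) hausdorff_measure d (B k)) @ \oo --> hausdorff_measure d X + 0.
  by apply: (cvgeD _ (cvg_cst _) tail); exact: fin_num_adde_defl.
apply: (cvge_to_ge lim).
by apply: nearW => N; exact: HN.
Qed.

Lemma borel_caratheodory (A : set E) : measurable A ->
  (@hausdorff_measure R D d).-caratheodory A.
Proof.
move: A; apply: smallest_sub; last exact: open_caratheodory.
exact: (@sigma_algebra_measurable _ (caratheodory_type (@hausdorff_measure R D d))).
Qed.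

Let hausdorff_measure_sigma_additive :
  semi_sigma_additive (@hausdorff_measure R D d).
Proof.
move=> F mF tF mUF; apply: caratheodory_measure_sigma_additive => //.
  by move=> k; exact: borel_caratheodory.
exact: borel_caratheodory.
Qed.

HB.instance Definition _ := isMeasure.Build _ E R (@hausdorff_measure R D d)
  hausdorff_measure0 hausdorff_measure_ge0 hausdorff_measure_sigma_additive.

End hausdorff_measure_is_measure.
Definition supp (R : realType) (D : nat) (P : probability 'rV[R]_D R) :
    set 'rV[R]_D :=
  [set x | forall V, open V -> V x -> (0 < P V)%E].

Definition distribution_class (R : realType) (D d : nat)
    (taumin tauBmin : \bar R) (fmin fmax : R) : set (probability 'rV[R]_D R) :=
  [set P | manifold_class d taumin tauBmin (supp P) /\
    exists f : 'rV[R]_D -> R,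
      [/\ measurable_fun (supp P) f,
          forall x, supp P x -> fmin <= f x <= fmax
        & forall A, measurable A ->
            P A = (\int[hausdorff_measure d]_(x in A `&` supp P) (f x)%:E)%E]].

Section iid_law.
Context d (T : measurableType d) (R : realType) (P : probability T R).
Local Open Scope ereal_scope.

Definition tuple_cons n (xt : T * n.-tuple T) : n.+1.-tuple T :=
  [the n.+1.-tuple T of xt.1 :: xt.2].

Lemma measurable_tuple_cons n : measurable_fun setT (@tuple_cons n).
Proof. exact: measurable_cons. Qed.

HB.instance Definition _ n :=
  isMeasurableFun.Build _ _ _ _ (@tuple_cons n) (@measurable_tuple_cons n).

Section product.
Context n (Q : probability (n.-tuple T) R).

Definition iid_step : set (T * n.-tuple T) -> \bar R := P \x Q.

HB.instance Definition _ := Measure.on iid_step.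

Lemma iid_step_setT : iid_step setT = 1.
Proof.
rewrite /iid_step -setXTT product_measure1E//.
by rewrite [X in X * _]probability_setT [X in _ * X]probability_setT mule1.
Qed.

HB.instance Definition _ :=
  Measure_isProbability.Build _ _ _ iid_step iid_step_setT.

End product.

(* The law P^n of an i.i.d. n-sample of P: P^0 is the point mass at the empty
   tuple, P^(n+1) the image of P \x P^n under (x, t) |-> x :: t. *)
Fixpoint iid_law n : probability (n.-tuple T) R :=
  if n is m.+1 then distribution (iid_step (iid_law m)) (@tuple_cons m)
  else \d_[tuple].

End iid_law.

(* Measurability of an estimator is Borel measurability for the Hausdorff
   metric on nonempty compact sets: that metric space being separable, its
   Borel sigma-algebra is generated by the distance functions to points. *)
Definition estimator (R : realType) (D n : nat)
    (Mhat : n.-tuple 'rV[R]_D -> set 'rV[R]_D) : Prop :=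
  (forall x, Mhat x !=set0 /\ compact (Mhat x)) /\
  forall K : set 'rV[R]_D, K !=set0 -> compact K ->
    measurable_fun setT (fun x => hausdorff_dist K (Mhat x)).

Definition minimax_risk (R : realType) (D n : nat)
    (PP : set (probability 'rV[R]_D R)) : \bar R :=
  ereal_inf [set ereal_sup
    [set (\int[iid_law P n]_x hausdorff_dist (supp P) (Mhat x))%E | P in PP]
  | Mhat in @estimator R D n].

(* Main.v *)
Require Import Defs.
From HB Require Import structures.
From mathcomp Require Import all_boot all_order all_algebra.
From mathcomp Require Import all_classical all_reals all_analysis measurable_realfun.
From mathcomp Require Import perm.
From mathcomp Require Import ring lra zify.

Set Implicit Arguments.
Unset Strict Implicit.
Unset Printing Implicit Defensive.

Import Order.TTheory GRing.Theory Num.Theory.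
Import numFieldNormedType.Exports.

Local Open Scope classical_set_scope.
Local Open Scope ring_scope.

(** Both bounds compare two manifolds that a sample of size n can hardly tell
    apart.  Single out the coordinate x_0 of R^(D+1), write N(x) for the sum of
    the squares of the other coordinates, and put
      lvl c dl r x = |x|^2 - 2 pbump c dl (N x) - r^2,
    where the bump is a C^2 function of N, of height c dl^2, that vanishes for
    N >= dl^2.  Inside the space of the first m coordinates, the zero set of lvl
    is the round sphere of radius r when c = 0; when c > 0 it is the same sphere
    with both poles pushed outwards, by a height of order dl^2 / r, above the
    cylinder N < dl^2.  This hypersurface serves the boundaryless class.  The
    convex body that it bounds serves the convex class: its boundary is again
    the bumped sphere.

    The geometry rests on one estimate, [lvl_taylor]: as soon as c <= 1/280, the
    second-order remainder of lvl lies between |h|^2 / 2 and 3 |h|^2 / 2, for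
    every dl.  Its lower half is strong convexity, which makes the sublevel set
    convex ([reach_body]).  Its upper half, together with a gradient of norm at
    least 2 r on the zero set, bounds the reach of the zero set below by 2 r / 3
    ([reach_surf]).  Taking r = 2 tau satisfies the constraint with room to spare,
    and it remains to choose dl.

    The statistical argument is Le Cam's ([two_point_risk]).  Put the same density
    on what the two manifolds have in common, and the same mass p <= 1 / (2 n) on
    each of the two caps.  With probability at least 1 / 2 the sample misses the
    cap, and on that event the two laws coincide; so no estimator is close to both
    manifolds, which are at distance h, of order dl^2 / tau.  A density at least
    f_min forces p to be of the order of f_min times the volume of the cap.  That
    volume is of order dl^d on the surface, but dl^(d+1) / tau in the body, where
    the cap has thickness dl^2 / tau.  Solving p = 1 / (2 n) for dl gives the two
    exponents 2 / d and 2 / (d+1).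

    Volumes matter up to factors depending on d only, because the densities are
    normalised by the true Hausdorff measures.  A set whose projection to k
    coordinates fills a box is large ([hausdorff_lower]), and a set on which k
    coordinates control all the others is small ([hausdorff_upper]). *)

(** * Maps of class C^k between normed spaces *)

Lemma near_eq_differentiable (R : numFieldType) (V W : normedModType R)
  (f g : V -> W) (x : V) :
  (\near x, f x = g x) -> differentiable f x -> differentiable g x.
Proof.
move=> fg df; apply/diffP.
apply: (@getPex _ (fun (dg : {linear V -> W}) => continuous dg /\
  forall y, g y = g (lim (nbhs x)) + dg (y - lim (nbhs x))
                  +o_(y \near x) (y - lim (nbhs x)))).
exists ('d f x); split; first exact: diff_continuous.
case: df => -[_ H0]; have H := eqadd_some_oP H0.
have E eps : 0 < eps -> \forall y \near nbhs x,
    `|(g - (fun y => g (lim (nbhs x)) + 'd f x (y - lim (nbhs x)))) y|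
    <= eps * `|y - lim (nbhs x)|.
  move=> eps0; have := H eps eps0.
  rewrite !lim_id//; apply: filter_app; have fx := nbhs_singleton fg; apply: filterS fg => y fgy.
  by rewrite /= !fctE /= fgy fx; exact.
by have := (eqaddoP (nbhs_filter_on x) _ _ _).2 E; rewrite funeqE.
Qed.

Section Ck_calculus.
Context (R : realType) (V : normedModType R).
Implicit Types (U : set V).

(** The recursion of [Ck_on] with an arbitrary normed source and target.  Smoothness
    of a row-vector valued map is then checked coordinate by coordinate, on scalar
    functions, which can be added, multiplied and composed; see [Ck_onP]. *)
Fixpoint Ck (W : normedModType R) (k : nat) U (f : V -> W) : Prop :=
  if k is k'.+1 then
    (forall x, U x -> differentiable f x) /\
    (forall v : V, Ck k' U (fun x => 'D_v f x))
  else forall x, U x -> {for x, continuous f}.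

Lemma near_open U (x : V) (P : V -> Prop) : open U -> U x ->
  (forall y, U y -> P y) -> \forall y \near x, P y.
Proof. by move=> oU Ux UP; apply: filterS (open_nbhs_nbhs (conj oU Ux)). Qed.

Lemma Ck_ext (W : normedModType R) k U (f g : V -> W) : open U ->
  (forall x, U x -> f x = g x) -> Ck k U f -> Ck k U g.
Proof.
move=> oU; elim: k f g => [|k IH] f g fg /=.
  move=> cf x Ux; have fgx := near_open oU Ux fg.
  rewrite /prop_for /continuous_at -(fg x Ux).
  by apply: cvg_trans (cf x Ux); exact: near_eq_cvg.
case=> df Df; split.
  by move=> x Ux; exact: near_eq_differentiable (near_open oU Ux fg) (df x Ux).
move=> v; apply: IH (Df v) => x Ux.
exact: near_eq_derive (near_open oU Ux fg).
Qed.

Lemma CkW (W : normedModType R) k U (f : V -> W) : Ck k.+1 U f -> Ck k U f.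
Proof.
elim: k f => [|k IH] f; first by case=> df _ x /df /differentiable_continuous.
by case=> df Df; split => // v; apply: IH; exact: Df.
Qed.

Lemma Ck_cst (W : normedModType R) k U (a : W) : Ck k U (fun=> a).
Proof.
elim: k a => [|k IH] a /=; first by move=> x _; exact: cst_continuous.
split=> [x _|v]; first exact: differentiable_cst.
have -> : (fun x : V => 'D_v (fun=> a) x) = (fun=> 0) by apply/funext => x; rewrite derive_cst.
exact: IH.
Qed.

Lemma CkD (W : normedModType R) k U (f g : V -> W) : open U ->
  Ck k U f -> Ck k U g -> Ck k U (fun x => f x + g x).
Proof.
move=> oU; elim: k f g => [|k IH] f g /=.
  by move=> cf cg x Ux; apply: continuousD; [exact: cf|exact: cg].
case=> df Df [dg Dg]; split.
  by move=> x Ux; apply: differentiableD; [exact: df|exact: dg].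
move=> v; apply: (Ck_ext oU _ (IH _ _ (Df v) (Dg v))) => x Ux.
exact/esym/(deriveD (diff_derivable (df x Ux)) (diff_derivable (dg x Ux))).
Qed.

Lemma CkZl (W : normedModType R) k U (f : V -> R) (w : W) : open U ->
  Ck k U f -> Ck k U (fun x => f x *: w).
Proof.
move=> oU; elim: k f => [|k IH] f /=.
  by move=> cf x Ux; apply: continuousZl; exact: cf.
case=> df Df; split; first by move=> x Ux; apply: differentiableZl; exact: df.
move=> v; apply: (Ck_ext oU _ (IH _ (Df v))) => x Ux.
rewrite (deriveE _ (differentiableZl _ (df x Ux))) (diffZl _ (df x Ux)) /=.
by rewrite (deriveE _ (df x Ux)).
Qed.

Lemma CkM k U (f g : V -> R) : open U ->
  Ck k U f -> Ck k U g -> Ck k U (fun x => f x * g x).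
Proof.
move=> oU; elim: k f g => [|k IH] f g /=.
  by move=> cf cg x Ux; apply: continuousM; [exact: cf|exact: cg].
case=> df Df [dg Dg]; split.
  by move=> x Ux; apply: differentiableM; [exact: df|exact: dg].
move=> v.
have Cf : Ck k U f by apply: CkW.
have Cg : Ck k U g by apply: CkW.
apply: (Ck_ext oU _ (CkD oU (IH _ _ Cf (Dg v)) (IH _ _ Cg (Df v)))) => x Ux.
exact/esym/(deriveM (diff_derivable (df x Ux)) (diff_derivable (dg x Ux))).
Qed.

Lemma Ck_sum (W : normedModType R) k U (I : Type) (s : seq I) (P : pred I)
    (f : I -> V -> W) : open U ->
  (forall i, P i -> Ck k U (f i)) -> Ck k U (fun x => \sum_(i <- s | P i) f i x).
Proof.
move=> oU Cf; elim: s => [|i s IH].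
  by apply: Ck_ext (Ck_cst _ _ 0) => // x _; rewrite big_nil.
have [Pi|nPi] := boolP (P i).
  by apply: (Ck_ext oU _ (CkD oU (Cf i Pi) IH)) => x _; rewrite big_cons Pi.
by apply: (Ck_ext oU _ IH) => x _; rewrite big_cons (negbTE nPi).
Qed.

(** For functions of one variable the successive derivatives are named explicitly:
    the chain rule [Ck_comp] composes them again with the inner function. *)
Fixpoint C1k (k : nat) (A : set R) (phi : R -> R) : Prop :=
  if k is k'.+1 then
    exists2 phi' : R -> R, (forall t, A t -> is_derive t (1 : R) phi (phi' t)) &
      C1k k' A phi'
  else forall t, A t -> {for t, continuous phi}.

Lemma Ck_comp k U A (phi : R -> R) (f : V -> R) : open U ->
  (forall x, U x -> A (f x)) ->
  C1k k A phi -> Ck k U f -> Ck k U (fun x => phi (f x)).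
Proof.
move=> oU fA; elim: k phi => [|k IH] phi /=.
  by move=> cphi cf x Ux; apply: continuous_comp; [exact: cf|exact/cphi/fA].
case=> phi' dphi Cphi' [df Df].
have dphix x : U x -> differentiable phi (f x).
  by move=> Ux; apply/derivable1_diffP; have [] := dphi _ (fA _ Ux).
split=> [x Ux|v].
  by apply: differentiable_comp; [exact: df|exact: dphix].
have Cf : Ck k U f by apply: CkW.
apply: (Ck_ext oU _ (CkM oU (IH _ Cphi' Cf) (Df v))) => x Ux.
rewrite (deriveE _ (differentiable_comp (df x Ux) (dphix _ Ux))).
rewrite (diff_comp (df x Ux) (dphix _ Ux)) /= deriv1E; last first.
  by have [] := dphi _ (fA _ Ux).
rewrite -(deriveE _ (df x Ux)) derive1E.
by have [_ ->] := dphi _ (fA _ Ux); rewrite mulrC.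
Qed.

End Ck_calculus.

Lemma Ck_coord (R : realType) D k (U : set 'rV[R]_D) (i : 'I_D) : open U ->
  Ck k U (fun x : 'rV[R]_D => x 0 i).
Proof.
move=> oU; case: k => [|k] /=; first by move=> x _; exact: coord_continuous.
have dc x : differentiable (fun x : 'rV[R]_D => x 0 i) x.
  exact: differentiable_coord.
split=> // v; apply: (Ck_ext oU _ (Ck_cst _ _ (v 0 i))) => x Ux.
apply/esym/cvg_lim => //; apply: cvg_near_cst; near=> h.
rewrite /= !mxE addrK /GRing.scale/= mulrA mulVf ?mul1r//.
near: h; exact: nbhs_dnbhs_neq.
Unshelve. all: by end_near. Qed.

Lemma Ck_onP (R : realType) D D' k (U : set 'rV[R]_D)
    (f : 'rV[R]_D -> 'rV[R]_D') : open U ->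
  (forall j, Ck k U (fun x => f x 0 j)) -> Ck_on k U f.
Proof.
move=> oU Cf.
have : Ck k U (fun x => \sum_j f x 0 j *: ('e_j : 'rV[R]_D')).
  by apply: Ck_sum => // j _; apply: CkZl.
rewrite (_ : (fun _ => _) = f); last first.
  by apply/funext => x; rewrite -row_sum_delta.
elim: k {Cf} f => [|k IH] f //= [df Df]; split => // v; exact: IH.
Qed.

(** * Euclidean geometry of row vectors *)

Lemma sum_cauchy_schwarz (R : realType) (I : finType) (P : pred I) (a b : I -> R) :
  (\sum_(i | P i) a i * b i) ^+ 2 <=
  (\sum_(i | P i) a i ^+ 2) * (\sum_(i | P i) b i ^+ 2).
Proof.
set A := \sum_(i | P i) a i ^+ 2; set B := \sum_(i | P i) b i ^+ 2.
set C := \sum_(i | P i) a i * b i.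
have B0 : 0 <= B by apply: sumr_ge0 => i _; exact: sqr_ge0.
(* Multiplying the discriminant by B makes it a sum of squares. *)
have H : 0 <= B * (A * B - C ^+ 2).
  have -> : B * (A * B - C ^+ 2) = \sum_(i | P i) (B * a i - C * b i) ^+ 2.
    have -> : \sum_(i | P i) (B * a i - C * b i) ^+ 2 =
        \sum_(i | P i) (B ^+ 2 * a i ^+ 2 - (2 * B * C) * (a i * b i) + C ^+ 2 * b i ^+ 2).
      by apply: eq_bigr => i _; ring.
    by rewrite big_split/= sumrB -!mulr_sumr -/A -/B -/C; ring.
  by apply: sumr_ge0 => i _; exact: sqr_ge0.
have [Bpos|] := ltP 0 B; first by move: H; rewrite pmulr_rge0// subr_ge0.
move=> Ble0; have {Ble0}B00 : B = 0 by apply/eqP; rewrite eq_le Ble0 B0.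
have bz i : P i -> b i = 0.
  move=> Pi; apply/eqP; rewrite -sqrf_eq0.
  by move: B00 => /psumr_eq0P => -> // j _; exact: sqr_ge0.
have -> : C = 0 by apply: big1 => i Pi; rewrite bz// mulr0.
by rewrite B00 mulr0 expr0n.
Qed.

Section euclidean.
Context (R : realType) (D : nat).
Implicit Types x y z : 'rV[R]_D.

Definition dotv x y : R := \sum_i x 0 i * y 0 i.

Lemma dotvC x y : dotv x y = dotv y x.
Proof. by apply: eq_bigr => i _; rewrite mulrC. Qed.

Lemma dotvDl x y z : dotv (x + y) z = dotv x z + dotv y z.
Proof. by rewrite -big_split/=; apply: eq_bigr => i _; rewrite mxE mulrDl. Qed.

Lemma dotvDr x y z : dotv z (x + y) = dotv z x + dotv z y.
Proof. by rewrite dotvC dotvDl ![dotv _ z]dotvC. Qed.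

Lemma dotvZl k x y : dotv (k *: x) y = k * dotv x y.
Proof. by rewrite mulr_sumr; apply: eq_bigr => i _; rewrite mxE mulrA. Qed.

Lemma dotvZr k x y : dotv x (k *: y) = k * dotv x y.
Proof. by rewrite dotvC dotvZl dotvC. Qed.

Lemma dotvNl x y : dotv (- x) y = - dotv x y.
Proof. by rewrite -scaleN1r dotvZl mulN1r. Qed.

Lemma dotvNr x y : dotv x (- y) = - dotv x y.
Proof. by rewrite dotvC dotvNl dotvC. Qed.

Lemma dotv_sqB x y : dotv (x - y) (x - y) = dotv x x - 2 * dotv x y + dotv y y.
Proof. by rewrite dotvDl !dotvDr !dotvNl !dotvNr (dotvC y); ring. Qed.

Definition dotvE := (dotvDl, dotvDr, dotvZl, dotvZr, dotvNl, dotvNr).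

Lemma dotv_sqE x : dotv x x = \sum_i x 0 i ^+ 2.
Proof. by []. Qed.

Lemma dotv_ge0 x : 0 <= dotv x x.
Proof. by rewrite dotv_sqE; apply: sumr_ge0 => i _; exact: sqr_ge0. Qed.

Lemma dotv_eq0 x : (dotv x x == 0) = (x == 0).
Proof.
apply/idP/eqP => [/eqP|->]; last first.
  by rewrite /dotv big1// => i _; rewrite mxE mul0r.
rewrite dotv_sqE => /psumr_eq0P H; apply/rowP => i; rewrite mxE.
by apply/eqP; rewrite -sqrf_eq0 H// => j _; exact: sqr_ge0.
Qed.

Lemma dotv_gt0 x : (0 < dotv x x) = (x != 0).
Proof. by rewrite lt0r dotv_ge0 andbT dotv_eq0. Qed.

Lemma enormE x : enorm x = Num.sqrt (dotv x x).
Proof. by rewrite dotv_sqE. Qed.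

Lemma enorm_ge0 x : 0 <= enorm x.
Proof. exact: sqrtr_ge0. Qed.

Lemma enorm_sq x : enorm x ^+ 2 = dotv x x.
Proof. by rewrite enormE sqr_sqrtr ?dotv_ge0. Qed.

Lemma enorm_eq0 x : (enorm x == 0) = (x == 0).
Proof. by rewrite -sqrf_eq0 enorm_sq dotv_eq0. Qed.

Lemma dotv_cauchy x y : dotv x y ^+ 2 <= dotv x x * dotv y y.
Proof. exact: sum_cauchy_schwarz. Qed.

Lemma dotv_le_enorm x y : dotv x y <= enorm x * enorm y.
Proof.
rewrite (le_trans (ler_norm _))// -(@ler_pXn2r _ 2)// ?nnegrE ?mulr_ge0 ?enorm_ge0//.
by rewrite exprMn !enorm_sq real_normK ?num_real// dotv_cauchy.
Qed.

Lemma enormD x y : enorm (x + y) <= enorm x + enorm y.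
Proof.
rewrite -(@ler_pXn2r _ 2)// ?nnegrE ?addr_ge0 ?enorm_ge0//.
rewrite sqrrD !enorm_sq !dotvE (dotvC y x).
by have := dotv_le_enorm x y; lra.
Qed.

Lemma enorm_triangle x y z : enorm (x - z) <= enorm (x - y) + enorm (y - z).
Proof. by apply: le_trans (enormD _ _); rewrite addrA subrK. Qed.

Lemma coord_le_enorm x i : `|x 0 i| <= enorm x.
Proof.
rewrite -sqrtr_sqr ler_wsqrtr// (bigD1 i)//=.
by rewrite lerDl sumr_ge0// => *; exact: sqr_ge0.
Qed.

Lemma enorm_le_sum x : enorm x <= \sum_i `|x 0 i|.
Proof.
have s0 : 0 <= \sum_i `|x 0 i| by apply: sumr_ge0.
rewrite -(@ler_pXn2r _ 2)// ?nnegrE ?enorm_ge0// enorm_sq dotv_sqE.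
rewrite expr2 mulr_suml; apply: ler_sum => i _.
rewrite -(real_normK (num_real (x 0 i))) expr2 ler_wpM2l//.
by rewrite (bigD1 i)//= lerDl sumr_ge0.
Qed.

End euclidean.

(** * The truncated cube, a profile of class C^2 *)

Definition posp (R : realType) (t : R) : R := Num.max 0 t.

Lemma posp_ge0 (R : realType) (t : R) : 0 <= posp t.
Proof. by rewrite /posp le_max lexx. Qed.

Lemma pospE (R : realType) (t : R) : 0 <= t -> posp t = t.
Proof. by move=> t0; rewrite /posp max_r. Qed.

Lemma posp0 (R : realType) (t : R) : t <= 0 -> posp t = 0.
Proof. by move=> t0; rewrite /posp max_l. Qed.

(** For N = |a|^2, q = <a, h> and H = |h|^2 this is a second-order Taylor estimate
    for a |-> posp (1 - |a|^2)^3, with a remainder that is linear in H and uniform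
    in a.  Inside the unit ball it is an expansion of polynomials.  When the segment
    crosses the unit sphere, the values on the inner side are themselves small,
    because 1 - N is at most the increment 2 q + H of the squared norm. *)
Lemma posp_cube_taylor (R : realType) (N q H : R) :
  0 <= N -> 0 <= N + 2 * q + H -> 0 <= H -> q ^+ 2 <= N * H ->
  `|posp (1 - (N + 2 * q + H)) ^+ 3 - posp (1 - N) ^+ 3
    + 6 * posp (1 - N) ^+ 2 * q| <= 70 * H.
Proof.
(* The crossing case, seen from the inner endpoint: 1 - N' is at most
   2 q' + H', hence its square is of order H'. *)
have cut (N' q' H' : R) : 0 <= N' -> 0 <= H' -> q' ^+ 2 <= N' * H' -> N' <= 1 ->
    1 <= N' + 2 * q' + H' ->
    (1 - N') ^+ 3 <= 10 * H' /\ (1 - N') ^+ 2 * `|q'| <= 10 * H'.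
  move=> N0 H0 qNH N1 N2.
  have qH : q' ^+ 2 <= H' by nra.
  have p0 : 0 <= 1 - N' by lra.
  have p1 : 1 - N' <= 1 by lra.
  have p32 : (1 - N') ^+ 3 <= (1 - N') ^+ 2.
    by rewrite exprS ler_piMl// sqr_ge0.
  have p21 : (1 - N') ^+ 2 <= 1 by rewrite exprn_ile1.
  have [H1|H1] := leP 1 H'.
    have q1 : `|q'| <= H'.
      rewrite -(@ler_pXn2r _ 2)// ?nnegrE// (real_normK (num_real _)); nra.
    split; first lra.
    have : (1 - N') ^+ 2 * `|q'| <= `|q'| by rewrite ler_piMl.
    lra.
  have p2 : (1 - N') ^+ 2 <= 10 * H'.
    apply: (@le_trans _ _ ((2 * q' + H') ^+ 2)).
      by rewrite ler_pXn2r// ?nnegrE; lra.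
    have HH : H' ^+ 2 <= H' by rewrite expr2 ler_piMl// ltW.
    by have := sqr_ge0 (2 * q' - H'); rewrite !expr2 in qH HH *; lra.
  have q1 : `|q'| <= 1.
    rewrite -(@ler_pXn2r _ 2)// ?nnegrE// (real_normK (num_real _)) expr1n; lra.
  split; first lra.
  have : (1 - N') ^+ 2 * `|q'| <= (1 - N') ^+ 2 by rewrite ler_piMr// sqr_ge0.
  lra.
move=> N0; set N' := N + 2 * q + H => N'0 H0 qNH.
have [N1|N1] := leP N 1; have [N'1|N'1] := leP N' 1.
- rewrite !pospE ?subr_ge0//.
  have q2 : `|q| <= N + H / 4.
    rewrite -(@ler_pXn2r _ 2)// ?nnegrE// ?(real_normK (num_real _)); [|lra].
    have := sqr_ge0 (N - H / 4); nra.
  have H4 : H <= 4 by move: N'1 q2; rewrite /N' ler_norml => N'1 /andP[]; lra.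
  have u2 : (2 * q + H) ^+ 2 <= 16 * H by have := sqr_ge0 (2 * q - H); nra.
  have -> : (1 - N') ^+ 3 - (1 - N) ^+ 3 + 6 * (1 - N) ^+ 2 * q =
     - 3 * (1 - N) ^+ 2 * H + (2 * q + H) ^+ 2 * (2 * (1 - N) + (1 - N')).
    by rewrite /N'; ring.
  have p2 : (1 - N) ^+ 2 <= 1 by rewrite exprn_ile1//; lra.
  have : 0 <= (2 * q + H) ^+ 2 * (2 * (1 - N) + (1 - N')).
    by rewrite mulr_ge0 ?sqr_ge0//; lra.
  have : (2 * q + H) ^+ 2 * (2 * (1 - N) + (1 - N')) <= (2 * q + H) ^+ 2 * 3.
    by apply: ler_wpM2l; [exact: sqr_ge0|lra].
  have : (1 - N) ^+ 2 * H <= H by rewrite ler_piMl.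
  have : 0 <= (1 - N) ^+ 2 * H by rewrite mulr_ge0 ?sqr_ge0.
  rewrite ler_norml.
  rewrite -mulrA; move: ((1 - N) ^+ 2 * H) => X.
  move: ((2 * q + H) ^+ 2) u2 => u u2.
  move: (u * (2 * (1 - N) + (1 - N'))) => Y X0 XH Y3 Y0; lra.
- rewrite (@pospE _ (1 - N)) ?subr_ge0// (@posp0 _ (1 - N')); [|lra].
  have [h1 h2] := cut N q H N0 H0 qNH N1 (ltW N'1).
  have h3 : 0 <= (1 - N) ^+ 3 by rewrite exprn_ge0// subr_ge0.
  rewrite expr0n/= sub0r (le_trans (ler_normD _ _))// normrN (ger0_norm h3).
  rewrite normrM (ger0_norm (_ : 0 <= 6 * (1 - N) ^+ 2)) ?mulr_ge0 ?sqr_ge0 ?subr_ge0//.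
  by rewrite -mulrA; lra.
- rewrite (@pospE _ (1 - N')) ?subr_ge0// (@posp0 _ (1 - N)); [|lra].
  have q'NH : (- (q + H)) ^+ 2 <= N' * H.
    have -> : (- (q + H)) ^+ 2 = q ^+ 2 + (2 * q + H) * H by ring.
    have -> : N' * H = N * H + (2 * q + H) * H by rewrite /N'; ring.
    by rewrite lerD2r.
  have N'2 : 1 <= N' + 2 * (- (q + H)) + H by rewrite /N'; lra.
  have [h1 h2] := cut N' (- (q + H)) H N'0 H0 q'NH N'1 N'2.
  have h3 : 0 <= (1 - N') ^+ 3 by rewrite exprn_ge0// subr_ge0.
  by rewrite !expr0n/= mulr0 mul0r addr0 subr0 ger0_norm//; lra.
- rewrite !posp0; [|lra|lra].
  by rewrite !expr0n/= subr0 mulr0 mul0r addr0 normr0; lra.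
Qed.

Lemma posp_continuous (R : realType) : continuous (@posp R).
Proof. by move=> t; apply: continuous_max; [exact: cst_continuous|exact: cvg_id]. Qed.

(** At t = 0 both one-sided quotients are O(|h|^(n+1)), so the two pieces fit
    together. *)
Lemma posp_exp_is_derive (R : realType) (n : nat) (t : R) :
  is_derive t (1 : R) (fun t => posp t ^+ n.+2) (n.+2%:R * posp t ^+ n.+1).
Proof.
have [t0|t0|->] := ltgtP t 0.
- rewrite (posp0 (ltW t0)) expr0n mulr0.
  apply: near_eq_is_derive _ (is_derive_cst 0 t 1).
  near=> s; rewrite posp0 ?expr0n//; apply/ltW.
  by near: s; exact: lt_nbhsl.
- rewrite (pospE (ltW t0)).
  have dX : is_derive t (1 : R) (fun s => s ^+ n.+2) (n.+2%:R * t ^+ n.+1).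
    apply: DeriveDef; first exact: exprn_derivable.
    by rewrite exp_derive /GRing.scale/= mulr1.
  apply: near_eq_is_derive _ dX.
  by near=> s; rewrite pospE//; apply/ltW; near: s; exact: lt_nbhsr.
- rewrite posp0// expr0n mulr0.
  have lim0 : (fun h : R => h^-1 *: (((fun t => posp t ^+ n.+2) \o shift 0) (h *: 1)
     - posp 0 ^+ n.+2)) @ 0^' --> (0 : R).
    apply/cvgr0Pnorm_le => e e0; near=> h.
    rewrite /= addr0 [_ *: 1]mulr1 (@posp0 _ 0)// expr0n subr0 /GRing.scale/= normrM normfV.
    have hn : `|posp h| <= `|h|.
      have [h0|h0] := leP 0 h; first by rewrite pospE.
      by rewrite posp0 ?normr0// ltW.
    have h0 : 0 < `|h| by rewrite normr_gt0; near: h; exact: nbhs_dnbhs_neq.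
    rewrite mulrC ler_pdivrMr// normrX exprS mulrC ler_pM ?exprn_ge0//.
    rewrite exprS; apply: (@le_trans _ _ (`|h| * 1)).
      rewrite ler_pM ?exprn_ge0// exprn_ile1//; apply: le_trans hn _.
      by near: h; apply: dnbhs0_le.
    by rewrite mulr1; near: h; apply: dnbhs0_le.
  by apply: DeriveDef; [apply/cvg_ex; exists 0|exact/cvg_lim].
Unshelve. all: by end_near. Qed.

Lemma C1k_posp_cube (R : realType) (A : set R) : C1k 2 A (fun t => posp t ^+ 3).
Proof.
exists (fun t => 3%:R * posp t ^+ 2) => [t _|]; first exact: posp_exp_is_derive.
exists (fun t => 3%:R * (2%:R * posp t)) => [t _|t _].
  have := posp_exp_is_derive 0 t; rewrite expr1 => H.
  exact: (@is_deriveZ _ _ _ _ 3%:R _ _ _ H).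
apply: continuousM; first exact: cst_continuous.
by apply: continuousM; [exact: cst_continuous|exact: posp_continuous].
Qed.

Lemma is_derive_inv (R : realType) (f : R -> R) (t df : R) : f t != 0 ->
  is_derive t (1 : R) f df ->
  is_derive t (1 : R) (fun s => (f s)^-1) (- (f t) ^- 2 * df).
Proof.
move=> ft0 [dd dv]; apply: DeriveDef; first exact: derivableV.
by rewrite -[in RHS]dv; exact: (deriveV ft0 dd).
Qed.

Lemma C1k_sqrt (R : realType) : C1k 2 [set t : R | 0 < t] Num.sqrt.
Proof.
exists (fun t => (2 * Num.sqrt t)^-1) => [t /= t0|]; first exact: is_derive1_sqrt.
have s0 (t : R) : 0 < t -> 2 * Num.sqrt t != 0 :> R.
  by move=> t0; rewrite mulf_neq0// gt_eqF// sqrtr_gt0.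
exists (fun t => - (2 * Num.sqrt t) ^- 2 * (2 * (2 * Num.sqrt t)^-1)) => [t /= t0|t /= t0].
  have d1 : is_derive t (1 : R) (fun t => 2 * Num.sqrt t) (2 * (2 * Num.sqrt t)^-1).
    exact: (@is_deriveZ _ _ _ _ 2 _ _ _ (is_derive1_sqrt t0)).
  exact: (@is_derive_inv R (fun t => 2 * Num.sqrt t) t _ (s0 _ t0) d1).
have cs : {for t, continuous (fun t : R => 2 * Num.sqrt t)}.
  by apply: continuousM; [exact: cst_continuous|exact: sqrt_continuous].
apply: continuousM.
  apply: continuousN; apply: continuousV; first by rewrite expf_neq0// s0.
  by rewrite (_ : (fun _ => _) = (fun t => (2 * Num.sqrt t) * (2 * Num.sqrt t))) //; apply: continuousM.
apply: continuousM; first exact: cst_continuous.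
by apply: continuousV => //; exact: s0.
Qed.

(** * The bumped sphere as a level set *)

Section profile.
Context (R : realType) (D : nat).
Notation E := 'rV[R]_D.+1.
Implicit Types (x y z h : E) (c dl r : R).

Definition tailsq x : R := \sum_(i | i != ord0) x 0 i ^+ 2.

(** The bump is dl^2 times a fixed profile of N / dl^2, where N stands for a squared
    length: its second derivatives do not depend on dl, only on c. *)
Definition pbump c dl (N : R) : R := c * dl ^+ 2 * posp (1 - N / dl ^+ 2) ^+ 3.

Definition lvl c dl r x : R := dotv x x - 2 * pbump c dl (tailsq x) - r ^+ 2.

Definition lvlgrad c dl x : E :=
  \row_i ((2 + if i == ord0 then 0 else
    12 * c * posp (1 - tailsq x / dl ^+ 2) ^+ 2) * x 0 i).

Lemma tailsq_ge0 x : 0 <= tailsq x.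
Proof. by apply: sumr_ge0 => i _; exact: sqr_ge0. Qed.

Lemma dotv_split x : dotv x x = x 0 ord0 ^+ 2 + tailsq x.
Proof. by rewrite dotv_sqE (bigD1 ord0). Qed.

Lemma tailsqD x h : tailsq (x + h) =
  tailsq x + 2 * (\sum_(i | i != ord0) x 0 i * h 0 i) + tailsq h.
Proof.
rewrite /tailsq mulr_sumr -!big_split/=; apply: eq_bigr => i _.
by rewrite mxE; ring.
Qed.

Section pbump.
Context (c dl : R) (c0 : 0 <= c) (dl0 : 0 < dl).

Lemma pbump_ge0 N : 0 <= pbump c dl N.
Proof. by rewrite mulr_ge0 ?exprn_ge0 ?posp_ge0// mulr_ge0 ?sqr_ge0. Qed.

Lemma pbump_le N : 0 <= N -> pbump c dl N <= c * dl ^+ 2.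
Proof.
move=> N0; have d20 : 0 <= dl ^+ 2 := sqr_ge0 _.
apply: ler_piMr; first exact: mulr_ge0.
apply: exprn_ile1; first exact: posp_ge0.
by rewrite /posp ge_max ler01 lerBlDr lerDl divr_ge0.
Qed.

Lemma pbump_far N : dl ^+ 2 <= N -> pbump c dl N = 0.
Proof.
move=> N1; rewrite /pbump posp0 ?expr0n ?mulr0//.
by rewrite subr_le0 ler_pdivlMr ?exprn_gt0// mul1r.
Qed.

Lemma pbump0 : pbump c dl 0 = c * dl ^+ 2.
Proof. by rewrite /pbump mul0r subr0 pospE// expr1n mulr1. Qed.

(** The profile is decreasing with slope at most 3, since |p^3 - q^3| <= 3 |p - q|
    on [0, 1]. *)
Lemma pbump_mono N N' : 0 <= N -> N <= N' ->
  0 <= pbump c dl N - pbump c dl N' <= 3 * c * (N' - N).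
Proof.
move=> N0 NN'; have d20 : 0 < dl ^+ 2 by rewrite exprn_gt0.
set p := posp (1 - N / dl ^+ 2); set p' := posp (1 - N' / dl ^+ 2).
have p'0 : 0 <= p' := posp_ge0 _.
have p1 : p <= 1.
  by rewrite /p /posp ge_max ler01 lerBlDr lerDl divr_ge0// ltW.
have pp' : p' <= p.
  rewrite /p /p' /posp ge_max !le_max lexx/= lerD2l lerN2 ler_pM2r ?invr_gt0//.
  by rewrite NN' orbT.
have dpp' : p - p' <= (N' - N) / dl ^+ 2.
  rewrite mulrBl /p /p' /posp; case: (leP 0 (1 - N / dl ^+ 2)) => h1;
    case: (leP 0 (1 - N' / dl ^+ 2)) => h2; rewrite ?(max_r h1) ?(max_l (ltW h1)).
  - lra.
  - lra.
  - move: h1 h2; have : N / dl ^+ 2 <= N' / dl ^+ 2 by rewrite ler_pM2r ?invr_gt0.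
    lra.
  - have : N / dl ^+ 2 <= N' / dl ^+ 2 by rewrite ler_pM2r ?invr_gt0.
    lra.
have cd0 : 0 <= c * dl ^+ 2 by rewrite mulr_ge0// ltW.
rewrite /pbump -mulrBr.
have -> : p ^+ 3 - p' ^+ 3 = (p - p') * (p ^+ 2 + p * p' + p' ^+ 2) by ring.
have q3 : 0 <= p ^+ 2 + p * p' + p' ^+ 2 <= 3 by nra.
have [q30 q31] := andP q3.
rewrite [X in X && _]mulr_ge0//=; last by rewrite mulr_ge0// subr_ge0.
have -> : 3 * c * (N' - N) = c * dl ^+ 2 * ((N' - N) / dl ^+ 2 * 3).
  by field; rewrite gt_eqF.
by rewrite ler_wpM2l// ler_pM ?subr_ge0.
Qed.

End pbump.

Section level.
Context (c dl r : R) (c0 : 0 <= c) (cle : c <= 1 / 280) (dl0 : 0 < dl).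
Local Notation F := (lvl c dl r).
Local Notation G := (lvlgrad c dl).

Lemma dotv_lvlgrad x h : dotv (G x) h = 2 * dotv x h +
  12 * c * posp (1 - tailsq x / dl ^+ 2) ^+ 2 *
    \sum_(i | i != ord0) x 0 i * h 0 i.
Proof.
rewrite /dotv (bigD1 ord0)//= [in RHS](bigD1 ord0)//= mxE eqxx addr0.
under eq_bigr => i i0 do rewrite mxE (negbTE i0).
rewrite [in RHS]mulrDr -[in RHS]addrA; congr (_ + _); first by rewrite mulrA.
rewrite !mulr_sumr -big_split/=; apply: eq_bigr => i _; ring.
Qed.

(** The remainder of |x|^2 is |h|^2 exactly.  By scaling, [posp_cube_taylor] bounds
    that of twice the bump by 2 * 70 c |h|^2, which is at most |h|^2 / 2 for
    c <= 1/280. *)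
Lemma lvl_taylor x h :
  dotv h h / 2 <= F (x + h) - F x - dotv (G x) h <= 3 / 2 * dotv h h.
Proof.
have d20 : 0 < dl ^+ 2 by rewrite exprn_gt0.
rewrite dotv_lvlgrad /lvl !dotvE (dotvC h x) tailsqD.
set q := \sum_(i | i != ord0) _; set N := tailsq x; set H := tailsq h.
have Hle : H <= dotv h h by rewrite dotv_split lerDr sqr_ge0.
have H0 : 0 <= H := tailsq_ge0 h.
have := @posp_cube_taylor R (N / dl ^+ 2) (q / dl ^+ 2) (H / dl ^+ 2).
have -> : N / dl ^+ 2 + 2 * (q / dl ^+ 2) + H / dl ^+ 2 = (N + 2 * q + H) / dl ^+ 2.
  by rewrite !mulrDl mulrA.
have N'0 : 0 <= N + 2 * q + H by rewrite -tailsqD tailsq_ge0.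
rewrite !divr_ge0 ?tailsq_ge0// ?(ltW d20)// => /(_ isT isT isT).
have cs : (q / dl ^+ 2) ^+ 2 <= N / dl ^+ 2 * (H / dl ^+ 2).
  have -> : N / dl ^+ 2 * (H / dl ^+ 2) = (N * H) / (dl ^+ 2) ^+ 2.
    by field; rewrite gt_eqF.
  rewrite expr_div_n ler_pM2r ?invr_gt0 ?exprn_gt0//.
  exact: sum_cauchy_schwarz.
move=> /(_ cs); rewrite /pbump.
set p := posp (1 - N / dl ^+ 2); set p' := posp (1 - (N + 2 * q + H) / dl ^+ 2) => hh.
have e1 : `|c * dl ^+ 2 * (p' ^+ 3 - p ^+ 3 + 6 * p ^+ 2 * (q / dl ^+ 2))| <= H / 4.
  rewrite normrM ger0_norm; last by rewrite mulr_ge0// ltW.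
  apply: (@le_trans _ _ (c * dl ^+ 2 * (70 * (H / dl ^+ 2)))).
    by rewrite ler_wpM2l// mulr_ge0// ltW.
  have -> : c * dl ^+ 2 * (70 * (H / dl ^+ 2)) = c * 70 * H by field; rewrite gt_eqF.
  have -> : H / 4 = (1 / 280) * 70 * H by field.
  by rewrite ler_wpM2r// ler_wpM2r.
move: e1.
have -> : c * dl ^+ 2 * (p' ^+ 3 - p ^+ 3 + 6 * p ^+ 2 * (q / dl ^+ 2)) =
   c * dl ^+ 2 * p' ^+ 3 - c * dl ^+ 2 * p ^+ 3 + 6 * c * p ^+ 2 * q.
  by field; rewrite gt_eqF.
rewrite ler_norml => /andP[].
move: (c * dl ^+ 2 * p' ^+ 3) (c * dl ^+ 2 * p ^+ 3) => b' b.
have -> : 12 * c * p ^+ 2 * q = 2 * (6 * c * p ^+ 2 * q) by ring.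
move: (6 * c * p ^+ 2 * q) => w w1 w2.
move: Hle; move: (dotv h h) (dotv x h) (dotv x x) => hh' xh xx Hle.
lra.
Qed.

(** Each coordinate of the gradient is a multiple at least 2 of that of x: the bump
    decreases away from the axis, and only adds to the radial growth. *)
Lemma lvlgrad_ge x : 4 * dotv x x <= dotv (G x) (G x).
Proof.
rewrite !dotv_sqE mulr_sumr; apply: ler_sum => i _; rewrite mxE exprMn.
rewrite ler_wpM2r ?sqr_ge0//.
have : 0 <= (if i == ord0 then 0 else 12 * c * posp (1 - tailsq x / dl ^+ 2) ^+ 2).
  by case: ifP => // _; rewrite mulr_ge0 ?sqr_ge0 ?mulr_ge0.
move: (if _ then _ else _) => w w0; nra.
Qed.

Lemma lvl0_norm x : F x = 0 -> r ^+ 2 <= dotv x x.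
Proof.
move=> Fx; have : 0 <= pbump c dl (tailsq x) by exact: pbump_ge0.
by move: Fx; rewrite /lvl; lra.
Qed.

Lemma lvl_norm_le x : F x <= 0 -> dotv x x <= r ^+ 2 + 2 * c * dl ^+ 2.
Proof.
move=> Fx; have : pbump c dl (tailsq x) <= c * dl ^+ 2 by apply: pbump_le => //; exact: tailsq_ge0.
by move: Fx; rewrite /lvl; lra.
Qed.

Lemma lvlgrad_norm x : 0 <= r -> F x = 0 -> 2 * r <= enorm (G x).
Proof.
move=> r0 /lvl0_norm xr; rewrite -(@ler_pXn2r _ 2)// ?nnegrE ?enorm_ge0//; last lra.
by rewrite enorm_sq (le_trans _ (lvlgrad_ge x))// exprMn; lra.
Qed.

(** Strong convexity: the lower half of [lvl_taylor] at the intermediate point,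
    applied towards both ends; the gradient terms cancel in the barycentre. *)
Lemma lvl_midpoint x y (t : R) : 0 <= t <= 1 ->
  F (x + t *: (y - x)) <= (1 - t) * F x + t * F y
     - t * (1 - t) / 2 * dotv (y - x) (y - x).
Proof.
move=> /andP[t0 t1]; set w := x + t *: (y - x).
have := lvl_taylor w ((- t) *: (y - x)).
have := lvl_taylor w ((1 - t) *: (y - x)).
have -> : w + (1 - t) *: (y - x) = y.
  by rewrite /w -addrA -scalerDl addrC subrKC scale1r subrK.
have -> : w + (- t) *: (y - x) = x.
  by rewrite /w -addrA -scalerDl subrr scale0r addr0.
rewrite !dotvZl !dotvZr.
move: (dotv (G w) _) (dotv (y - x) (y - x)) (F w) (F x) (F y) => g e fw fx fy.
move=> /andP[h1 _] /andP[h2 _]; nra.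
Qed.

Lemma Ck_tailsq (U : set E) (A : E -> E) : open U ->
  (forall i, Ck 2 U (fun u => A u 0 i)) -> Ck 2 U (fun u => tailsq (A u)).
Proof. by move=> oU CA; apply: Ck_sum => // i _; exact: CkM. Qed.

Lemma Ck_pbump (U : set E) (A : E -> E) : open U ->
  (forall i, Ck 2 U (fun u => A u 0 i)) ->
  Ck 2 U (fun u => pbump c dl (tailsq (A u))).
Proof.
move=> oU CA; apply: CkM => //; first exact: Ck_cst.
apply: (@Ck_comp _ _ 2 U setT (fun t => posp t ^+ 3)) => //.
  exact: C1k_posp_cube.
apply: CkD => //; first exact: Ck_cst.
have : Ck 2 U (fun u => (- (dl ^+ 2)^-1) * tailsq (A u)).
  by apply: CkM => //; [exact: Ck_cst|exact: Ck_tailsq].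
by apply: Ck_ext => // x _; rewrite mulNr mulrC.
Qed.

Lemma continuous_tailsq : continuous tailsq.
Proof.
move=> x; have : Ck 2 setT (fun u => tailsq (id u)).
  by apply: Ck_tailsq => [|i]; [exact: openT|exact/Ck_coord/openT].
by move/CkW/CkW; exact.
Qed.

Lemma continuous_pbump : continuous (fun x => pbump c dl (tailsq x)).
Proof.
move=> x; have : Ck 2 setT (fun u => pbump c dl (tailsq (id u))).
  by apply: Ck_pbump => [|i]; [exact: openT|exact/Ck_coord/openT].
by move/CkW/CkW; exact.
Qed.

Lemma continuous_dotv : continuous (fun x => dotv x x).
Proof.
move=> x; have : Ck 0 [set: E] (fun x => dotv x x).
  by apply: Ck_sum => [|i _]; [exact: openT|apply: CkM; [exact: openT|exact/Ck_coord/openT..]].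
exact.
Qed.

Lemma continuous_lvl : continuous F.
Proof.
move=> x; have : Ck 0 [set: E] F.
  apply: CkD; [exact: openT| |exact: Ck_cst].
  apply: CkD; [exact: openT|by move=> y _; exact: continuous_dotv|].
  have : Ck 0 [set: E] (fun x => -2 * pbump c dl (tailsq x)).
    apply: CkM; [exact: openT|exact: Ck_cst|].
    by move=> y _; exact: continuous_pbump.
  by apply: Ck_ext => [|y _]; [exact: openT|rewrite mulNr].
exact.
Qed.

End level.
End profile.

(** * Reach of the bumped sphere and of the body that it bounds *)

Section reach.
Context (R : realType) (D m : nat).
Notation E := 'rV[R]_D.+1.
Implicit Types (x y z h : E).

(** The bumped sphere and the convex body that it bounds, inside the space of the
    first m coordinates. *)
Definition surf (c dl r : R) : set E := [set x | flat_model m x /\ lvl c dl r x = 0].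
Definition body (c dl r : R) : set E := [set x | flat_model m x /\ lvl c dl r x <= 0].

Lemma flatD x y : flat_model m x -> flat_model m y -> flat_model m (x + y).
Proof. by move=> fx fy i mi; rewrite mxE fx// fy// addr0. Qed.

Lemma flatZ (k : R) x : flat_model m x -> flat_model m (k *: x).
Proof. by move=> fx i mi; rewrite mxE fx// mulr0. Qed.

Lemma flatB x y : flat_model m x -> flat_model m y -> flat_model m (x - y).
Proof. by move=> fx fy i mi; rewrite !mxE fx// fy// subr0. Qed.

Lemma flat_segment x y (t : R) : flat_model m x -> flat_model m y ->
  flat_model m (x + t *: (y - x)).
Proof. by move=> fx fy; apply/flatD/flatZ/flatB. Qed.

Definition flat_proj z : E := \row_i (if (i < m)%N then z 0 i else 0).

Lemma flat_proj_flat z : flat_model m (flat_proj z).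
Proof. by move=> i mi; rewrite mxE ltnNge mi. Qed.

Lemma flat_pythagoras z w : flat_model m w ->
  dotv (z - w) (z - w) = dotv (flat_proj z - w) (flat_proj z - w) +
     dotv (z - flat_proj z) (z - flat_proj z).
Proof.
move=> fw; rewrite /dotv -big_split/=; apply: eq_bigr => i _; rewrite !mxE.
have [im|mi] := ltnP i m; first by rewrite subrr mulr0 addr0.
by rewrite fw// !subr0 mulr0 add0r.
Qed.

Lemma segment_lvl_zero (c dl r : R) x y : 0 <= c -> 0 < dl ->
  lvl c dl r x < 0 -> 0 < lvl c dl r y ->
  exists2 t : R, 0 < t < 1 & lvl c dl r (x + t *: (y - x)) = 0.
Proof.
move=> c0 dl0 Fx Fy.
have cf : continuous (fun t : R => lvl c dl r (x + t *: (y - x))).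
  move=> t; apply: (@continuous_comp _ _ _ (fun t : R => x + t *: (y - x))).
    by apply: continuousD; [exact: cst_continuous|apply: continuousZl; exact: cvg_id].
  exact: continuous_lvl.
have := @IVT R (fun t : R => lvl c dl r (x + t *: (y - x))) 0 1 0 ler01.
rewrite scale0r addr0 scale1r subrKC ge_min le_max (ltW Fx) (ltW Fy) orbT => /(_ _ isT).
case=> [|t]; first exact: continuous_subspaceT.
rewrite in_itv/= => /andP[t0 t1] Ft; exists t => //.
rewrite !lt_neqAle t0 t1 !andbT; apply/andP; split; apply/eqP => tE.
  by move: Ft Fx; rewrite -tE scale0r addr0 => ->; rewrite ltxx.
by move: Ft Fy; rewrite tE scale1r subrKC => ->; rewrite ltxx.
Qed.

Lemma nearest_le (S : set E) z x w : Defs.edist z S = (enorm (z - x))%:E -> S w ->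
  dotv (z - x) (z - x) <= dotv (z - w) (z - w).
Proof.
move=> zx Sw; rewrite -!enorm_sq ler_pXn2r ?nnegrE ?enorm_ge0//.
by rewrite -lee_fin -zx; apply: ereal_inf_lbound; exists w.
Qed.

(** Suppose that z has two nearest points x and y on the surface, at distance rho.
    The flat projection of z has the same nearest points, so z may be taken flat.
    From outside, the nearest point is unique because the body is convex.  From
    inside, the open ball of radius rho about z does not meet the surface, hence
    stays inside it; this forces x - z to be rho times the unit normal at x.  As y
    lies on the surface too, the upper half of [lvl_taylor] at x bounds the gradient
    at x by 3 rho, while [lvlgrad_norm] bounds it below by 2 r. *)
Lemma reach_surf (c dl r tau : R) : 0 <= c -> c <= 1 / 280 -> 0 < dl -> 0 < r ->
  3 * tau <= 2 * r -> (tau%:E <= reach (surf c dl r))%E.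
Proof.
move=> c0 cle dl0 r0 taur; apply: le_ereal_inf_tmp => _ [z [x [y [Sx Sy xy zx zy]]] <-].
rewrite zx lee_fin leNgt; apply/negP => ltau.
have hmin w : surf c dl r w -> dotv (z - x) (z - x) <= dotv (z - w) (z - w).
  exact: nearest_le.
have hxy : dotv (z - y) (z - y) = dotv (z - x) (z - x).
  by rewrite -!enorm_sq; congr (_ ^+ 2); move: zy; rewrite zx => -[].
have [fx Fx] := Sx; have [fy Fy] := Sy.
set z' := flat_proj z; have fz' : flat_model m z' := flat_proj_flat z.
set rho2 := dotv (z' - x) (z' - x).
have hmin' w : surf c dl r w -> rho2 <= dotv (z' - w) (z' - w).
  move=> Sw; have := hmin w Sw; have [fw _] := Sw.
  by rewrite (flat_pythagoras z fx) (flat_pythagoras z fw) lerD2r.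
have hxy' : dotv (z' - y) (z' - y) = rho2.
  by move: hxy; rewrite (flat_pythagoras z fx) (flat_pythagoras z fy) => /addIr.
have yx0 : 0 < dotv (y - x) (y - x).
  by rewrite dotv_gt0 subr_eq0; apply/eqP => /esym.
have yxE : dotv (y - x) (y - x) = 2 * dotv (z' - x) (y - x).
  move: hxy'; have -> : z' - y = (z' - x) - (y - x) by rewrite opprB addrA subrK.
  rewrite dotv_sqB /rho2 => H; lra.
have rho_lt : rho2 < tau ^+ 2.
  have : rho2 <= dotv (z - x) (z - x).
    by rewrite (flat_pythagoras z fx) lerDl dotv_ge0.
  move=> /le_lt_trans; apply; rewrite -enorm_sq ltr_pXn2r ?nnegrE ?enorm_ge0//.
  by rewrite ltW// (le_lt_trans (enorm_ge0 _) ltau).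
have [Fz|Fz|Fz] := ltgtP (lvl c dl r z') 0; last first.
(* A point of the surface is its own nearest point. *)
- have := hmin' z' (conj fz' Fz); rewrite subrr /dotv big1 => [|i _]; last first.
    by rewrite !mxE mul0r.
  move=> rho0; have /eqP : rho2 = 0 by apply/eqP; rewrite eq_le rho0 dotv_ge0.
  rewrite /rho2 dotv_eq0 subr_eq0 => /eqP zx'.
  move: hxy' => /eqP; rewrite /rho2 zx' subrr (_ : dotv 0 0 = 0); last first.
    by apply/eqP; rewrite dotv_eq0.
  by rewrite dotv_eq0 subr_eq0 => /eqP.
(* From outside, the midpoint of x and y is strictly inside and nearer to z'
   than x, and the segment from it to z' meets the surface at a point that
   is nearer still. *)
- set w := x + (1 / 2) *: (y - x).
  have fw : flat_model m w by exact: flat_segment.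
  have Fw : lvl c dl r w < 0.
    have := @lvl_midpoint R D c dl r c0 cle dl0 x y (1 / 2).
    by rewrite -/w Fx Fy => /(_ _) H; apply: le_lt_trans (H _) _; lra.
  have [t /andP[t0 t1] Ft] := segment_lvl_zero c0 dl0 Fw Fz.
  have := hmin' _ (conj (flat_segment t fw fz') Ft); apply/negP; rewrite -ltNge.
  have -> : z' - (w + t *: (z' - w)) = (1 - t) *: (z' - w).
    by rewrite scalerBl scale1r opprD addrA.
  rewrite dotvZl dotvZr.
  have zw : dotv (z' - w) (z' - w) < rho2.
    have -> : z' - w = (z' - x) - (1 / 2) *: (y - x) by rewrite /w opprD addrA.
    by rewrite dotv_sqB -/rho2 !dotvZl !dotvZr; lra.
  apply: le_lt_trans zw; rewrite mulrA ler_piMl ?dotv_ge0//.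
  by rewrite mulr_ile1//; lra.
set g := lvlgrad c dl x; set N := enorm g.
have N2r : 2 * r <= N by apply: lvlgrad_norm => //; exact: ltW.
have N0 : 0 < N by lra.
set rho := enorm (z' - x); have rhoE : rho ^+ 2 = rho2 := enorm_sq _.
have rho0 : 0 < rho.
  rewrite lt0r enorm_ge0 andbT enorm_eq0 subr_eq0; apply/eqP => zx'.
  by move: Fz; rewrite zx' Fx ltxx.
have fg : flat_model m g by move=> i mi; rewrite mxE fx// mulr0.
(* From inside, walk from z' over the distance rho in the direction of the
   outward normal at x: the surface is not crossed on the way. *)
set u := z' + (rho / N) *: g.
have fu : flat_model m u by apply/flatD/flatZ.
have Fu : lvl c dl r u <= 0.
  rewrite leNgt; apply/negP => Fu.
  have [t /andP[t0 t1] Ft] := segment_lvl_zero c0 dl0 Fz Fu.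
  have := hmin' _ (conj (flat_segment t fz' fu) Ft); apply/negP; rewrite -ltNge.
  rewrite /u addrAC subrr add0r opprD addrA subrr add0r scalerA.
  rewrite dotvNl dotvNr opprK dotvZl dotvZr -enorm_sq -/N -rhoE.
  have -> : t * (rho / N) * (t * (rho / N) * N ^+ 2) = t ^+ 2 * rho ^+ 2.
    by field; rewrite gt_eqF.
  by rewrite gtr_pMl ?exprn_gt0// exprn_ilt1// ltW.
(* By convexity u lies in the half-space below the tangent plane at x. *)
have gz : dotv g (z' - x) + rho * N <= 0.
  have := @lvl_taylor R D c dl r c0 cle dl0 x (u - x); rewrite subrKC Fx subr0 => /andP[H _].
  have := dotv_ge0 (u - x) => H0.
  have : dotv g (u - x) = dotv g (z' - x) + rho * N.
    have -> : u - x = (z' - x) + (rho / N) *: g by rewrite /u addrAC.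
    rewrite dotvDr dotvZr -enorm_sq -/N; congr (_ + _).
    by field; rewrite gt_eqF.
  rewrite -/g in H; lra.
(* Equality case of the Cauchy-Schwarz inequality: the vectors z' - x, of norm
   rho, and g, of norm N, have an inner product at most - rho N. *)
have zxE : z' - x = (- (rho / N)) *: g.
  apply/eqP; rewrite -subr_eq0 -dotv_eq0 eq_le dotv_ge0 andbT.
  rewrite dotv_sqB !dotvZl !dotvZr -!enorm_sq -/rho -/N (dotvC _ g).
  have -> : - (rho / N) * (- (rho / N) * N ^+ 2) = rho ^+ 2.
    by field; rewrite gt_eqF.
  have : rho / N * dotv g (z' - x) <= rho / N * (- (rho * N)).
    by apply: ler_wpM2l; [rewrite divr_ge0 ?ltW|lra].
  have -> : rho / N * - (rho * N) = - rho ^+ 2 by field; rewrite gt_eqF.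
  lra.
have gyx : - dotv g (y - x) <= 3 / 2 * dotv (y - x) (y - x).
  have := @lvl_taylor R D c dl r c0 cle dl0 x (y - x).
  by rewrite subrKC Fx Fy subrr sub0r => /andP[].
have : dotv (y - x) (y - x) * N <= 3 * rho * dotv (y - x) (y - x).
  rewrite [X in X * N]yxE zxE dotvZl.
  have -> : 2 * (- (rho / N) * dotv g (y - x)) * N = 2 * rho * (- dotv g (y - x)).
    by field; rewrite gt_eqF.
  by have := ler_wpM2l (ltW rho0) gyx; lra.
rewrite mulrC ler_pM2r// => Nrho.
have : rho < tau.
  rewrite -(@ltr_pXn2r _ 2)// ?nnegrE ?rhoE ?ltW//.
  exact: le_lt_trans (enorm_ge0 _) ltau.
lra.
Qed.

(** Two nearest points would have a midpoint in the body, strictly nearer by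
    Pythagoras. *)
Lemma reach_body (c dl r : R) : 0 <= c -> c <= 1 / 280 -> 0 < dl ->
  reach (body c dl r) = +oo%E.
Proof.
move=> c0 cle dl0; rewrite /reach (_ : medial_axis _ = set0) ?image_set0 ?ereal_inf0//.
apply/seteqP; split=> // z [x [y [[fx Fx] [fy Fy] xy zx zy]]] /=.
have hxy : dotv (z - y) (z - y) = dotv (z - x) (z - x).
  by rewrite -!enorm_sq; congr (_ ^+ 2); move: zy; rewrite zx => -[].
have yx0 : 0 < dotv (y - x) (y - x).
  by rewrite dotv_gt0 subr_eq0; apply/eqP => /esym.
have yxE : dotv (y - x) (y - x) = 2 * dotv (z - x) (y - x).
  move: hxy; have -> : z - y = (z - x) - (y - x) by rewrite opprB addrA subrK.
  rewrite dotv_sqB => H; lra.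
set w := x + (1 / 2) *: (y - x).
have Fw : lvl c dl r w <= 0.
  have := @lvl_midpoint R D c dl r c0 cle dl0 x y (1 / 2).
  by rewrite -/w => /(_ _) H; apply: le_trans (H _) _; lra.
have := nearest_le zx (conj (flat_segment (1 / 2) fx fy) Fw).
have -> : z - w = (z - x) - (1 / 2) *: (y - x) by rewrite /w opprD addrA.
by rewrite [leRHS]dotv_sqB !dotvZl !dotvZr; lra.
Qed.

End reach.

(** * Charts of a hypersurface that is locally a graph *)

(** Near p the function F is x_j^2 - g(x), where g is positive and does not depend on
    the coordinate j: the zero set is a graph x_j = s sqrt (g x), with s = 1 or
    s = -1.  The chart exchanges the coordinates j and n, where n is the last
    flat one, then measures the n-th from the graph, pointing inwards.  The zero set
    thus becomes u_n = 0 and the sublevel set u_n >= 0, so that a single pair of maps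
    gives both kinds of charts.  The maps Phi and Psi are inverse bijections of the
    whole space; only their smoothness is local. *)
Section graph_chart.
Context (R : realType) (D m : nat).
Notation E := 'rV[R]_D.+1.
Implicit Types (x y p u : E) (U V W : set E).
Context (F g : E -> R) (p : E) (j n : 'I_D.+1) (s : R) (W : set E).

Context (nm : n.+1 = m).
Context (jm : (j < m)%N).
Context (ss : s * s = 1).
Context (gC : forall U (A : E -> E), open U ->
  (forall i, Ck 2 U (fun u => A u 0 i)) -> Ck 2 U (fun u => g (A u))).
Context (gind : forall x y, (forall i, i != j -> x 0 i = y 0 i) -> g x = g y).
Context (pW : nbhs p W).
Context (Wg : forall x, W x -> [/\ 0 < g x, 0 < s * x 0 j & F x = x 0 j ^+ 2 - g x]).
Context (fp : flat_model m p) (Fp : F p = 0).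

Let swp u : E := p + \row_i u 0 (tperm j n i).

Let Phi x : E := \row_i if i == n then Num.sqrt (g x) - s * x 0 j
  else x 0 (tperm j n i) - p 0 (tperm j n i).

Let Psi u : E := \row_i if i == j then s * (Num.sqrt (g (swp u)) - u 0 n)
  else p 0 i + u 0 (tperm j n i).

Let tperm_neq_j i : i != n -> tperm j n i != j.
Proof. by apply: contraNneq => e; rewrite -(tpermK j n i) e tpermL. Qed.

Let tperm_neq_n i : i != j -> tperm j n i != n.
Proof. by apply: contraNneq => e; rewrite -(tpermK j n i) e tpermR. Qed.

Let g_swp_Phi x : g (swp (Phi x)) = g x.
Proof.
apply: gind => i ij; rewrite !mxE (negbTE (tperm_neq_n ij)) tpermK.
by rewrite subrKC.
Qed.

Let g_Psi u : g (Psi u) = g (swp u).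
Proof. by apply: gind => i ij; rewrite !mxE (negbTE ij). Qed.

Let PhiK x : Psi (Phi x) = x.
Proof.
apply/rowP => i; rewrite mxE g_swp_Phi; case: eqVneq => [->|ij].
  by rewrite mxE eqxx opprB addrC subrK mulrA ss mul1r.
by rewrite mxE (negbTE (tperm_neq_n ij)) tpermK subrKC.
Qed.

Let PsiK u : Phi (Psi u) = u.
Proof.
apply/rowP => i; rewrite mxE g_Psi; case: eqVneq => [->|ni].
  by rewrite mxE eqxx mulrA ss mul1r opprB addrC subrK.
by rewrite mxE (negbTE (tperm_neq_j ni)) tpermK addrC addKr.
Qed.

Let swpC U : open U -> forall i, Ck 2 U (fun u => swp u 0 i).
Proof.
move=> oU i; have : Ck 2 U (fun u => p 0 i + u 0 (tperm j n i)).
  by apply: CkD => //; [exact: Ck_cst|exact: Ck_coord].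
by apply: Ck_ext => // u _; rewrite !mxE.
Qed.

Let sqrtC U (A : E -> E) : open U -> (forall i, Ck 2 U (fun u => A u 0 i)) ->
  (forall u, U u -> 0 < g (A u)) -> Ck 2 U (fun u => Num.sqrt (g (A u))).
Proof.
move=> oU CA gA; apply: (@Ck_comp _ _ 2 U [set t | 0 < t]) => //.
  exact: C1k_sqrt.
exact: gC.
Qed.

Let PhiC U : open U -> (forall x, U x -> 0 < g x) -> Ck_on 2 U Phi.
Proof.
move=> oU gU; apply: Ck_onP => // i; case: (eqVneq i n) => [->|ni].
  have : Ck 2 U (fun x => Num.sqrt (g x) + (- s) * x 0 j).
    apply: CkD => //; first by apply: (@sqrtC U id) => // k; exact: Ck_coord.
    by apply: CkM => //; [exact: Ck_cst|exact: Ck_coord].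
  by apply: Ck_ext => // x _; rewrite mxE eqxx mulNr.
have : Ck 2 U (fun x => x 0 (tperm j n i) + - p 0 (tperm j n i)).
  by apply: CkD => //; [exact: Ck_coord|exact: Ck_cst].
by apply: Ck_ext => // x _; rewrite mxE (negbTE ni).
Qed.

Let PsiC U : open U -> (forall u, U u -> 0 < g (swp u)) ->
  forall i, Ck 2 U (fun u => Psi u 0 i).
Proof.
move=> oU gU i; case: (eqVneq i j) => [->|ij].
  have : Ck 2 U (fun u => s * (Num.sqrt (g (swp u)) + (-1) * u 0 n)).
    apply: CkM => //; first exact: Ck_cst.
    apply: CkD => //; first by apply: sqrtC => //; exact: swpC.
    by apply: CkM => //; [exact: Ck_cst|exact: Ck_coord].
  by apply: Ck_ext => // x _; rewrite mxE eqxx mulN1r.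
have : Ck 2 U (fun u => p 0 i + u 0 (tperm j n i)).
  by apply: CkD => //; [exact: Ck_cst|exact: Ck_coord].
by apply: Ck_ext => // x _; rewrite mxE (negbTE ij).
Qed.

Let open_swp : open [set u | 0 < g (swp u)].
Proof.
have cg : continuous (fun u => g (swp u)).
  by move=> u; apply: (CkW (CkW (gC openT (swpC openT)))).
exact: (open_comp (fun u _ => cg u) (@open_gt R 0)).
Qed.

Let Psi0 : Psi 0 = p.
Proof.
have [g0 sp Fpg] := Wg (nbhs_singleton pW).
apply/rowP => i; rewrite mxE; case: eqVneq => [->|ij]; last first.
  by rewrite mxE addr0.
have -> : g (swp 0) = g p by apply: gind => k _; rewrite !mxE addr0.
have -> : g p = (s * p 0 j) ^+ 2.
  by rewrite exprMn (expr2 s) ss mul1r; apply/esym/subr0_eq; rewrite -Fpg.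
by rewrite sqrtr_sqr gtr0_norm// mxE subr0 mulrA ss mul1r.
Qed.

Let chart_of (model M : set E) V : open V -> V p -> V `<=` W ->
  (forall x, V x -> M x <-> model (Phi x)) -> has_chart model M p V.
Proof.
move=> oV Vp VW MV.
have oU : open [set u | 0 < g (swp u) /\ V (Psi u)].
  rewrite openE => u [gu Vu].
  have c : {for u, continuous Psi}.
    have : Ck_on 0 [set u | 0 < g (swp u)] Psi.
      by apply: Ck_onP => // i; exact: (CkW (CkW (PsiC open_swp (fun u h => h) i))).
    by apply.
  exact: filterI (open_nbhs_nbhs (conj open_swp gu)) (c V (open_nbhs_nbhs (conj oV Vu))).
exists [set u | 0 < g (swp u) /\ V (Psi u)], Psi; split=> //.
- have [g0 _ _] := Wg (VW _ Vp).
  split=> /=; last by rewrite Psi0.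
  by rewrite -g_Psi Psi0.
- exists Phi; split.
  + by apply: Ck_onP => // i; apply: PsiC => // u [].
  + by apply: PhiC => // x Vx; have [] := Wg (VW _ Vx).
  + by move=> u [gu Vu]; rewrite PsiK.
  + move=> x Vx; rewrite PhiK; split=> //; split; last by rewrite PhiK.
    by rewrite g_swp_Phi; have [] := Wg (VW _ Vx).
- apply/seteqP; split=> [_ [u [[gu Vu] mu] <-]|x [Mx Vx]].
    by split=> //; apply/MV => //; rewrite PsiK.
  exists (Phi x); last exact: PhiK.
  split; last exact/MV.
  split; last by rewrite PhiK.
  by rewrite /= g_swp_Phi; have [] := Wg (VW _ Vx).
Qed.

Let Phi_far (i : 'I_D.+1) x : (m <= i)%N -> Phi x 0 i = x 0 i.
Proof.
move=> mi; rewrite mxE; case: eqVneq => [e|ni].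
  by move: mi; rewrite e -nm ltnn.
have ij : i != j by apply/eqP => e; move: jm; rewrite -e ltnNge mi.
by rewrite tpermD 1?eq_sym// fp// subr0.
Qed.

Let Phi_n x : Phi x 0 n = Num.sqrt (g x) - s * x 0 j.
Proof. by rewrite mxE eqxx. Qed.

Lemma graph_chart_flat : small_open_nbhs p
  (has_chart (flat_model n) [set x | flat_model m x /\ F x = 0] p).
Proof.
exists W => // V oV Vp VW; apply: chart_of => // x Vx /=.
have [g0 sx Fx] := Wg (VW _ Vx).
have FE : F x = 0 <-> Num.sqrt (g x) - s * x 0 j = 0.
  have -> : F x = (s * x 0 j) ^+ 2 - Num.sqrt (g x) ^+ 2.
    by rewrite sqr_sqrtr ?ltW// exprMn (expr2 s) ss mul1r.
  split=> [/subr0_eq e|/subr0_eq ->]; last by rewrite subrr.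
  have /eqP -> : Num.sqrt (g x) == s * x 0 j.
    by rewrite -(@eqrXn2 _ 2)// ?sqrtr_ge0 ?ltW// e.
  by rewrite subrr.
split=> [[fx /FE e] i|h].
  rewrite leq_eqVlt => /predU1P[ni|]; last by rewrite nm => mi; rewrite Phi_far// fx.
  have -> : i = n by apply/val_inj.
  by rewrite Phi_n.
split; last by apply/FE; rewrite -Phi_n h.
by move=> i mi; rewrite -(Phi_far _ mi) h// -ltnS nm ltnW.
Qed.

Lemma graph_chart_half : small_open_nbhs p
  (has_chart (half_model m) [set x | flat_model m x /\ F x <= 0] p).
Proof.
exists W => // V oV Vp VW; apply: chart_of => // x Vx /=.
have [g0 sx Fx] := Wg (VW _ Vx).
have FE : (F x <= 0) = (0 <= Num.sqrt (g x) - s * x 0 j).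
  have -> : F x = (s * x 0 j) ^+ 2 - Num.sqrt (g x) ^+ 2.
    by rewrite sqr_sqrtr ?ltW// exprMn (expr2 s) ss mul1r.
  by rewrite subr_le0 subr_ge0 ler_pXn2r// nnegrE ?sqrtr_ge0// ltW.
split=> [[fx e]|[fx hx]].
  split=> [i mi|i im]; first by rewrite Phi_far// fx.
  have -> : i = n by apply/val_inj/succn_inj; rewrite /= im nm.
  by rewrite Phi_n -FE.
split; last by rewrite FE -Phi_n hx.
by move=> i mi; rewrite -(Phi_far _ mi) fx.
Qed.

End graph_chart.

(** * Charts of the bumped sphere and of the body *)

Section profile_charts.
Context (R : realType) (D : nat) (n : 'I_D.+1) (c dl r : R).
Context (c0 : 0 <= c) (dl0 : 0 < dl) (dlr : dl < r).
Notation E := 'rV[R]_D.+1.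
Implicit Types (x p : E).
Notation F := (@lvl R D c dl r).

Let sgn_coord p (j : 'I_D.+1) : p 0 j != 0 ->
  exists2 s : R, s * s = 1 & 0 < s * p 0 j.
Proof.
move=> pj; exists (Num.sg (p 0 j)); last by rewrite -normrEsg normr_gt0.
by rewrite -expr2 sqr_sg pj.
Qed.

Let gt_near (f : E -> R) p (a : R) : continuous f -> a < f p ->
  nbhs p [set x | a < f x].
Proof. by move=> cf; exact: cvgr_gt (cf p) a. Qed.

Let coord_gt_near p (j : 'I_D.+1) s : 0 < s * p 0 j ->
  nbhs p [set x : E | 0 < s * x 0 j].
Proof.
apply: (@gt_near (fun x => s * x 0 j)) => x.
by apply: continuousM; [exact: cst_continuous|exact: coord_continuous].
Qed.

(** Where x_0 is not zero, the equation can be solved for x_0, with the bump in the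
    right-hand side, since the bump depends on the other coordinates only.  On the
    equator x_0 = 0 the point is far from the axis, the bump vanishes nearby, and the
    equation of the round sphere can be solved for any coordinate that is not zero. *)
Lemma surf_charts p : surf n.+1 c dl r p ->
  small_open_nbhs p (has_chart (flat_model n) (surf n.+1 c dl r) p) /\
  small_open_nbhs p (has_chart (half_model n.+1) (body n.+1 c dl r) p).
Proof.
move=> [fp Fp]; have [p0|p0] := eqVneq (p 0 ord0) 0; last first.
  have [s ss sp] := sgn_coord p0.
  pose g x := r ^+ 2 + 2 * pbump c dl (tailsq x) - tailsq x.
  have FE x : F x = x 0 ord0 ^+ 2 - g x by rewrite /lvl dotv_split /g; ring.
  have gC U (A : E -> E) : open U -> (forall i, Ck 2 U (fun u => A u 0 i)) ->
      Ck 2 U (fun u => g (A u)).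
    move=> oU CA; have : Ck 2 U (fun u => (r ^+ 2 + 2 * pbump c dl (tailsq (A u)))
        + (-1) * tailsq (A u)).
      apply: CkD; [exact: oU|apply: CkD; [exact: oU|exact: Ck_cst|]|].
        by apply: CkM; [exact: oU|exact: Ck_cst|exact: Ck_pbump].
      by apply: CkM; [exact: oU|exact: Ck_cst|exact: Ck_tailsq].
    by apply: Ck_ext => // u _; rewrite mulN1r.
  have gind (x y : E) : (forall i : 'I_D.+1, i != ord0 -> x 0 i = y 0 i) -> g x = g y.
    move=> xy; rewrite /g (_ : tailsq x = tailsq y)//.
    by apply: eq_bigr => i i0; rewrite xy.
  have cg : continuous g.
    have h := gC setT id openT (fun i => @Ck_coord R D.+1 2 setT i openT).
    by move=> x; apply: (CkW (CkW h)).
  pose W := [set x | 0 < g x] `&` [set x : E | 0 < s * x 0 ord0].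
  have pW : nbhs p W.
    apply: filterI; last exact: coord_gt_near.
    apply: gt_near => //; move: (FE p); rewrite Fp => /esym/subr0_eq <-.
    by rewrite exprn_even_gt0.
  have Wg x : W x -> [/\ 0 < g x, 0 < s * x 0 ord0 & F x = x 0 ord0 ^+ 2 - g x].
    by case.
  split; first exact: (@graph_chart_flat _ _ n.+1 F g p ord0 n s W).
  exact: (@graph_chart_half _ _ n.+1 F g p ord0 n s W).
have r0 : 0 < r by exact: lt_trans dlr.
(* A point of the equator is outside of the cylinder that carries the bump:
   this is where dl < r enters. *)
have Np : tailsq p = r ^+ 2.
  have := Fp; rewrite /lvl dotv_split p0 expr0n/= add0r.
  have [/(pbump_far c dl0) ->|Nd] := leP (dl ^+ 2) (tailsq p).
    by rewrite mulr0 subr0 => /subr0_eq.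
  have : dl ^+ 2 < r ^+ 2 by rewrite ltr_pXn2r// nnegrE ltW.
  have : 0 <= pbump c dl (tailsq p) by exact: pbump_ge0.
  lra.
have [j j0 pj] : exists2 j, j != ord0 & p 0 j != 0.
  apply: contrapT => h; have : tailsq p = 0.
    apply: big1 => i i0; have [->|pi] := eqVneq (p 0 i) 0; first by rewrite expr0n.
    by exfalso; apply: h; exists i.
  by rewrite Np => /eqP; rewrite expf_eq0/= gt_eqF.
have jm : (j < n.+1)%N.
  by rewrite ltnNge; apply/negP => mj; move: pj; rewrite fp// eqxx.
have [s ss sp] := sgn_coord pj.
pose g x := r ^+ 2 - \sum_(i | i != j) x 0 i ^+ 2.
have FE x : dl ^+ 2 < tailsq x -> F x = x 0 j ^+ 2 - g x.
  move=> dx; rewrite /lvl pbump_far ?ltW// dotv_sqE (bigD1 j)//= /g; ring.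
have gC U (A : E -> E) : open U -> (forall i, Ck 2 U (fun u => A u 0 i)) ->
    Ck 2 U (fun u => g (A u)).
  move=> oU CA; have : Ck 2 U (fun u => r ^+ 2 + (-1) * \sum_(i | i != j) A u 0 i ^+ 2).
    apply: CkD => //; first exact: Ck_cst.
    apply: CkM => //; first exact: Ck_cst.
    by apply: Ck_sum => // i _; exact: CkM.
  by apply: Ck_ext => // u _; rewrite mulN1r.
have gind (x y : E) : (forall i : 'I_D.+1, i != j -> x 0 i = y 0 i) -> g x = g y.
  by move=> xy; congr (_ - _); apply: eq_bigr => i i0; rewrite xy.
have cg : continuous g.
  have h := gC setT id openT (fun i => @Ck_coord R D.+1 2 setT i openT).
  by move=> x; apply: (CkW (CkW h)).
pose W := [set x | 0 < g x] `&` [set x : E | 0 < s * x 0 j] `&`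
  [set x | dl ^+ 2 < tailsq x].
have dlNp : dl ^+ 2 < tailsq p by rewrite Np ltr_pXn2r// nnegrE ltW.
have pW : nbhs p W.
  apply: filterI; last by apply: gt_near => //; exact: continuous_tailsq.
  apply: filterI; last exact: coord_gt_near.
  apply: gt_near => //; move: (FE p dlNp); rewrite Fp => /esym/subr0_eq <-.
  by rewrite exprn_even_gt0.
have Wg x : W x -> [/\ 0 < g x, 0 < s * x 0 j & F x = x 0 j ^+ 2 - g x].
  by move=> [[gx sx] dx]; split => //; exact: FE.
split; first exact: (@graph_chart_flat _ _ n.+1 F g p j n s W).
exact: (@graph_chart_half _ _ n.+1 F g p j n s W).
Qed.

Lemma body_interior_chart p : flat_model n.+1 p -> F p < 0 ->
  small_open_nbhs p (has_chart (flat_model n.+1) (body n.+1 c dl r) p).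
Proof.
move=> fp Fp; exists [set x | F x < 0].
  have cF : F x @[x --> p] --> F p by exact: continuous_lvl.
  exact: (cvgr_lt (F p) cF 0 Fp).
move=> V oV Vp VW.
have shiftC (v : E) U : open U -> Ck_on 2 U (fun x => x + v).
  move=> oU; apply: Ck_onP => // i.
  have : Ck 2 U (fun x : E => x 0 i + v 0 i).
    by apply: CkD => //; [exact: Ck_coord|exact: Ck_cst].
  by apply: Ck_ext => // x _; rewrite mxE.
have oU : open [set u : E | V (u + p)].
  rewrite openE => u Vu.
  have cu : {for u, continuous (fun x : E => x + p)}.
    by apply: continuousD; [exact: cvg_id|exact: cst_continuous].
  exact: cu V (open_nbhs_nbhs (conj oV Vu)).
exists [set u | V (u + p)], (fun u => u + p); split=> //=.
- by rewrite add0r.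
- exists (fun x => x - p); split; [exact: shiftC|exact: shiftC| |].
  + by move=> u Vu; rewrite addrK.
  + by move=> x Vx; rewrite /= subrK.
- by rewrite add0r.
- apply/seteqP; split=> [_ [u [Vu fu] <-]|x [[fx Fx] Vx]].
    by split=> //; split; [exact: flatD|exact/ltW/VW].
  exists (x - p); rewrite ?subrK//; split; first by rewrite /= subrK.
  exact: flatB.
Qed.

End profile_charts.

Lemma derive_ge0_right (R : realType) (V : normedModType R) (f : V -> R) (v : V) :
  derivable f 0 v -> (\forall t \near (0 : R)^'+, f 0 <= f (t *: v)) ->
  0 <= 'D_v f 0.
Proof.
move=> dfv ft; have cr := cvg_at_rightE _ _ dfv.
rewrite /derive cr; apply: limr_ge.
  apply/cvg_ex; exists (lim ((fun h => h^-1 *: ((f \o shift 0) (h *: v) - f 0)) @ 0^')).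
  exact: cvg_dnbhs_at_right.
near=> t; rewrite /= addr0 mulr_ge0// ?invr_ge0 ?subr_ge0; near: t => //.
by apply: nbhs_right_ge.
Unshelve. all: by end_near. Qed.

(** Invariance of the boundary, at the level of first derivatives.  The transition map
    G from a flat chart to a half chart sends flat vectors to u_n >= 0 and 0 to 0; so
    along every flat direction v its derivative has a nonnegative n-th coordinate.
    The opposite transition H sends the inward normal e_n to a flat direction w with
    D_w G = e_n, and the direction - w contradicts the inequality. *)
Lemma flat_chart_not_boundary (R : realType) (D : nat) (n : 'I_D)
    (M : set 'rV[R]_D) (p : 'rV[R]_D) : M p ->
  small_open_nbhs p (has_chart (flat_model n.+1) M p) ->
  ~ boundary n.+1 M p.
Proof.
move=> Mp [W1 pW1 h1] [_ [W2 pW2 h2]].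
pose V := (W1 `&` W2)°.
have oV : open V by exact: open_interior.
have Vp : V p by apply: filterI.
have VW : V `<=` W1 `&` W2 by exact: interior_subset.
have [U1 [Psi1 [oU1 U10 [Phi1 [C1 C1' K1 K1']] Psi10 E1]]] :=
  h1 V oV Vp (fun x Vx => (VW x Vx).1).
have [U2 [Psi2 [oU2 U20 [Phi2 [C2 C2' K2 K2']] Psi20 E2]]] :=
  h2 V oV Vp (fun x Vx => (VW x Vx).2).
pose G u := Phi2 (Psi1 u); pose H u := Phi1 (Psi2 u).
have G0 : G 0 = 0 by rewrite /G Psi10 -Psi20; have [] := K2 _ U20.
have H0 : H 0 = 0 by rewrite /H Psi20 -Psi10; have [] := K1 _ U10.
have dG : differentiable G 0.
  apply: differentiable_comp; first by have [+ _] := C1; apply.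
  by rewrite Psi10; have [+ _] := C2'; apply.
have dH : differentiable H 0.
  apply: differentiable_comp; first by have [+ _] := C2; apply.
  by rewrite Psi20; have [+ _] := C1'; apply.
pose e : 'rV[R]_D := delta_mx 0 n.
pose w := 'D_e H 0.
have small (U : set 'rV[R]_D) (v : 'rV[R]_D) : open U -> U 0 -> \forall t \near (0 : R), U (t *: v).
  move=> oU U0; have c : {for (0 : R), continuous (fun t : R => t *: v)}.
    by apply: continuousZl; exact: cvg_id.
  by apply: c; rewrite scale0r; exact: open_nbhs_nbhs.
have coordD (f : 'rV[R]_D -> 'rV[R]_D) v i : differentiable f 0 ->
    derivable (fun x => f x 0 i) 0 v /\ 'D_v (fun x => f x 0 i) 0 = ('D_v f 0) 0 i.
  move=> df; have dv := diff_derivable df (v := v); split.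
    by move/derivable_mxP : dv.
  by rewrite derive_mx// mxE.
have DN (f : 'rV[R]_D -> 'rV[R]_D) v : differentiable f 0 -> 'D_(- v) f 0 = - 'D_v f 0.
  by move=> df; rewrite !deriveE// linearN.
have Hflat : \forall t \near (0 : R)^'+, flat_model n.+1 (H (t *: e)).
  near=> t.
  have U2t : U2 (t *: e) by near: t; apply: cvg_within; exact: small.
  have : (M `&` V) (Psi2 (t *: e)).
    rewrite -E2; exists (t *: e) => //; split=> //; split.
      move=> i ni; rewrite !mxE; have -> : (i == n) = false.
        by apply/eqP => ei; move: ni; rewrite ei ltnn.
      by rewrite andbF mulr0.
    move=> i [/val_inj ->]; rewrite !mxE !eqxx mulr1.
    by near: t; exact: nbhs_right_ge.
  by rewrite -E1 => -[u [U1u fu] uE]; rewrite /H -uE; have [_ ->] := K1 _ U1u.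
(* Only nonnegative multiples of e stay in the half model, so that each
   vanishing coordinate is obtained from two one-sided inequalities. *)
have wflat : flat_model n.+1 w.
  move=> i ni; have [dHi DHi] := coordD H e i dH.
  rewrite /w -DHi; apply/eqP; rewrite eq_le; apply/andP; split.
    rewrite -oppr_ge0 -deriveN//; apply: derive_ge0_right; first exact: derivableN.
    by apply: filterS Hflat => t ft; rewrite !fctE H0 mxE ft.
  by apply: derive_ge0_right => //; apply: filterS Hflat => t ft; rewrite H0 mxE ft.
have Gpos v : flat_model n.+1 v ->
    \forall t \near (0 : R)^'+, 0 <= G (t *: v) 0 n.
  move=> fv; near=> t.
  have U1t : U1 (t *: v) by near: t; apply: cvg_within; exact: small.
  have : (M `&` V) (Psi1 (t *: v)).
    rewrite -E1; exists (t *: v) => //; split=> // i ni.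
    by rewrite mxE fv// mulr0.
  rewrite -E2 => -[u [U2u [_ hu]] uE]; rewrite /G -uE.
  by have [_ ->] := K2 _ U2u; exact: hu.
have DG v : flat_model n.+1 v -> 0 <= ('D_v G 0) 0 n.
  move=> fv; have [dGn <-] := coordD G v n dG.
  by apply: derive_ge0_right => //; apply: filterS (Gpos v fv) => t; rewrite G0 mxE.
have := DG (- w); rewrite DN// mxE oppr_ge0 => /(_ _) h.
have DGw : 'D_w G 0 = e.
  have GH : nbhs (0 : 'rV[R]_D) [set u | (G \o H) u = id u].
    apply: filterS (open_nbhs_nbhs (conj oU2 U20)) => u U2u.
    have [Vu Pu] := K2 _ U2u.
    by rewrite /= /G /H; have [_ ->] := K1' _ Vu.
  have : 'D_e (G \o H) 0 = 'D_e id 0 by exact: near_eq_derive.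
  rewrite derive_id => <-.
  have dG' : differentiable G (H 0) by rewrite H0.
  rewrite [RHS]deriveE; last exact: differentiable_comp.
  by rewrite diff_comp//= H0 /w !deriveE.
have : (e 0 n <= 0).
  by rewrite -DGw; apply: h => i ni; rewrite mxE wflat// oppr0.
by rewrite mxE !eqxx ler10.
Unshelve. all: by end_near. Qed.

(** * Membership in the two classes of manifolds *)

Lemma star_connected (R : realType) (k : nat) (A : set 'rV[R]_k) (a : 'rV[R]_k) :
  A a -> (forall x (t : R), A x -> 0 <= t <= 1 -> A (a + t *: (x - a))) ->
  connected A.
Proof.
move=> Aa star; pose seg x := (fun t : R => a + t *: (x - a)) @` `[0, 1].
have -> : A = \bigcup_(x in A) seg x.
  apply/seteqP; split=> [x Ax|x [y Ay [t + <-]]].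
    exists x => //; exists 1; first by rewrite /= in_itv/= ler01 lexx.
    by rewrite scale1r subrKC.
  by rewrite /= in_itv/= => t01; exact: star.
apply: bigcup_connected => [|x Ax].
  exists a => x Ax; exists 0; first by rewrite /= in_itv/= ler01 lexx.
  by rewrite scale0r addr0.
apply: connected_continuous_connected; first exact: segment_connected.
have ct (t : R) : {for t, continuous (fun t : R => a + t *: (x - a))}.
  by apply: continuousD; [exact: cst_continuous|apply: continuousZl; exact: cvg_id].
exact: continuous_subspaceT.
Qed.

Section profile_manifolds.
Context (R : realType) (D : nat) (n : 'I_D.+1) (c dl r : R).
Context (c0 : 0 <= c) (cle : c <= 1 / 280) (dl0 : 0 < dl) (dlr : dl < r).
Notation E := 'rV[R]_D.+1.
Implicit Types (x p : E).
Notation F := (@lvl R D c dl r).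

Let r0 : 0 < r. Proof. exact: lt_trans dlr. Qed.

Let closed_flat m : closed [set x : E | flat_model m x].
Proof.
have -> : [set x : E | flat_model m x] =
    (fun x : E => \sum_(i < D.+1 | (m <= i)%N) x 0 i ^+ 2) @^-1` [set y | y = 0].
  apply/seteqP; split=> x /=; [move=> fx|].
    by apply: big1 => i mi; rewrite fx// expr0n.
  by move/psumr_eq0P => h i mi; apply/eqP; rewrite -sqrf_eq0 h// => *; exact: sqr_ge0.
apply: preimage_closed; last exact: closed_eq.
move=> x _; have : Ck 0 setT (fun x : E => \sum_(i < D.+1 | (m <= i)%N) x 0 i ^+ 2).
  apply: Ck_sum => [|i _]; first exact: openT.
  by apply: CkM; [exact: openT|exact/Ck_coord/openT..].
exact.
Qed.

Lemma closed_surf m : closed (surf m c dl r : set E).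
Proof.
apply: closedI; first exact: closed_flat.
by apply: (preimage_closed _ (@closed_eq R 0)) => x _; exact: continuous_lvl.
Qed.

Lemma closed_body m : closed (body m c dl r : set E).
Proof.
apply: closedI; first exact: closed_flat.
by apply: (preimage_closed _ (@closed_le R 0)) => x _; exact: continuous_lvl.
Qed.

Let bounded_lvl (A : set E) : (forall x, A x -> F x <= 0) -> bounded_set A.
Proof.
move=> AF; exists (Num.sqrt (r ^+ 2 + 2 * c * dl ^+ 2)); split; first exact: num_real.
move=> K lK x Ax; apply: le_trans (norm_le_enorm x) _; rewrite enormE.
by apply: le_trans (ltW lK); apply: ler_wsqrtr; apply: lvl_norm_le => //; exact: AF.
Qed.

Lemma compact_surf m : compact (surf m c dl r : set E).
Proof.
apply: bounded_closed_compact; last exact: closed_surf.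
by apply: bounded_lvl => x [_ ->].
Qed.

Lemma compact_body m : compact (body m c dl r : set E).
Proof.
apply: bounded_closed_compact; last exact: closed_body.
by apply: bounded_lvl => x [].
Qed.

Lemma lvl_center x : dotv x x <= r ^+ 2 -> F x <= 0.
Proof.
move=> xr; have : 0 <= pbump c dl (tailsq x) by exact: pbump_ge0.
by rewrite /lvl; lra.
Qed.

Lemma body_star x (t : R) m y : body m c dl r x -> body m c dl r y -> 0 <= t <= 1 ->
  body m c dl r (x + t *: (y - x)).
Proof.
move=> [fx Fx] [fy Fy] /andP[t0 t1]; split; first exact: flat_segment.
have := @lvl_midpoint R D c dl r c0 cle dl0 x y t; rewrite t0 t1 => /(_ isT) h.
apply: le_trans h _.
have := dotv_ge0 (y - x); have : 0 <= t * (1 - t) by rewrite mulr_ge0// subr_ge0.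
move: (t * (1 - t)) (dotv _ _) => a b a0 b0.
have : 0 <= a / 2 * b by rewrite mulr_ge0// divr_ge0.
have : (1 - t) * F x <= 0 by rewrite mulr_ge0_le0// subr_ge0.
have : t * F y <= 0 by rewrite mulr_ge0_le0.
lra.
Qed.

Lemma body0 m : body m c dl r (0 : E).
Proof.
split; first by move=> i _; rewrite mxE.
apply: lvl_center; rewrite (_ : dotv 0 0 = 0) ?sqr_ge0//.
by apply/eqP; rewrite dotv_eq0.
Qed.

Lemma connected_body m : connected (body m c dl r : set E).
Proof. by apply: star_connected (body0 m) _ => x t Bx t01; apply: body_star => //; exact: body0. Qed.

(** Each of the two hemispheres x_0 >= 0 and x_0 <= 0 of the surface is the graph of
    this function, up to sign, over the equatorial ball. *)
Definition cap_height (N : R) : R := Num.sqrt (r ^+ 2 + 2 * pbump c dl N - N).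

Definition hemi_point (s : R) (y : E) : E :=
  y + (s * cap_height (tailsq y)) *: delta_mx 0 ord0.

Lemma hemi_coord0 s (y : E) : y 0 ord0 = 0 -> hemi_point s y 0 ord0 = s * cap_height (tailsq y).
Proof. by move=> y0; rewrite !mxE y0 add0r !eqxx mulr1. Qed.

Lemma hemi_coord s (y : E) i : i != ord0 -> hemi_point s y 0 i = y 0 i.
Proof. by move=> i0; rewrite !mxE eqxx/= (negbTE i0) mulr0 addr0. Qed.

Lemma tailsq_hemi s (y : E) : tailsq (hemi_point s y) = tailsq y.
Proof. by apply: eq_bigr => i i0; rewrite hemi_coord. Qed.

Lemma hemi_surf s (y : E) : s * s = 1 -> flat_model n.+1 y -> y 0 ord0 = 0 ->
  tailsq y <= r ^+ 2 + 2 * pbump c dl (tailsq y) -> surf n.+1 c dl r (hemi_point s y).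
Proof.
move=> ss fy y0 Ny; split.
  move=> i ni; rewrite hemi_coord ?fy//.
  by apply/eqP => i0; move: ni; rewrite i0.
rewrite /lvl dotv_split tailsq_hemi hemi_coord0// exprMn expr2 ss mul1r.
by rewrite sqr_sqrtr ?subr_ge0//; ring.
Qed.

Lemma surf_tailsq_le x : F x = 0 -> tailsq x <= r ^+ 2 + 2 * pbump c dl (tailsq x).
Proof.
by rewrite /lvl dotv_split => Fx; have := sqr_ge0 (x 0 ord0); lra.
Qed.

Lemma surf_hemi x : surf n.+1 c dl r x ->
  exists s (y : E), [/\ s * s = 1, flat_model n.+1 y, y 0 ord0 = 0,
    tailsq y <= r ^+ 2 & x = hemi_point s y].
Proof.
move=> [fx Fx].
pose y := x - (x 0 ord0) *: delta_mx 0 ord0.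
have y0 : y 0 ord0 = 0 by rewrite !mxE !eqxx mulr1 subrr.
have yi i : i != ord0 -> y 0 i = x 0 i.
  by move=> i0; rewrite !mxE eqxx/= (negbTE i0) mulr0 subr0.
have Ny : tailsq y = tailsq x by apply: eq_bigr => i i0; rewrite yi.
have x0 : x 0 ord0 ^+ 2 = r ^+ 2 + 2 * pbump c dl (tailsq x) - tailsq x.
  by move: Fx; rewrite /lvl dotv_split; lra.
exists (if 0 <= x 0 ord0 then 1 else -1), y; split=> //.
- by case: ifP => _; rewrite ?mulr1// mulrNN mulr1.
- move=> i ni; rewrite yi ?fx//.
  by apply/eqP => i0; move: ni; rewrite i0.
- rewrite Ny; have [Nd|Nd] := leP (dl ^+ 2) (tailsq x).
    by have := surf_tailsq_le Fx; rewrite pbump_far// mulr0 addr0.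
  by apply/ltW/(lt_trans Nd); rewrite ltr_pXn2r// nnegrE ltW.
- apply/rowP => i; have [->|i0] := eqVneq i ord0; last by rewrite hemi_coord// yi.
  rewrite hemi_coord0// /cap_height Ny -x0 sqrtr_sqr.
  have [h|h] := leP 0 (x 0 ord0); first by rewrite mul1r ger0_norm.
  by rewrite ltr0_norm// mulrNN mul1r.
Qed.

Lemma continuous_cap_height : continuous (fun y : E => cap_height (tailsq y)).
Proof.
move=> y; apply: (@continuous_comp _ _ _ (fun y : E => r ^+ 2 + 2 * pbump c dl (tailsq y) - tailsq y)); last exact: sqrt_continuous.
have : Ck 0 setT (fun y : E => (r ^+ 2 + 2 * pbump c dl (tailsq y)) + (-1) * tailsq y).
  apply: CkD; [exact: openT| |].
    apply: CkD; [exact: openT|exact: Ck_cst|].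
    apply: CkM; [exact: openT|exact: Ck_cst|].
    by move=> z _; exact: continuous_pbump.
  apply: CkM; [exact: openT|exact: Ck_cst|].
  by move=> z _; exact: continuous_tailsq.
move/(_ y Logic.I); congr (continuous_at _ _).
by apply/funext => z; rewrite mulN1r.
Qed.

(** The two hemispheres are images of a ball, and they meet on the equator, which is
    not empty as soon as there is a second flat coordinate. *)
Lemma connected_surf : (0 < n)%N -> connected (surf n.+1 c dl r : set E).
Proof.
move=> n0.
pose Om := [set y : E | [/\ flat_model n.+1 y, y 0 ord0 = 0 & tailsq y <= r ^+ 2]].
have tail0 : tailsq (0 : E) = 0 by apply: big1 => i _; rewrite mxE expr0n.
have cOm : connected Om.
  apply: (@star_connected _ _ _ 0) => [|x t [fx x0 Nx] /andP[t0 t1]].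
    by split=> [i _||]; rewrite ?mxE// tail0 sqr_ge0.
  rewrite add0r subr0; split; [exact: flatZ|by rewrite mxE x0 mulr0|].
  have -> : tailsq (t *: x) = t ^+ 2 * tailsq x.
    by rewrite mulr_sumr; apply: eq_bigr => i _; rewrite mxE exprMn.
  by apply: le_trans Nx; rewrite ler_piMl ?tailsq_ge0// exprn_ile1.
have chemi s (y : E) : {for y, continuous (hemi_point s)}.
  apply: continuousD; first exact: cvg_id.
  apply: continuousZl; apply: continuousM; first exact: cst_continuous.
  exact: continuous_cap_height.
have -> : surf n.+1 c dl r = (hemi_point 1 @` Om) `|` (hemi_point (-1) @` Om).
  apply/seteqP; split=> [x Sx|x].
    have [s [y [ss fy y0 Ny ->]]] := surf_hemi Sx.
    have : (s == 1) || (s == -1).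
      by rewrite -eqf_sqr expr2 ss expr1n.
    by move=> /orP[/eqP ->|/eqP ->]; [left|right]; exists y.
  have bnd y : tailsq y <= r ^+ 2 -> tailsq y <= r ^+ 2 + 2 * pbump c dl (tailsq y).
    by have : 0 <= pbump c dl (tailsq y) by [exact: pbump_ge0]; lra.
  case=> -[y [fy y0 Ny] <-]; apply: hemi_surf => //; rewrite ?mulr1 ?mulrNN ?mulr1//; exact: bnd.
apply: connectedU.
- have n1D : (1 < D.+1)%N by rewrite (leq_ltn_trans n0)// ltn_ord.
  pose e : E := r *: delta_mx 0 (Ordinal n1D).
  have Ne : tailsq e = r ^+ 2.
    rewrite /tailsq (bigD1 (Ordinal n1D))//= big1 ?addr0.
      by rewrite !mxE !eqxx mulr1.
    by move=> i /andP[_ i1]; rewrite !mxE (negbTE i1) andbF mulr0 expr0n.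
  have Oe : Om e.
    split; last by rewrite Ne.
      move=> i ni; rewrite !mxE; have -> : (i == Ordinal n1D) = false.
        by apply/eqP => i1; move: ni; rewrite i1/= ltnS leqn0 => /eqP n00; move: n0; rewrite n00.
      by rewrite andbF mulr0.
    by rewrite !mxE/= mulr0.
  exists (hemi_point 1 e); split; first by exists e.
  exists e => //; rewrite /hemi_point.
  have -> : cap_height (tailsq e) = 0.
    by rewrite /cap_height Ne pbump_far ?ler_pXn2r ?nnegrE ?ltW// mulr0 addr0 subrr sqrtr0.
  by rewrite !mulr0.
- by apply: connected_continuous_connected cOm _; apply: continuous_subspaceT => y; exact: chemi.
- by apply: connected_continuous_connected cOm _; apply: continuous_subspaceT => y; exact: chemi.
Qed.

Lemma reach_set0 (k : nat) : reach (set0 : set 'rV[R]_k) = +oo%E.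
Proof.
rewrite /reach (_ : medial_axis _ = set0) ?image_set0 ?ereal_inf0//.
by apply/seteqP; split => // z [x [y []]].
Qed.

(** Points of the surface have half charts; the other points of the body have flat
    charts, which exclude half charts by [flat_chart_not_boundary]. *)
Lemma boundary_body : boundary n.+1 (body n.+1 c dl r : set E) = surf n.+1 c dl r.
Proof.
apply/seteqP; split=> p.
  move=> bp; have [[fp Fp] _] := bp.
  have [F0|F0] := eqVneq (F p) 0; first by split.
  exfalso; apply: (flat_chart_not_boundary (conj fp Fp) _ bp).
  by apply: body_interior_chart => //; rewrite lt_neqAle F0.
move=> Sp; have [_ h] := surf_charts c0 dl0 dlr Sp; split=> //.
by have [fp Fp] := Sp; split; rewrite ?Fp.
Qed.

Lemma body_manifold (tau : R) : 3 * tau <= 2 * r ->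
  manifold_class n.+1 +oo tau%:E (body n.+1 c dl r : set E).
Proof.
move=> taur; split.
- exact: compact_body.
- exact: connected_body.
- split=> [|p [fp Fp]]; first exact: closed_body.
  have [F0|F0] := eqVneq (F p) 0.
    have [_ [W pW h]] := surf_charts c0 dl0 dlr (conj fp F0).
    by exists W => // V oV Vp VW; right; exact: h.
  have Flt : F p < 0 by rewrite lt_neqAle F0.
  have [W pW h] := body_interior_chart fp Flt.
  by exists W => // V oV Vp VW; left; exact: h.
- by rewrite reach_body.
- by rewrite boundary_body; exact: reach_surf.
Qed.

Lemma surf_manifold (tau : R) : (0 < n)%N -> 3 * tau <= 2 * r ->
  manifold_class n tau%:E +oo (surf n.+1 c dl r : set E).
Proof.
move=> n0 taur; split.
- exact: compact_surf.
- exact: connected_surf.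
- split=> [|p Sp]; first exact: closed_surf.
  have [[W pW h] _] := surf_charts c0 dl0 dlr Sp.
  by exists W => // V oV Vp VW; left; exact: h.
- exact: reach_surf.
- rewrite (_ : boundary _ _ = set0) ?reach_set0//.
  apply/seteqP; split=> // p bp; have [Sp _] := bp.
  have [h _] := surf_charts c0 dl0 dlr Sp.
  have nD : (n.-1 < D.+1)%N by rewrite (leq_ltn_trans (leq_pred _))// ltn_ord.
  have nE : n = (Ordinal nD).+1 :> nat by rewrite /= prednK.
  have := @flat_chart_not_boundary R D.+1 (Ordinal nD) _ _ Sp.
  by rewrite -nE => H; exact: H h bp.
Qed.

End profile_manifolds.

(** * Boxes under product laws *)

Section iid_boxes.
Context d (T : measurableType d) (R : realType) (P : probability T R).

Definition tuple_box n (B : nat -> set T) : set (n.-tuple T) :=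
  [set t | forall i : 'I_n, B i (tnth t i)].
Arguments tuple_box n B : clear implicits.

Lemma measurable_tuple_box n (B : nat -> set T) :
  (forall i, measurable (B i)) -> measurable (tuple_box n B).
Proof.
move=> mB; rewrite (_ : tuple_box n B =
    \bigcap_(i in [set: 'I_n]) ((fun t => tnth t i) @^-1` B i)).
  apply: fin_bigcap_measurable => [|i _]; first exact: finite_finset.
  by rewrite -[X in measurable X]setTI; apply: measurable_tnth.
by apply/seteqP; split => [t Bt i _|t Bt i]; exact: Bt.
Qed.

Lemma tuple_cons_box n (B : nat -> set T) :
  @tuple_cons d T n @^-1` tuple_box n.+1 B =
  B 0%N `*` tuple_box n (fun i => B i.+1).
Proof.
apply/seteqP; split => [[x t] /= Bt|[x t] /= [Bx Bt] i].
  split=> [|i]; first exact: (Bt ord0).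
  have := Bt (lift ord0 i); rewrite (tnth_nth x)/= (tnth_nth x).
  by rewrite /bump leq0n add1n.
rewrite (tnth_nth x)/=; case: i => -[|i] //= ilt.
have := Bt (Ordinal (ilt : (i < n)%N)).
by rewrite (tnth_nth x).
Qed.

Lemma iid_law_box n (B : nat -> set T) : (forall i, measurable (B i)) ->
  iid_law P n (tuple_box n B) = (\prod_(i < n) fine (P (B i)))%:E.
Proof.
elim: n B => [|n IH] B mB.
  rewrite big_ord0 /= diracE mem_set//.
  by case.
rewrite big_ord_recl /= /distribution /pushforward tuple_cons_box.
rewrite /iid_step product_measure1E//; last exact: measurable_tuple_box.
by rewrite [X in (_ * X)%E]IH// EFinM fineK// fin_num_measure.
Qed.

End iid_boxes.
Arguments tuple_box {d T} n B.

Section uniform_unit.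
Context (R : realType).

Definition unif01 : probability (measurableTypeR R) R :=
  [the probability _ R of uniform_prob (@ltr01 R)].

Lemma unif01_le (U : set R) : measurable U ->
  (unif01 U <= lebesgue_measure U)%E.
Proof.
move=> mU; rewrite /unif01 /= /uniform_prob.
rewrite -[leRHS]mul1e -(integral_cst lebesgue_measure mU 1).
apply: ge0_le_integral => //=.
- by move=> x _; rewrite lee_fin uniform_pdf_ge0.
- by apply/measurable_EFinP/measurable_funTS; exact: measurable_uniform_pdf.
- move=> x _; rewrite lee_fin /uniform_pdf subr0 invr1; case: ifP => //.
Qed.

Lemma unif01_ball (x e : R) : 0 <= e ->
  (unif01 `[(x - e)%R, (x + e)%R]%classic <= (2 * e)%:E)%E.
Proof.
move=> e0; apply: le_trans (unif01_le _) _ => //.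
rewrite lebesgue_measure_itv/= lte_fin; case: ifP => _; rewrite -?EFinB lee_fin; lra.
Qed.

Lemma unif01_unit : unif01 `[0%R, 1%R]%classic = 1%E.
Proof. by rewrite /unif01 /= /uniform_prob integral_uniform_pdf1. Qed.

End uniform_unit.

(** * Bounds for the Hausdorff measure from coordinates *)

Section hausdorff_bounds.
Context (R : realType) (D k : nat).
Notation E := 'rV[R]_D.
Implicit Types (A : set E) (sg : nat -> 'I_D) (a s : nat -> R).

Lemma ball_volume_gt0 n : 0 < ball_volume R n.
Proof.
suff : (0 < ball_volume R n) && (0 < ball_volume R n.+1) by case/andP.
elim: n => [|n /andP[h0 h1]]; first by rewrite /= ltr01 ltr0n.
by rewrite h1/= mulr_gt0// divr_gt0// mulr_gt0// pi_gt0.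
Qed.

Lemma gauge_le (A : set E) (e : R) : 0 <= e ->
  (forall x y, A x -> A y -> enorm (x - y) <= e) ->
  (diam A <= e%:E /\
   hausdorff_gauge k A <= (ball_volume R k / 2 ^+ k * e ^+ k)%:E)%E.
Proof.
move=> e0 Ae; have dA : (diam A <= e%:E)%E.
  rewrite /diam ge_max lee_fin e0/=; apply: ge_ereal_sup => _ [[x y] [Ax Ay] <-].
  by rewrite lee_fin; exact: Ae.
have w0 : 0 <= ball_volume R k / 2 ^+ k.
  by rewrite divr_ge0 ?exprn_ge0// ltW// ball_volume_gt0.
split=> //; rewrite /hausdorff_gauge; case: ifP => _.
  by rewrite lee_fin mulr_ge0 ?exprn_ge0.
have : (diam A \is a fin_num)%E.
  by rewrite ge0_fin_numE ?diam_ge0// (le_lt_trans dA)// ltry.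
move=> /fineK dE; rewrite -dE -EFin_expe -EFinM lee_fin ler_wpM2l//.
rewrite lerXn2r ?nnegrE ?fine_ge0 ?diam_ge0//.
by rewrite -lee_fin dE.
Qed.

(** Coordinates are 1-Lipschitz.  Hence a cover of A by sets of diameters rho_j yields
    a cover of the box by cubes of sides 2 rho_j, whose volumes must add up to that
    of the box.  Here the law of k independent uniform variables, rescaled to the box,
    plays the role of the Lebesgue measure of R^k.  The factor 4^k combines the 2^k in
    the gauge with the 2^k lost by taking cubes around points of the sets. *)
Lemma hausdorff_lower A sg a s : (0 < k)%N -> (forall i, 0 < s i) ->
  (forall t : nat -> R, (forall i, (i < k)%N -> a i <= t i <= a i + s i) ->
     exists2 x, A x & forall i, (i < k)%N -> x 0 (sg i) = t i) ->
  ((ball_volume R k / 4 ^+ k * \prod_(i < k) s i)%:E <= hausdorff_measure k A)%E.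
Proof.
move=> k0 s0 Abox; apply: le_trans (le_hausdorff_measure_pre _ _ ltr01).
apply: le_ereal_inf_tmp => _ [F [AF Fd] <-].
pose rho j := fine (diam (F j)).
have rhoE j : ((rho j)%:E = diam (F j))%E.
  rewrite fineK// ge0_fin_numE ?diam_ge0//.
  by rewrite (le_lt_trans (Fd j))// ltry.
have rho0 j : 0 <= rho j by rewrite -lee_fin rhoE diam_ge0.
pose z j := xget 0 (F j).
have Fz j x : F j x -> F j (z j) by move=> Fx; apply: xgetPex; exists x.
pose ctr j i := (z j 0 (sg i) - a i) / s i.
pose B j i : set (measurableTypeR R) := if pselect (F j !=set0)
  then `[(ctr j i - rho j / s i)%R, (ctr j i + rho j / s i)%R]%classic else set0.
have BE j i x : F j x ->
    B j i = `[(ctr j i - rho j / s i)%R, (ctr j i + rho j / s i)%R]%classic.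
  by move=> Fx; rewrite /B; case: pselect => //= nF; exfalso; apply: nF; exists x.
have mB j i : measurable (B j i) by rewrite /B; case: pselect => /= _.
pose unit : nat -> set (measurableTypeR R) := fun=> `[0%R, 1%R]%classic.
pose P := iid_law (unif01 R) k.
pose C := ball_volume R k / 4 ^+ k * \prod_(i < k) s i.
have w0 : 0 < ball_volume R k := ball_volume_gt0 k.
have ps0 : 0 < \prod_(i < k) s i by apply: prodr_gt0.
have C0 : 0 <= C by rewrite mulr_ge0 ?divr_ge0 ?exprn_ge0 ?ltW.
have PB j : (C%:E * P (tuple_box k (B j)) <= hausdorff_gauge k (F j))%E.
  rewrite /P iid_law_box//.
  have [[x Fx]|Fj0] := pselect (F j !=set0); last first.
    rewrite (_ : \prod_(i < k) _ = 0).
      by rewrite mule0 hausdorff_gauge_ge0.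
    apply/eqP/prodf_eq0; exists (Ordinal k0) => //=.
    by rewrite /B; case: pselect => //= _; rewrite measure0.
  rewrite /hausdorff_gauge; case: ifP => [/eqP F0|_]; first by rewrite F0 in Fx.
  rewrite -rhoE -EFin_expe -!EFinM lee_fin.
  have le1 : \prod_(i < k) fine (unif01 R (B j i)) <= \prod_(i < k) (2 * (rho j / s i)).
    apply: ler_prod => i _; rewrite fine_ge0//= -lee_fin fineK ?fin_num_measure//.
    rewrite (BE _ _ _ Fx); apply: unif01_ball.
    by rewrite divr_ge0// ltW.
  apply: le_trans (ler_wpM2l C0 le1) _.
  rewrite !big_split/= prodfV !prodr_const card_ord /C.
  have -> : 4 ^+ k = 2 ^+ k * 2 ^+ k :> R by rewrite -exprMn; congr (_ ^+ _); ring.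
  rewrite le_eqVlt; apply/orP; left; apply/eqP; field.
  by rewrite expf_neq0//= gt_eqF.
have mU i : measurable (unit i) by exact: measurable_itv.
have unitP : P (tuple_box k unit) = 1%E.
  rewrite /P (@iid_law_box _ _ _ _ _ _ mU); congr EFin; apply: big1 => i _.
  by rewrite [X in fine X]unif01_unit.
have cov : tuple_box k unit `<=` \bigcup_j tuple_box k (B j).
  move=> t t01.
  have [x Ax xt] : exists2 x, A x & forall i, (i < k)%N ->
      x 0 (sg i) = a i + s i * nth 0 t i.
    apply: (Abox (fun i => a i + s i * nth 0 t i)) => i ik.
    have := t01 (Ordinal ik); rewrite /unit (tnth_nth 0)/= in_itv/= => /andP[h0 h1].
    have si := ltW (s0 i).
    by rewrite lerDl lerD2l mulr_ge0// ler_piMr.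
  have [j _ Fx] := AF _ Ax; exists j => // i.
  rewrite (BE _ _ _ Fx) (tnth_nth 0)/= in_itv/= -ler_distlC.
  have -> : ctr j i - nth 0 t i = (z j 0 (sg i) - x 0 (sg i)) / s i.
    by rewrite xt// /ctr; field; rewrite gt_eqF.
  rewrite normrM normfV (gtr0_norm (s0 i)) ler_pM2r ?invr_gt0//.
  have -> : z j 0 (sg i) - x 0 (sg i) = (z j - x) 0 (sg i) by rewrite !mxE.
  apply: le_trans (coord_le_enorm _ _) _.
  by rewrite -lee_fin rhoE; apply: enorm_diam => //; exact: Fz Fx.
rewrite -/C -[leLHS]mule1 -unitP.
apply: (@le_trans _ _ (C%:E * \sum_(j <oo) P (tuple_box k (B j)))%E).
  rewrite lee_wpmul2l ?lee_fin//; apply: measure_sigma_subadditive => //.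
    by move=> j; exact: measurable_tuple_box.
  exact: measurable_tuple_box.
rewrite -nneseriesZl//; apply: lee_nneseries => [j _|j _]; last exact: PB.
by rewrite mule_ge0// lee_fin.
Qed.

Lemma finite_cover_premeasure (I : finType) (A : set E) (cell : I -> set E) (e delta : R) :
  0 <= e -> e <= delta -> A `<=` \bigcup_i cell i ->
  (forall i x y, cell i x -> cell i y -> enorm (x - y) <= e) ->
  (hausdorff_premeasure k delta A <=
    (#|I|%:R * (ball_volume R k / 2 ^+ k * e ^+ k))%:E)%E.
Proof.
move=> e0 ed Acell celle.
pose cs := [seq cell i | i <- enum I].
pose F j := nth set0 cs j.
have szc : size cs = #|I| by rewrite size_map cardE.
set g := ball_volume R k / 2 ^+ k * e ^+ k.
have g0 : 0 <= g by rewrite mulr_ge0 ?divr_ge0 ?exprn_ge0// ltW// ball_volume_gt0.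
have FP j : (diam (F j) <= delta%:E)%E /\
    (hausdorff_gauge k (F j) <= (if (j < #|I|)%N then g else 0)%:E)%E.
  rewrite -szc; case: ltnP => jI; last first.
    rewrite /F nth_default// hausdorff_gauge0 diam0 !lee_fin; split=> //.
    exact: le_trans ed.
  have [i Fi] : exists i, F j = cell i.
    have : F j \in [seq cell i | i <- enum I] by exact: mem_nth.
    by case/mapP => i _ ->; exists i.
  rewrite Fi; have [h1 h2] := gauge_le e0 (celle i).
  by split=> //; apply: le_trans h1 _; rewrite lee_fin.
apply: (@le_trans _ _ (\sum_(j <oo) hausdorff_gauge k (F j))%E).
  apply: ereal_inf_lbound; exists F => //; split; last by move=> j; have [] := FP j.
  move=> x /Acell[i _ xi]; exists (index i (enum I)) => //.
  have iI : (index i (enum I) < size (enum I))%N by rewrite index_mem mem_enum.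
  by rewrite /F (nth_map i)// nth_index// mem_enum.
apply: lime_le; first by apply: is_cvg_nneseries => *; exact: hausdorff_gauge_ge0.
apply: nearW => n.
have le1 : (\sum_(0 <= j < n) hausdorff_gauge k (F j) <=
   (\sum_(0 <= j < n) (if (j < #|I|)%N then g else 0))%:E)%E.
  by rewrite -sumEFin; apply: lee_sum => j _; have [] := FP j.
apply: le_trans le1 _; rewrite lee_fin.
have -> : \sum_(0 <= j < n) (if (j < #|I|)%N then g else 0) = (minn n #|I|)%:R * g.
  elim: n => [|n IH]; first by rewrite big_geq// min0n mul0r.
  rewrite big_nat_recr//= IH; case: ltnP => nI.
    by rewrite !(minn_idPl _)// 1?ltnW// -addn1 natrD mulrDl mul1r.
  by rewrite addr0 !(minn_idPr _)// ltnW.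
by rewrite ler_wpM2r// ler_nat geq_minr.
Qed.

(** Cut the box of the k coordinates into cubes of side eps; above each of them A has
    diameter at most L eps.  The number of cubes is at most the product of the
    2 s_i / eps, so that eps disappears from the bound. *)
Lemma hausdorff_upper A sg a s (L : R) : 0 < L -> (forall i, 0 < s i) ->
  (forall x i, A x -> (i < k)%N -> a i <= x 0 (sg i) <= a i + s i) ->
  (forall x y (e : R), A x -> A y ->
     (forall i, (i < k)%N -> `|x 0 (sg i) - y 0 (sg i)| <= e) ->
     enorm (x - y) <= L * e) ->
  (hausdorff_measure k A <=
    (ball_volume R k * L ^+ k * \prod_(i < k) s i)%:E)%E.
Proof.
move=> L0 s0 Abox Alip; apply: ge_ereal_sup => _ [delta /= d0 <-].
(* At most the least side of the box, so that rounding up the number of cubes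
   along a side costs a factor 2 at most. *)
pose eps := Num.min (delta / L) (\big[Num.min/1]_(i < k) s i).
have eps0 : 0 < eps.
  rewrite lt_min divr_gt0//=; elim/big_ind: _ => // x y x0 y0.
  by rewrite lt_min x0.
have epss (i : 'I_k) : eps <= s i.
  by rewrite ge_min; apply/orP; right; exact: bigmin_le.
have epsd : L * eps <= delta.
  by rewrite mulrC -ler_pdivlMr// ge_min lexx.
pose N (i : 'I_k) := (Num.truncn (s i / eps)).+1.
pose I := {dffun forall i : 'I_k, 'I_(N i)}.
pose cell (f : I) : set E := [set x | A x /\ forall i : 'I_k,
  a i + (f i)%:R * eps <= x 0 (sg i) <= a i + (f i)%:R * eps + eps].
have Acell : A `<=` \bigcup_i cell i.
  move=> x Ax.
  have q0 (i : 'I_k) : 0 <= (x 0 (sg i) - a i) / eps.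
    by have /andP[h _] := Abox x i Ax (ltn_ord i); rewrite divr_ge0 ?subr_ge0// ltW.
  have qN (i : 'I_k) : (Num.truncn ((x 0%R (sg i) - a i) / eps) < N i)%N.
    rewrite ltnS; apply: le_truncn; rewrite ler_pM2r ?invr_gt0//.
    by have /andP[_] := Abox x i Ax (ltn_ord i); rewrite lerBlDl.
  exists [ffun i => Ordinal (qN i)] => //; split=> // i; rewrite ffunE/=.
  have /andP[h0 h1] := truncn_itv (q0 i).
  rewrite -lerBrDl -ler_pdivlMr// h0/=.
  move: h1; move: (Num.truncn _) => t; rewrite ltr_pdivrMr// -[t.+1]addn1 natrD mulrDl mul1r.
  by move: (_%:R * eps) => T; lra.
have cellL f x y : cell f x -> cell f y -> enorm (x - y) <= L * eps.
  move=> [Ax fx] [Ay fy]; apply: Alip => // i ik.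
  have /andP[x0 x1] := fx (Ordinal ik); have /andP[y0 y1] := fy (Ordinal ik).
  by rewrite ler_norml; move: x0 x1 y0 y1 => /=; lra.
apply: le_trans (finite_cover_premeasure _ epsd Acell cellL) _.
  by rewrite mulr_ge0 ?ltW.
rewrite lee_fin card_dep_ffun.
have -> : foldr muln 1%N [seq #|'I_(N x)| | x : 'I_k] = (\prod_(i < k) N i)%N.
  by rewrite foldrE big_map big_enum/=; apply: eq_bigr => i _; rewrite card_ord.
rewrite natr_prod.
have NE : \prod_(i < k) (N i)%:R <= \prod_(i < k) (2 * (s i / eps)) :> R.
  apply: ler_prod => i _; rewrite ler0n/= /N.
  have se1 : 1 <= s i / eps by rewrite ler_pdivlMr// mul1r epss.
  have /andP[h0 _] := truncn_itv (le_trans ler01 se1).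
  by rewrite -addn1 natrD; lra.
have w0 : 0 <= ball_volume R k / 2 ^+ k * (L * eps) ^+ k.
  by rewrite mulr_ge0 ?divr_ge0 ?exprn_ge0// ?mulr_ge0 ?ltW// ball_volume_gt0.
apply: le_trans (ler_wpM2r w0 NE) _.
rewrite !big_split/= prodfV !prodr_const card_ord exprMn.
rewrite le_eqVlt; apply/orP; left; apply/eqP; field.
by rewrite !expf_neq0// gt_eqF.
Qed.

End hausdorff_bounds.

(** * The two-point method *)

Section iid_agree.
Context d (T : measurableType d) (R : realType).
Local Open Scope ereal_scope.

(** In the product integral the first point may be restricted to A, since the sections
    above the other points are empty. *)
Lemma iid_law_agree (P Q : probability T R) (A : set T) : measurable A ->
  (forall S, measurable S -> S `<=` A -> P S = Q S) ->
  forall n S, measurable S -> S `<=` tuple_box n (fun=> A) ->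
    iid_law P n S = iid_law Q n S.
Proof.
move=> mA PQ; elim=> [//|n IH] S mS SA.
rewrite /= /distribution /pushforward /iid_step.
set X := _ @^-1` S.
have mX : measurable X.
  by rewrite -[X]setTI; exact: measurable_tuple_cons.
have XA x : xsection X x `<=` tuple_box n (fun=> A).
  move=> t /xsectionP Xt i; have := SA _ Xt (lift ord0 i).
  by rewrite (tnth_nth x)/= (tnth_nth x).
have X0 x : ~ A x -> xsection X x = set0.
  move=> nAx; apply/seteqP; split=> // t /xsectionP Xt; apply: nAx.
  exact: (SA _ Xt ord0).
have restrict (m : probability (n.-tuple T) R) :
    (fun x => m (xsection X x)) = (fun x => m (xsection X x)) \_ A.
  apply/funext => x; rewrite patchE; case: ifPn => //.
  by rewrite notin_setE => /X0 ->; rewrite measure0.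
rewrite /product_measure1 /=.
rewrite [LHS](_ : _ = \int[P]_x ((fun x => iid_law P n (xsection X x)) \_ A) x); last first.
  by rewrite -restrict.
rewrite [RHS](_ : _ = \int[Q]_x ((fun x => iid_law Q n (xsection X x)) \_ A) x); last first.
  by rewrite -restrict.
rewrite -!integral_mkcond (eq_measure_integral Q)//.
apply: eq_integral => x _; apply: IH; last exact: XA.
exact: measurable_xsection.
Qed.

(** When the whole sample falls into A, which happens with probability P(A)^n, both
    laws coincide; there the two losses add up to at least h. *)
Lemma two_point_lower_bound (P Q : probability T R) (A : set T) n
    (g0 g1 : n.-tuple T -> \bar R) (h : R) : measurable A ->
  (forall S, measurable S -> S `<=` A -> P S = Q S) ->
  measurable_fun setT g0 -> measurable_fun setT g1 ->
  (forall t, 0 <= g0 t) -> (forall t, 0 <= g1 t) -> (0 <= h)%R ->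
  (forall t, h%:E <= g0 t + g1 t) ->
  (h * fine (P A) ^+ n)%:E <= \int[iid_law P n]_t g0 t + \int[iid_law Q n]_t g1 t.
Proof.
move=> mA PQ mg0 mg1 g00 g10 h0 hg.
pose X := tuple_box n (fun=> A).
have mX : measurable X by exact: measurable_tuple_box.
apply: (@le_trans _ _ (\int[iid_law P n]_(t in X) g0 t + \int[iid_law P n]_(t in X) g1 t)).
  rewrite -ge0_integralD//; [|exact: measurable_funTS..].
  apply: (@le_trans _ _ (\int[iid_law P n]_(t in X) (cst h%:E t))).
    rewrite integral_cst// [X in _ <= _ * X]iid_law_box// EFinM.
    by rewrite prodr_const card_ord.
  apply: ge0_le_integral => //.
  by apply: measurable_funTS; exact: emeasurable_funD.
apply: leeD.
  by apply: ge0_subset_integral.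
rewrite (eq_measure_integral (iid_law Q n)).
  by apply: ge0_subset_integral.
by move=> S mS SX; exact: iid_law_agree mS SX.
Qed.

End iid_agree.

Lemma one_sub_exp (R : realType) (p : R) (n : nat) : 0 <= p <= 1 ->
  1 - n%:R * p <= (1 - p) ^+ n.
Proof.
move=> /andP[p0 p1]; elim: n => [|n IH]; first by rewrite mul0r subr0 expr0.
rewrite exprS; apply: (@le_trans _ _ ((1 - p) * (1 - n%:R * p))).
  have : 0 <= n%:R * p * p by rewrite !mulr_ge0.
  by rewrite -addn1 natrD; lra.
by rewrite ler_wpM2l// subr_ge0.
Qed.

Section hausdorff_two_point.
Context (R : realType) (D : nat).
Local Open Scope ereal_scope.
Implicit Types (K M : set 'rV[R]_D).

Lemma edist_ge0 (z : 'rV[R]_D) K : 0 <= Defs.edist z K.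
Proof. by apply: le_ereal_inf_tmp => _ [x _ <-]; rewrite lee_fin enorm_ge0. Qed.

Lemma hausdorff_dist_ge0 K M : K !=set0 -> 0 <= hausdorff_dist K M.
Proof.
move=> [x Kx]; rewrite /hausdorff_dist le_max; apply/orP; left.
by apply: ereal_sup_ge; exists (Defs.edist x M); [exists x|exact: edist_ge0].
Qed.

Lemma edist_le_hausdorff K M (x : 'rV[R]_D) : K x -> Defs.edist x M <= hausdorff_dist K M.
Proof.
move=> Kx; rewrite /hausdorff_dist le_max; apply/orP; left.
by apply: ereal_sup_ubound; exists x.
Qed.

Lemma edist_le_hausdorff_r K M (x : 'rV[R]_D) : M x -> Defs.edist x K <= hausdorff_dist K M.
Proof.
move=> Kx; rewrite /hausdorff_dist le_max; apply/orP; right.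
by apply: ereal_sup_ubound; exists x.
Qed.

(** Go from x to a nearly nearest point of K, then to a nearly nearest point of M0. *)
Lemma hausdorff_separation (M0 M1 K : set 'rV[R]_D) (x : 'rV[R]_D) (h : R) :
  M0 !=set0 -> M1 x -> h%:E <= Defs.edist x M0 ->
  h%:E <= hausdorff_dist M0 K + hausdorff_dist M1 K.
Proof.
move=> M00 M1x hx.
have h00 : 0 <= hausdorff_dist M0 K by exact: hausdorff_dist_ge0.
have h10 : 0 <= hausdorff_dist M1 K by apply: hausdorff_dist_ge0; exists x.
have [->|f0] := eqVneq (hausdorff_dist M0 K) +oo.
  by rewrite addye ?leey// gt_eqF// (lt_le_trans _ h10)// ltNy0.
have [->|f1] := eqVneq (hausdorff_dist M1 K) +oo.
  by rewrite addey ?leey// gt_eqF// (lt_le_trans _ h00)// ltNy0.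
have F0 : hausdorff_dist M0 K \is a fin_num by rewrite ge0_fin_numE// ltey.
have F1 : hausdorff_dist M1 K \is a fin_num by rewrite ge0_fin_numE// ltey.
(* The set K is arbitrary: infima may not be attained, hence the slack e. *)
apply/lee_addgt0Pr => e e0.
pose e2 := (e / 2)%R; have e20 : (0 < e2)%R by rewrite divr_gt0.
have [_ [m Km <-] hm] : exists2 y, [set (enorm (x - z))%:E | z in K] y &
    y < hausdorff_dist M1 K + e2%:E.
  apply/ereal_inf_lt; apply: le_lt_trans (edist_le_hausdorff K M1x) _.
  by rewrite lteDl.
have [_ [y M0y <-] hy] : exists2 y, [set (enorm (m - z))%:E | z in M0] y &
    y < hausdorff_dist M0 K + e2%:E.
  apply/ereal_inf_lt; apply: le_lt_trans (edist_le_hausdorff_r M0 Km) _.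
  by rewrite lteDl.
apply: le_trans hx _.
apply: (@le_trans _ _ (enorm (x - y))%:E); first by apply: ereal_inf_lbound; exists y.
apply: (@le_trans _ _ ((enorm (x - m))%:E + (enorm (m - y))%:E)).
  by rewrite -EFinD lee_fin; exact: enorm_triangle.
apply: (@le_trans _ _ ((hausdorff_dist M1 K + e2%:E) + (hausdorff_dist M0 K + e2%:E))).
  by apply: leeD; exact: ltW.
have -> : e%:E = e2%:E + e2%:E :> \bar R by rewrite -EFinD /e2; congr EFin; lra.
by rewrite addeACA [X in X + _]addeC.
Qed.

End hausdorff_two_point.

(** The law with density a on M outside of B, and b on M inside B, with respect to the
    Hausdorff measure. *)
Section two_level_law.
Context (R : realType) (D k : nat).
Notation E := 'rV[R]_D.
Notation mu := (hausdorff_measure k : set E -> \bar R).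
Context (M B : set E) (a b : {nonneg R}).
Context (mM : measurable M) (mB : measurable B).

Let mMB : measurable (M `\` B). Proof. exact: measurableD. Qed.
Let mMIB : measurable (M `&` B). Proof. exact: measurableI. Qed.

Definition two_level : set E -> \bar R :=
  measure_add (mscale a (mrestr (@hausdorff_measure R D k) mMB))
              (mscale b (mrestr (@hausdorff_measure R D k) mMIB)).

HB.instance Definition _ := Measure.on two_level.

Lemma measurable_two_level_density :
  measurable_fun setT (fun x : E => if x \in B then b%:num else a%:num : R).
Proof.
apply: measurable_fun_ifT => //; apply: (measurable_fun_bool true).
rewrite setTI (_ : _ @^-1` _ = B)//.
by apply/seteqP; split => x /=; [move/set_mem|move/mem_set].
Qed.

Lemma two_levelE (A : set E) :
  two_level A = (a%:num%:E * mu (A `&` (M `\` B)) + b%:num%:E * mu (A `&` (M `&` B)))%E.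
Proof. by rewrite /two_level measure_addE. Qed.

Context (total : (a%:num%:E * mu (M `\` B) + b%:num%:E * mu (M `&` B) = 1)%E).

Let two_level_setT : two_level setT = 1%E.
Proof. by rewrite two_levelE !setTI. Qed.

HB.instance Definition _ := Measure_isProbability.Build _ _ _ two_level two_level_setT.

Definition two_level_prob : probability E R := two_level.

Lemma two_level_integral (A : set E) : measurable A ->
  two_level A = (\int[hausdorff_measure k]_(x in A `&` M)
    (if x \in B then b%:num else a%:num)%:E)%E.
Proof.
move=> mA; rewrite two_levelE.
have -> : A `&` M = (A `&` (M `\` B)) `|` (A `&` (M `&` B)).
  apply/seteqP; split=> [x [Ax Mx]|x [[Ax [Mx _]]|[Ax [Mx _]]]//].
  by have [Bx|nBx] := pselect (B x); [right|left].
have mf (S : set E) : measurable S -> measurable_fun S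
    (fun x => (if x \in B then b%:num else a%:num)%:E : \bar R).
  by move=> mS; apply/measurable_EFinP/measurable_funTS; exact: measurable_two_level_density.
rewrite ge0_integral_setU//=.
- congr (_ + _)%E.
    rewrite (eq_integral (cst a%:num%:E)).
      by rewrite integral_cst//; exact: measurableI.
    by move=> x; rewrite inE => -[_ [_ nBx]]; rewrite memNset.
  rewrite (eq_integral (cst b%:num%:E)).
    by rewrite integral_cst//; exact: measurableI.
  by move=> x; rewrite inE => -[_ [_ Bx]]; rewrite mem_set.
- exact: measurableI.
- exact: measurableI.
- by apply: mf; apply: measurableU; exact: measurableI.
- by move=> x _; rewrite lee_fin; case: ifP.
- by apply/disj_setPRL => x [_ [_ Bx]] [_ [_]].
Qed.

End two_level_law.
Section two_point_risk.
Context (R : realType) (D k : nat).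
Notation E := 'rV[R]_D.
Notation mu := (@hausdorff_measure R D k).
Implicit Types (M B : set E).

Lemma open_measurable_rV (V : set E) : open V -> measurable V.
Proof. by move=> oV; exact: sub_sigma_algebra. Qed.

Lemma closed_measurable_rV (M : set E) : closed M -> measurable M.
Proof.
move=> cM; rewrite -[M]setCK; apply: measurableC; apply: open_measurable_rV.
exact: closed_openC.
Qed.

Definition locally_positive M := forall p V, M p -> open V -> V p ->
  (0 < mu (M `&` V))%E.

(** A closed set all of whose nonempty relatively open parts have positive measure is
    the support of every law that it carries with a density bounded below. *)
Lemma two_level_supp M B (a b : {nonneg R}) (mM : measurable M) (mB : measurable B)
    (total : (a%:num%:E * mu (M `\` B) + b%:num%:E * mu (M `&` B) = 1)%E) :
  closed M -> locally_positive M -> 0 < a%:num -> 0 < b%:num ->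
  supp (two_level_prob mM mB total) = M.
Proof.
move=> cM posM a0 b0; apply/seteqP; split=> x.
  move=> sx; apply: contrapT => nMx.
  have := sx _ (closed_openC cM) nMx.
  rewrite [X in (_ < X)%E](_ : _ = 0%E) ?ltxx//.
  rewrite [LHS]two_levelE.
  have -> : ~` M `&` (M `\` B) = set0 by apply/seteqP; split => // y [nMy [My _]].
  have -> : ~` M `&` (M `&` B) = set0 by apply/seteqP; split => // y [nMy [My _]].
  by rewrite measure0 !mule0 adde0.
move=> Mx V oV Vx; have mV := open_measurable_rV oV.
pose m := Num.min a%:num b%:num.
have m0 : 0 < m by rewrite lt_min a0 b0.
apply: (@lt_le_trans _ _ (m%:E * mu (M `&` V))%E).
  by rewrite mule_gt0 ?lte_fin//; exact: posM Vx.
rewrite [leRHS]two_levelE.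
apply: (@le_trans _ _ (m%:E * (mu (V `&` (M `\` B)) + mu (V `&` (M `&` B))))%E).
  apply: lee_wpmul2l; first by rewrite lee_fin ltW.
  apply: le_trans (outer_measureU2 (@hausdorff_measure R D k) _ _).
  apply: le_hausdorff_measure => y [My Vy].
  by have [By|nBy] := pselect (B y); [right|left].
rewrite ge0_muleDr ?measure_ge0//.
by apply: leeD; apply: lee_wpmul2r; rewrite ?measure_ge0// lee_fin ge_min lexx ?orbT.
Qed.

Lemma two_level_in_class M B (a b : {nonneg R}) (mM : measurable M) (mB : measurable B)
    (total : (a%:num%:E * mu (M `\` B) + b%:num%:E * mu (M `&` B) = 1)%E)
    (t1 t2 : \bar R) (fmin fmax : R) :
  manifold_class k t1 t2 M -> locally_positive M -> 0 < fmin ->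
  fmin <= a%:num <= fmax -> fmin <= b%:num <= fmax ->
  distribution_class k t1 t2 fmin fmax (two_level_prob mM mB total).
Proof.
move=> clM posM f0 fa fb; have [_ _ [cM _] _ _] := clM.
have sE : supp (two_level_prob mM mB total) = M.
  apply: two_level_supp => //.
    by case/andP: fa => fa _; exact: lt_le_trans fa.
  by case/andP: fb => fb _; exact: lt_le_trans fb.
rewrite /distribution_class /= sE; split=> //.
exists (fun x => if x \in B then b%:num else a%:num); split.
- by apply: measurable_funTS; exact: measurable_two_level_density.
- by move=> x _; case: ifP.
- by move=> A mA; exact: two_level_integral mA.
Qed.

(** Both laws give the mass p = fmin * vhi to the cap, spread uniformly: its density is
    then at least fmin on either cap, as neither has volume above vhi.  The remaining
    mass 1 - p, which is at least 1 / 2, is spread uniformly on the common part.  The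
    factor 1 / 4 is the probability 1 / 2 of missing the cap, times the 1 / 2 lost when
    a sum of two risks is compared to their maximum. *)
Lemma two_point_risk (n : nat) (t1 t2 : \bar R) (fmin fmax : R) (M0 M1 B : set E)
    (lo hi vlo vhi h : R) (x : E) :
  (0 < n)%N -> manifold_class k t1 t2 M0 -> manifold_class k t1 t2 M1 ->
  locally_positive M0 -> locally_positive M1 -> measurable B ->
  M0 `\` B = M1 `\` B ->
  0 < lo -> 0 < hi -> 0 < vlo -> 0 < vhi ->
  (lo%:E <= mu (M0 `\` B) <= hi%:E)%E ->
  (vlo%:E <= mu (M0 `&` B) <= vhi%:E)%E ->
  (vlo%:E <= mu (M1 `&` B) <= vhi%:E)%E ->
  0 < fmin -> fmin <= (2 * hi)^-1 -> lo^-1 <= fmax ->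
  fmin * vhi <= (2 * n%:R)^-1 -> fmin * (vhi / vlo) <= fmax ->
  0 <= h -> M1 x -> (h%:E <= Defs.edist x M0)%E ->
  ((h / 4)%:E <= minimax_risk n (@distribution_class R D k t1 t2 fmin fmax))%E.
Proof.
move=> n0 cl0 cl1 pos0 pos1 mB M01 lo0 hi0 vlo0 vhi0 mid v0 v1 f0 fhi flo fn ffmax h0 M1x hx.
have [kM0 _ [cM0 _] _ _] := cl0; have [kM1 _ [cM1 _] _ _] := cl1.
have mM0 := closed_measurable_rV cM0; have mM1 := closed_measurable_rV cM1.
have finE (S : set E) (lb ub : R) : 0 < lb -> (lb%:E <= mu S <= ub%:E)%E ->
    [/\ mu S = (fine (mu S))%:E, lb <= fine (mu S) & fine (mu S) <= ub].
  move=> lb0 /andP[h1 h2].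
  have fS : mu S = (fine (mu S))%:E.
    rewrite fineK// ge0_fin_numE ?hausdorff_measure_ge0//.
    by apply: le_lt_trans h2 _; rewrite ltry.
  by split=> //; rewrite -lee_fin -fS.
have [mE mlo mhi] := finE _ _ _ lo0 mid.
have [v0E v0lo v0hi] := finE _ _ _ vlo0 v0.
have [v1E v1lo v1hi] := finE _ _ _ vlo0 v1.
set m := fine _ in mE mlo mhi; set w0 := fine _ in v0E v0lo v0hi.
set w1 := fine _ in v1E v1lo v1hi.
have nR0 : 0 < n%:R :> R by rewrite ltr0n.
have nR1 : 1 <= n%:R :> R by rewrite ler1n.
pose p := fmin * vhi; have p0 : 0 < p by rewrite mulr_gt0.
have p12 : p <= 1 / 2.
  by apply: le_trans fn _; rewrite mul1r lef_pV2 ?posrE ?mulr_gt0//; lra.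
have q0 : 0 < 1 - p by clear -p12; lra.
have p01 : 0 <= p <= 1 by apply/andP; split; [exact: ltW|clear -p12; lra].
have m0 : 0 < m by exact: lt_le_trans mlo.
have w00 : 0 < w0 by exact: lt_le_trans v0lo.
have w10 : 0 < w1 by exact: lt_le_trans v1lo.
have a0 : 0 <= (1 - p) / m by rewrite divr_ge0 ?ltW//; lra.
have b00 : 0 <= p / w0 by rewrite divr_ge0 ?ltW.
have b10 : 0 <= p / w1 by rewrite divr_ge0 ?ltW.
pose a := NngNum a0; pose b0 := NngNum b00; pose b1 := NngNum b10.
have tot0 : (a%:num%:E * mu (M0 `\` B) + b0%:num%:E * mu (M0 `&` B) = 1)%E.
  rewrite mE v0E -!EFinM -EFinD/=; congr EFin; field.
  by rewrite !gt_eqF.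
have tot1 : (a%:num%:E * mu (M1 `\` B) + b1%:num%:E * mu (M1 `&` B) = 1)%E.
  rewrite -M01 mE v1E -!EFinM -EFinD/=; congr EFin; field.
  by rewrite !gt_eqF.
have fa : fmin <= a%:num <= fmax.
  rewrite /=; apply/andP; split.
    apply: le_trans fhi _; rewrite invfM; apply: ler_pM.
    - by rewrite invr_ge0.
    - by rewrite invr_ge0 ltW.
    - lra.
    - by rewrite lef_pV2 ?posrE.
  apply: le_trans _ flo; rewrite -[leRHS]mul1r; apply: ler_pM.
  - lra.
  - by rewrite invr_ge0 ltW.
  - lra.
  - by rewrite lef_pV2 ?posrE.
have fb w : vlo <= w -> w <= vhi -> 0 < w -> fmin <= p / w <= fmax.
  move=> wlo whi w_gt0; apply/andP; split.
    by rewrite ler_pdivlMr// ler_wpM2l// ltW.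
  apply: le_trans _ ffmax; rewrite /p -mulrA ler_wpM2l// ?(ltW f0)//.
  by rewrite ler_wpM2l ?(ltW vhi0)// lef_pV2 ?posrE.
pose P0 := two_level_prob mM0 mB tot0; pose P1 := two_level_prob mM1 mB tot1.
have D0 : distribution_class k t1 t2 fmin fmax P0.
  by apply: two_level_in_class => //; exact: fb.
have D1 : distribution_class k t1 t2 fmin fmax P1.
  by apply: two_level_in_class => //; exact: fb.
have S0 : supp P0 = M0.
  by apply: two_level_supp => //=; exact: divr_gt0.
have S1 : supp P1 = M1.
  by apply: two_level_supp => //=; exact: divr_gt0.
have mA : measurable (~` B) by exact: measurableC.
have agree (S : set E) : measurable S -> S `<=` ~` B -> P0 S = P1 S.
  move=> mS SB; rewrite [LHS]two_levelE [RHS]two_levelE M01.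
  have SB0 M : S `&` (M `&` B) = set0.
    by apply/seteqP; split=> // y [Sy [_ By]]; exact: SB Sy By.
  by rewrite !SB0 measure0 !mule0.
have PA : P0 (~` B) = (1 - p)%:E.
  rewrite [LHS]two_levelE (_ : ~` B `&` (M0 `\` B) = M0 `\` B); last first.
    by apply/seteqP; split=> [y []|y [My nBy]].
  rewrite (_ : ~` B `&` (M0 `&` B) = set0); last first.
    by apply/seteqP; split=> // y [nBy [_ By]].
  rewrite measure0 mule0 adde0 mE -EFinM; congr EFin => /=; field.
  by rewrite gt_eqF.
have M0n0 : M0 !=set0.
  apply/set0P/eqP => M00; have : mu (M0 `\` B) = 0%E.
    by rewrite M00 set0D measure0.
  by rewrite mE => -[] m00; move: m0; rewrite m00 ltxx.
have M1n0 : M1 !=set0 by exists x.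
apply: le_ereal_inf_tmp => _ [Mhat [Mhn0 mMh] <-].
set S := ereal_sup _.
pose g0 t := hausdorff_dist M0 (Mhat t); pose g1 t := hausdorff_dist M1 (Mhat t).
have r0S : (\int[iid_law P0 n]_t g0 t <= S)%E.
  by rewrite /g0 -S0; apply: ereal_sup_ubound; exists P0.
have r1S : (\int[iid_law P1 n]_t g1 t <= S)%E.
  by rewrite /g1 -S1; apply: ereal_sup_ubound; exists P1.
have := @two_point_lower_bound _ _ _ P0 P1 (~` B) n g0 g1 h mA agree
  (mMh M0 M0n0 kM0) (mMh M1 M1n0 kM1).
have g00 t : (0 <= g0 t)%E by exact: hausdorff_dist_ge0.
have g10 t : (0 <= g1 t)%E by exact: hausdorff_dist_ge0.
have gh t : (h%:E <= g0 t + g1 t)%E by exact: hausdorff_separation hx.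
move=> /(_ g00 g10 h0 gh); rewrite PA /= => lb.
have half : 1 / 2 <= (1 - p) ^+ n.
  apply: le_trans _ (one_sub_exp n p01).
  have : n%:R * p <= n%:R * (2 * n%:R)^-1 by rewrite ler_wpM2l// ltW.
  have -> : n%:R * (2 * n%:R)^-1 = 1 / 2 :> R by field; rewrite gt_eqF.
  by move: (n%:R * p) => q; clear -q; lra.
have hS : ((h / 2)%:E <= S + S)%E.
  apply: le_trans _ (leeD r0S r1S); apply: le_trans _ lb; rewrite lee_fin.
  by have := ler_wpM2l h0 half; move: (h * (1 - p) ^+ n) => q; clear -q; lra.
have [->|Soo] := eqVneq S +oo%E; first by rewrite leey.
have Sge0 : (0 <= S)%E by apply: le_trans r0S; apply: integral_ge0.
have Sfin : S \is a fin_num by rewrite ge0_fin_numE// ltey.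
by move: hS; rewrite -(fineK Sfin) -EFinD !lee_fin; move: (fine S) => s; clear -s; lra.
Qed.

End two_point_risk.

(** * Volumes of the caps and of their complements: lower bounds *)

Lemma bump_ltn (j i n : nat) : (i < n)%N -> (fintype.bump j i < n.+1)%N.
Proof. by rewrite /fintype.bump; case: (j <= i)%N => /=; lia. Qed.

Lemma unbump_ltn (j i n : nat) : (j < n.+1)%N -> (i < n.+1)%N -> i != j ->
  (unbump j i < n)%N.
Proof. by rewrite /unbump; case: (ltnP j i) => /= ji; lia. Qed.

Section volumes.
Context (R : realType) (D : nat) (n : 'I_D.+1) (c dl r : R).
Context (c0 : 0 <= c) (cle : c <= 1 / 280) (dl0 : 0 < dl) (dlr : 2 * n.+1%:R * dl <= r).
Notation E := 'rV[R]_D.+1.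
Implicit Types (x y p : E) (A : set E).
Notation F := (@lvl R D c dl r).
Notation m := (n.+1%:R : R).
Notation w := (ball_volume R).

Let m1 : 1 <= m. Proof. by rewrite ler1n. Qed.
Let dlr1 : 2 * dl <= r.
Proof. by apply: le_trans dlr; rewrite -mulrA ler_wpM2l// ler_peMl// ltW. Qed.
Let r0 : 0 < r. Proof. by move: dlr1 dl0; lra. Qed.
Let dlltr : dl < r. Proof. by move: dlr1 dl0; lra. Qed.
Let dl2r2 : 4 * dl ^+ 2 <= r ^+ 2.
Proof.
have -> : 4 * dl ^+ 2 = (2 * dl) ^+ 2 by ring.
by rewrite ler_pXn2r// nnegrE; [rewrite mulr_ge0// ltW|exact: ltW].
Qed.

Let inordn (i : nat) : (i < n.+1)%N -> (inord i : 'I_D.+1) = i :> nat.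
Proof. by move=> i_n; rewrite inordK// (leq_trans i_n). Qed.

Definition flat_of (t : nat -> R) : E := \row_i (if (i < n.+1)%N then t i else 0).

Lemma flat_of_flat t : flat_model n.+1 (flat_of t).
Proof. by move=> i ni; rewrite mxE ltnNge ni. Qed.

Lemma flat_ofE t (i : nat) : (i < n.+1)%N -> flat_of t 0 (inord i) = t i.
Proof. by move=> i_n; rewrite mxE inordn// i_n. Qed.

Lemma flat_box_lower A (a s : nat -> R) : (forall i, 0 < s i) ->
  (forall x, flat_model n.+1 x ->
    (forall i : nat, (i < n.+1)%N -> a i <= x 0 (inord i) <= a i + s i) -> A x) ->
  ((w n.+1 / 4 ^+ n.+1 * \prod_(i < n.+1) s i)%:E <= hausdorff_measure n.+1 A)%E.
Proof.
move=> s0 HA; apply: (@hausdorff_lower R _ n.+1 A (fun i => inord i) a s) => // t tas.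
exists (flat_of t); last by move=> i i_n; rewrite flat_ofE.
apply: HA; first exact: flat_of_flat.
by move=> i i_n; rewrite flat_ofE//; exact: tas.
Qed.

Lemma hemi_box_lower A (a s : nat -> R) (sg : R) : (0 < n)%N -> (forall i, 0 < s i) ->
  (forall y, flat_model n.+1 y -> y 0 ord0 = 0 ->
    (forall i : nat, (i < n)%N -> a i <= y 0 (inord i.+1) <= a i + s i) ->
    A (hemi_point c dl r sg y)) ->
  ((w n / 4 ^+ n * \prod_(i < n) s i)%:E <= hausdorff_measure n A)%E.
Proof.
move=> n0 s0 HA.
apply: (@hausdorff_lower R _ n A (fun i => inord i.+1) a s) => // t tas.
pose y := flat_of (fun i => if i is i'.+1 then t i' else 0).
have yi i : (i < n)%N -> y 0 (inord i.+1) = t i.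
  by move=> i_n; rewrite flat_ofE.
exists (hemi_point c dl r sg y).
  apply: HA; [exact: flat_of_flat|by rewrite mxE|].
  by move=> i i_n; rewrite yi//; exact: tas.
move=> i i_n; rewrite hemi_coord ?yi//.
by apply/eqP => /(congr1 val); rewrite /= inordn.
Qed.

Lemma tailsq_flat y : flat_model n.+1 y ->
  tailsq y = \sum_(i < n) y 0 (inord i.+1) ^+ 2.
Proof.
move=> fy; rewrite /tailsq.
rewrite (eq_bigl (fun i : 'I_D.+1 => (0 < i)%N)); last first.
  by move=> i; rewrite lt0n.
pose G (i : nat) : R := y 0 (inord i) ^+ 2.
rewrite (eq_bigr (fun i : 'I_D.+1 => G i)); last by move=> i _; rewrite /G inord_val.
rewrite big_mkcond/= -(big_mkord xpredT (fun i => if (0 < i)%N then G i else 0)).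
rewrite big_nat_recl//= add0r.
rewrite (@big_cat_nat _ _ _ n)//=; last by rewrite -ltnS.
rewrite [X in _ + X]big_nat_cond [X in _ + X]big1 ?addr0.
  by rewrite big_mkord.
move=> i /andP[/andP[ni iD] _]; rewrite /G fy ?expr0n//.
by rewrite inordK// ltnS.
Qed.


Lemma tailsq_flat_le y (b : R) : flat_model n.+1 y -> 0 <= b ->
  (forall i : nat, (i < n)%N -> `|y 0 (inord i.+1)| <= b) ->
  tailsq y <= n%:R * b ^+ 2.
Proof.
move=> fy b0 yb; rewrite tailsq_flat// -[n in n%:R]card_ord -sum1_card natr_sum mulr_suml.
apply: ler_sum => i _; rewrite mul1r -(real_normK (num_real (y 0 _))).
by rewrite ler_pXn2r ?nnegrE// yb.
Qed.

Lemma prod_const (q : R) (l : nat) : \prod_(i < l) q = q ^+ l.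
Proof. by rewrite prodr_const card_ord. Qed.

Definition cylinder : set E := [set x | tailsq x < dl ^+ 2].

Let n_lt_m2 : n%:R < m ^+ 2.
Proof.
apply: (@lt_le_trans _ _ m); first by rewrite ltr_nat.
by rewrite expr2 ler_peMl.
Qed.

(** The half of the surface x_0 >= 0 is a graph over the equatorial ball, so its part
    over a box projects onto that box. *)
Lemma surf_cap_lower : (0 < n)%N ->
  ((w n / 4 ^+ n * (dl / m) ^+ n)%:E <=
   hausdorff_measure n (surf n.+1 c dl r `&` cylinder))%E.
Proof.
move=> n0; rewrite -prod_const.
have m0 : 0 < m by exact: lt_le_trans m1.
apply: (@hemi_box_lower _ (fun=> 0) (fun=> dl / m) 1) => // [_|y fy y0 ybox].
  exact: divr_gt0.
have Ny : tailsq y < dl ^+ 2.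
  apply: (@le_lt_trans _ _ (n%:R * (dl / m) ^+ 2)).
    apply: tailsq_flat_le => // [|i i_n]; first by rewrite divr_ge0 ?ltW.
    by have /andP[h1 h2] := ybox i i_n; rewrite ger0_norm// -[leRHS]add0r.
  rewrite expr_div_n mulrCA gtr_pMr ?exprn_gt0//.
  by rewrite ltr_pdivrMr ?exprn_gt0// mul1r.
split; last by rewrite /cylinder /= tailsq_hemi.
apply: hemi_surf => //; first by rewrite mulr1.
have : 0 <= pbump c dl (tailsq y) by exact: pbump_ge0.
by move: (ltW Ny) dl2r2 (sqr_ge0 dl); lra.
Qed.

Lemma surf_rest_lower : (0 < n)%N ->
  ((w n / 4 ^+ n * (r / (2 * m)) ^+ n)%:E <=
   hausdorff_measure n (surf n.+1 c dl r `\` cylinder))%E.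
Proof.
move=> n0; rewrite -prod_const.
have m0 : 0 < m by exact: lt_le_trans m1.
have q0 : 0 < r / (2 * m) by rewrite divr_gt0// mulr_gt0.
apply: (@hemi_box_lower _ (fun=> r / (2 * m)) (fun=> r / (2 * m)) 1) => // y fy y0 ybox.
have Nr : tailsq y <= r ^+ 2.
  apply: (@le_trans _ _ (n%:R * (r / m) ^+ 2)).
    apply: tailsq_flat_le => // [|i i_n]; first by rewrite divr_ge0 ?ltW.
    have /andP[h1 h2] := ybox i i_n; rewrite ger0_norm ?(le_trans (ltW q0))//.
    by apply: le_trans h2 _; rewrite le_eqVlt; apply/orP; left; apply/eqP; field; rewrite gt_eqF.
  rewrite expr_div_n mulrCA ler_piMr ?exprn_ge0 ?(ltW r0)//.
  by rewrite ler_pdivrMr ?exprn_gt0// mul1r ltW.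
have Nd : dl ^+ 2 <= tailsq y.
  apply: (@le_trans _ _ ((r / (2 * m)) ^+ 2)).
    rewrite ler_pXn2r ?nnegrE ?(ltW dl0) ?(ltW q0)//.
    by rewrite ler_pdivlMr ?mulr_gt0// mulrC.
  have /andP[h1 _] := ybox 0%N n0.
  rewrite tailsq_flat// (bigD1 (Ordinal n0))//= -[leLHS]addr0 lerD//.
    by rewrite ler_pXn2r ?nnegrE ?(ltW q0)// (le_trans (ltW q0)).
  by apply: sumr_ge0 => i _; exact: sqr_ge0.
split; last by rewrite /cylinder /= tailsq_hemi; apply/negP; rewrite -leNgt.
apply: hemi_surf => //; first by rewrite mulr1.
by rewrite pbump_far// mulr0 addr0.
Qed.

(** * Volumes of the caps and of their complements: upper bounds *)

Let cdl : 2 * c * dl ^+ 2 <= r ^+ 2.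
Proof.
have : c * dl ^+ 2 <= 1 / 280 * dl ^+ 2 by rewrite ler_wpM2r// exprn_ge0// ltW.
by have := dl2r2; have := sqr_ge0 dl; rewrite -mulrA; lra.
Qed.

Lemma lvl_coord_le x (i : 'I_D.+1) : F x <= 0 -> `|x 0 i| <= 2 * r.
Proof.
move=> Fx; apply: le_trans (coord_le_enorm x i) _.
rewrite -(@ler_pXn2r _ 2)// ?nnegrE ?enorm_ge0//; last by rewrite mulr_ge0// ltW.
have h : dotv x x <= r ^+ 2 + 2 * c * dl ^+ 2 by exact: lvl_norm_le.
by rewrite enorm_sq (le_trans h)// exprMn; move: cdl (sqr_ge0 r); lra.
Qed.

(** On the surface x_0^2 = r^2 - damped (N x): the bump perturbs N into a function of N
    that is still increasing, and Lipschitz with constant 2. *)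
Definition damped (N : R) : R := N - 2 * pbump c dl N.

Lemma damped_lip (N N' : R) : 0 <= N -> 0 <= N' ->
  `|N - N'| <= `|damped N - damped N'| <= 2 * `|N - N'|.
Proof.
wlog NN' : N N' / N <= N'.
  move=> H N0 N'0; have [NN'|NN'] := leP N N'; first exact: H.
  by rewrite distrC (distrC (damped N)); apply: H => //; exact: ltW.
move=> N0 _; have /andP[h1 h2] := pbump_mono c0 dl0 N0 NN'.
have h3 : 3 * c * (N' - N) <= 1 / 2 * (N' - N).
  by rewrite ler_wpM2r ?subr_ge0//; move: cle; lra.
rewrite (distrC N) (distrC (damped N)) (ger0_norm (_ : 0 <= N' - N)) ?subr_ge0//.
rewrite ger0_norm; rewrite /damped; lra.
Qed.

Lemma surf_damped x : F x = 0 -> x 0 ord0 ^+ 2 = r ^+ 2 - damped (tailsq x).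
Proof. by rewrite /lvl dotv_split /damped; lra. Qed.

(** The equation of the surface turns differences of the squares of the other
    coordinates into a bound for |x_j^2 - y_j^2|.  As x_j and y_j have the same sign
    and are at least b in absolute value, this is at least 2 b |x_j - y_j|. *)
Lemma surf_coord_lip (j : 'I_D.+1) (sg b e : R) x y : (j < n.+1)%N ->
  surf n.+1 c dl r x -> surf n.+1 c dl r y -> sg * sg = 1 -> 0 < b ->
  b <= sg * x 0 j -> b <= sg * y 0 j -> 0 <= e ->
  (forall i : 'I_D.+1, (i < n.+1)%N -> i != j -> `|x 0 i - y 0 i| <= e) ->
  `|x 0 j - y 0 j| * (2 * b) <= 8 * m * r * e.
Proof.
move=> jn [fx Fx] [fy Fy] ss b0 xb yb e0 xye.
pose sqd (i : 'I_D.+1) : R := x 0 i ^+ 2 - y 0 i ^+ 2.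
pose bd (i : 'I_D.+1) : R := if (i < n.+1)%N then 4 * r * e else 0.
have re0 : 0 <= 4 * r * e by rewrite !mulr_ge0// ltW.
have bd0 i : 0 <= bd i by rewrite /bd; case: ifP.
have sqd_bd i : i != j -> `|sqd i| <= bd i.
  move=> ij; rewrite /bd; case: ltnP => i_n; last first.
    by rewrite /sqd fx// fy// subrr normr0.
  rewrite /sqd subr_sqr normrM mulrC; apply: ler_pM => //; last exact: xye.
  apply: le_trans (ler_normD _ _) _.
  have := @lvl_coord_le x i; have := @lvl_coord_le y i.
  by rewrite Fx Fy lexx => /(_ isT) h1 /(_ isT) h2; lra.
have sum_bd (P : pred 'I_D.+1) : \sum_(i | P i) bd i <= m * (4 * r * e).
  apply: (@le_trans _ _ (\sum_i bd i)).
    by rewrite [leRHS](bigID P)/= lerDl sumr_ge0.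
  rewrite /bd -big_mkcond/= -(big_ord_widen _ (fun=> 4 * r * e)) ?ltn_ord//.
  by rewrite sumr_const card_ord -[leLHS]mulr_natl lexx.
have sum_sqd (P : pred 'I_D.+1) : (forall i, P i -> i != j) ->
    `|\sum_(i | P i) sqd i| <= m * (4 * r * e).
  move=> Pj; apply: le_trans (ler_norm_sum _ _ _) _; apply: le_trans (sum_bd P).
  by apply: ler_sum => i Pi; apply: sqd_bd; exact: Pj.
have NE : tailsq x - tailsq y = \sum_(i | i != ord0) sqd i by rewrite -sumrB.
have x0E : sqd ord0 = damped (tailsq y) - damped (tailsq x).
  by rewrite /sqd (surf_damped Fx) (surf_damped Fy); ring.
have /andP[dN1 dN2] := damped_lip (tailsq_ge0 y) (tailsq_ge0 x).
have key : `|sqd j| <= 8 * m * r * e.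
  have [j0|j0] := eqVneq j ord0.
    have ij (i : 'I_D.+1) : i != ord0 -> i != j by rewrite j0.
    rewrite j0 x0E (le_trans dN2)// distrC NE.
    by have := sum_sqd (fun i => i != ord0) ij; lra.
  (* For j other than 0, the equation is solved for N first, by inverting the
     increasing function damped. *)
  have sq0 : `|sqd ord0| <= 4 * r * e.
    by apply: le_trans (sqd_bd ord0 _) _; rewrite 1?eq_sym.
  have -> : sqd j = (tailsq x - tailsq y) - \sum_(i | (i != ord0) && (i != j)) sqd i.
    by rewrite NE (bigD1 j)//= addrK.
  apply: le_trans (ler_normB _ _) _.
  have := sum_sqd (fun i => (i != ord0) && (i != j)) (fun i h => proj2 (andP h)).
  have h2 : `|tailsq x - tailsq y| <= 4 * r * e.
    by rewrite distrC (le_trans dN1)// -x0E.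
  have : 4 * r * e <= m * (4 * r * e) by rewrite ler_peMl.
  by move: h2; lra.
apply: le_trans key; rewrite /sqd subr_sqr normrM ler_wpM2l//.
have -> : `|x 0 j + y 0 j| = `|sg * (x 0 j + y 0 j)|.
  rewrite normrM; have -> : `|sg| = 1; last by rewrite mul1r.
  by apply/eqP; rewrite -(@eqrXn2 _ 2)// real_normK ?num_real// expr2 ss expr1n.
by rewrite mulrDr; apply: le_trans (ler_norm _); lra.
Qed.

Lemma enorm_flat_le x (e e' : R) (j : 'I_D.+1) : flat_model n.+1 x -> 0 <= e ->
  (forall i : 'I_D.+1, (i < n.+1)%N -> i != j -> `|x 0 i| <= e) ->
  `|x 0 j| <= e' -> enorm x <= m * e + e'.
Proof.
move=> fx e0 xe xj; apply: le_trans (enorm_le_sum x) _.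
rewrite (bigD1 j)//= addrC lerD//.
apply: (@le_trans _ _ (\sum_(i < D.+1) if (i < n.+1)%N then e else 0)).
  rewrite [leRHS](bigD1 j)//= -[leLHS]add0r lerD//; first by case: ifP.
  apply: ler_sum => i ij; case: ltnP => i_n; first exact: xe.
  by rewrite fx// normr0.
rewrite -big_mkcond/= -(big_ord_widen _ (fun=> e)) ?ltn_ord//.
by rewrite sumr_const card_ord -[leLHS]mulr_natl lexx.
Qed.

(** Where |x_j| >= r / (2 m), the remaining coordinates control x_j by [surf_coord_lip],
    with a constant that depends on m only: the piece is a Lipschitz graph. *)
Lemma surf_piece_upper A (j : 'I_D.+1) (sg b : R) : (0 < n)%N -> (j < n.+1)%N -> sg * sg = 1 ->
  A `<=` surf n.+1 c dl r -> (forall x, A x -> r / (2 * m) <= sg * x 0 j) -> 0 < b ->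
  (forall x (i : 'I_D.+1), A x -> (i < n.+1)%N -> i != j -> `|x 0 i| <= b) ->
  (hausdorff_measure n A <= (w n * (9 * m ^+ 2) ^+ n * (2 * b) ^+ n)%:E)%E.
Proof.
move=> n0 jn ss AS Aj b0 Ab; rewrite -[(2 * b) ^+ n]prod_const.
have m0 : 0 < m by exact: lt_le_trans m1.
have bumpj (i : nat) : (i < n)%N -> (fintype.bump j i < n.+1)%N.
  exact: bump_ltn.
have inordj (i : nat) : (i < n)%N -> (inord (fintype.bump j i) : 'I_D.+1) != j.
  move=> i_n; rewrite -val_eqE/= inordn ?bumpj//.
  by rewrite eq_sym neq_bump.
apply: (@hausdorff_upper R _ n A (fun i => inord (fintype.bump j i)) (fun=> - b) (fun=> 2 * b)).
- by rewrite mulr_gt0// exprn_gt0.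
- by move=> i; rewrite mulr_gt0.
- move=> x i Ax i_n; have := Ab x (inord (fintype.bump j i)) Ax.
  rewrite inordn ?bumpj// => /(_ isT (inordj _ i_n)).
  by rewrite ler_norml; lra.
move=> x y e Ax Ay xye.
have e0 : 0 <= e by apply: le_trans (xye 0%N n0).
have xyi (i : 'I_D.+1) : (i < n.+1)%N -> i != j -> `|x 0 i - y 0 i| <= e.
  move=> i_n ij; have ijn : (i != j :> nat) by [].
  have ubn : (unbump j i < n)%N by exact: unbump_ltn.
  by have := xye _ ubn; rewrite unbumpK ?inord_val.
have rm0 : 0 < r / (2 * m) by rewrite divr_gt0// mulr_gt0.
have lip := surf_coord_lip jn (AS x Ax) (AS y Ay) ss rm0 (Aj x Ax) (Aj y Ay) e0 xyi.
have fxy : flat_model n.+1 (x - y).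
  by apply: flatB; [have [] := AS x Ax|have [] := AS y Ay].
have lipj : `|(x - y) 0 j| <= 8 * m ^+ 2 * e.
  have -> : (x - y) 0 j = x 0 j - y 0 j by rewrite !mxE.
  have rm : 0 < r / m by rewrite divr_gt0.
  rewrite -(ler_pM2r rm); move: lip.
  have -> : 2 * (r / (2 * m)) = r / m by field; rewrite gt_eqF.
  by have -> : 8 * m ^+ 2 * e * (r / m) = 8 * m * r * e by field; rewrite gt_eqF.
have xyi' (i : 'I_D.+1) : (i < n.+1)%N -> i != j -> `|(x - y) 0 i| <= e.
  by move=> i_n ij; rewrite !mxE; exact: xyi.
apply: le_trans (enorm_flat_le fxy e0 xyi' lipj) _.
have : m * e <= m ^+ 2 * e by rewrite ler_wpM2r// expr2 ler_peMl// (le_trans ler01).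
lra.
Qed.


Lemma finite_union_upper (I : finType) (k : nat) (P : I -> set E) A (q : R) : 0 <= q ->
  A `<=` \bigcup_i P i -> (forall i, (hausdorff_measure k (P i) <= q%:E)%E) ->
  (hausdorff_measure k A <= (#|I|%:R * q)%:E)%E.
Proof.
move=> q0 AP Pq.
have H (l : seq I) B : B `<=` [set x | exists2 i, i \in l & P i x] ->
    (hausdorff_measure k B <= ((size l)%:R * q)%:E)%E.
  elim: l B => [|i l IH] B Bl.
    rewrite (_ : B = set0) ?hausdorff_measure0 ?mul0r//.
    by apply/seteqP; split=> // x /Bl[].
  have -> : ((size (i :: l))%:R * q)%:E = (q%:E + ((size l)%:R * q)%:E)%E.
    by rewrite -EFinD /= -[(size l).+1]add1n natrD mulrDl mul1r.
  have Bsub : B `<=` P i `|` (B `\` P i).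
    by move=> x Bx; have [Px|Px] := pselect (P i x); [left|right].
  apply: le_trans (le_hausdorff_measure _ Bsub) _.
  apply: le_trans (outer_measureU2 _ _ _) _; apply: leeD; first exact: Pq.
  apply: IH => x [/Bl[j]]; rewrite inE => /orP[/eqP -> //|jl] Pj _.
  by exists j.
rewrite cardE; apply: H => x /AP[i _ Pi]; exists i => //.
by rewrite mem_enum.
Qed.

Lemma flat_dotv_le x (b : R) : flat_model n.+1 x -> 0 <= b ->
  (forall i : 'I_D.+1, (i < n.+1)%N -> `|x 0 i| <= b) -> dotv x x <= m * b ^+ 2.
Proof.
move=> fx b0 xb; rewrite dotv_sqE.
apply: (@le_trans _ _ (\sum_(i < D.+1) if (i < n.+1)%N then b ^+ 2 else 0)).
  apply: ler_sum => i _; case: ltnP => i_n; last by rewrite fx// expr0n.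
  by rewrite -(real_normK (num_real (x 0 i))) ler_pXn2r ?nnegrE// xb.
rewrite -big_mkcond/= -(big_ord_widen _ (fun=> b ^+ 2)) ?ltn_ord//.
by rewrite sumr_const card_ord -[leLHS]mulr_natl lexx.
Qed.

Let w_ge0 k : 0 <= w k. Proof. exact/ltW/ball_volume_gt0. Qed.

Let sgn (b : bool) : R := if b then 1 else -1.

Let sgn_sq b : sgn b * sgn b = 1.
Proof. by case: b; rewrite /sgn ?mulr1// mulrNN mulr1. Qed.

Let sgn_norm (q : R) : exists b, sgn b * q = `|q|.
Proof.
have [q0|q0] := leP 0 q; first by exists true; rewrite /sgn mul1r ger0_norm.
by exists false; rewrite /sgn mulN1r ltr0_norm.
Qed.

Lemma surf_large_coord x : surf n.+1 c dl r x ->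
  exists2 j : 'I_n.+1, true & r / (2 * m) <= `|x 0 (inord j)|.
Proof.
move=> [fx Fx]; apply: contrapT => H.
have m0 : 0 < m by exact: lt_le_trans m1.
have q0 : 0 <= r / (2 * m) by rewrite divr_ge0 ?mulr_ge0 ?ltW.
have : dotv x x <= m * (r / (2 * m)) ^+ 2.
  apply: flat_dotv_le => // i i_n; rewrite leNgt; apply/negP => xi; apply: H.
  by exists (Ordinal i_n) => //=; rewrite inord_val ltW.
have := lvl0_norm c0 Fx.
have -> : m * (r / (2 * m)) ^+ 2 = r ^+ 2 / (4 * m) by field; rewrite gt_eqF.
have : r ^+ 2 / (4 * m) < r ^+ 2.
  by rewrite ltr_pdivrMr ?mulr_gt0// ltr_pMr ?exprn_gt0//; move: m1; lra.
by move=> h1 h2 h3; have := lt_le_trans (le_lt_trans h3 h1) h2; rewrite ltxx.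
Qed.

(** A point of the surface has norm at least r, hence one of its m coordinates is at
    least r / (2 m) in absolute value: the surface is covered by 2 m Lipschitz graphs. *)
Lemma surf_upper : (0 < n)%N -> (hausdorff_measure n (surf n.+1 c dl r : set E) <=
  (2 * m * (w n * (9 * m ^+ 2) ^+ n * (4 * r) ^+ n))%:E)%E.
Proof.
move=> n0; have m0 : 0 < m by exact: lt_le_trans m1.
pose P (i : 'I_n.+1 * bool) : set E :=
  [set x | surf n.+1 c dl r x /\ r / (2 * m) <= sgn i.2 * x 0 (inord i.1)].
have -> : 2 * m = #|{: 'I_n.+1 * bool}|%:R :> R.
  by rewrite card_prod card_ord card_bool natrM mulrC.
apply: (@finite_union_upper _ _ P).
- by rewrite !mulr_ge0 ?exprn_ge0 ?mulr_ge0 ?sqr_ge0 ?(ltW r0) ?w_ge0//.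
- move=> x Sx; have [j _ xj] := surf_large_coord Sx.
  by have [b xb] := sgn_norm (x 0 (inord j)); exists (j, b) => //; split=> //=; rewrite xb.
move=> [j b]; have -> : 4 * r = 2 * (2 * r) by ring.
apply: (@surf_piece_upper _ (inord j) (sgn b)) => //.
- by rewrite inordn.
- by move=> x [].
- by move=> x [].
- by rewrite mulr_gt0.
- by move=> x i [[_ Fx] _] _ _; apply: lvl_coord_le; rewrite Fx.
Qed.

(** Over the cylinder x_0 is the large coordinate, and the n others stay below dl: two
    pieces suffice, both over a box of side 2 dl. *)
Lemma surf_cap_upper : (0 < n)%N -> (hausdorff_measure n (surf n.+1 c dl r `&` cylinder) <=
  (2 * (w n * (9 * m ^+ 2) ^+ n * (2 * dl) ^+ n))%:E)%E.
Proof.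
move=> n0; have m0 : 0 < m by exact: lt_le_trans m1.
pose P (b : bool) : set E := [set x |
  [/\ surf n.+1 c dl r x, cylinder x & r / (2 * m) <= sgn b * x 0 ord0]].
have -> : 2 * (w n * (9 * m ^+ 2) ^+ n * (2 * dl) ^+ n) =
    #|{: bool}|%:R * (w n * (9 * m ^+ 2) ^+ n * (2 * dl) ^+ n) by rewrite card_bool.
apply: (@finite_union_upper _ _ P).
- by rewrite !mulr_ge0 ?exprn_ge0 ?mulr_ge0 ?sqr_ge0 ?(ltW dl0) ?w_ge0//.
- move=> x [Sx Cx]; have [b xb] := sgn_norm (x 0 ord0); exists b => //; split=> //.
  rewrite xb; have [_ Fx] := Sx; have := lvl0_norm c0 Fx.
  rewrite dotv_split => h; apply: (@le_trans _ _ (r / 2)).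
    rewrite ler_pM2l// lef_pV2 ?posrE ?mulr_gt0//; move: m1; lra.
  rewrite -(@ler_pXn2r _ 2)// ?nnegrE//; last by rewrite divr_ge0// ltW.
  rewrite real_normK ?num_real//; have -> : (r / 2) ^+ 2 = r ^+ 2 / 4 by field.
  by have := dl2r2; have := sqr_ge0 r; move: Cx h; rewrite /cylinder/=; lra.
move=> b.
apply: (@surf_piece_upper _ ord0 (sgn b)) => //.
- by move=> x [].
- by move=> x [].
move=> x i [_ Cx _] _ i0; rewrite -(@ler_pXn2r _ 2)// ?nnegrE ?(ltW dl0)//.
rewrite real_normK ?num_real//; apply: le_trans (ltW Cx).
by rewrite /tailsq (bigD1 i)//= lerDl sumr_ge0// => *; exact: sqr_ge0.
Qed.

Lemma flat_box_upper A (a s : nat -> R) : (forall i, 0 < s i) ->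
  (forall x, A x -> flat_model n.+1 x) ->
  (forall x (i : nat), A x -> (i < n.+1)%N -> a i <= x 0 (inord i) <= a i + s i) ->
  (hausdorff_measure n.+1 A <= (w n.+1 * (2 * m) ^+ n.+1 * \prod_(i < n.+1) s i)%:E)%E.
Proof.
move=> s0 Af Abox; have m0 : 0 < m by exact: lt_le_trans m1.
apply: (@hausdorff_upper R _ n.+1 A (fun i => inord i) a s (2 * m)) => //.
move=> x y e Ax Ay xye.
have e0 : 0 <= e by apply: le_trans (xye 0%N _).
have xyi (i : 'I_D.+1) : (i < n.+1)%N -> `|(x - y) 0 i| <= e.
  by move=> i_n; have := xye i i_n; rewrite inord_val !mxE.
apply: le_trans (enorm_flat_le (flatB (Af x Ax) (Af y Ay)) e0 (fun i i_n _ => xyi i i_n) (xyi ord0 _)) _ => //.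
have : e <= m * e by rewrite ler_peMl.
lra.
Qed.

Lemma body_upper : (hausdorff_measure n.+1 (body n.+1 c dl r : set E) <=
  (w n.+1 * (2 * m) ^+ n.+1 * (4 * r) ^+ n.+1)%:E)%E.
Proof.
rewrite -(prod_const (4 * r)); apply: (@flat_box_upper _ (fun=> - (2 * r)) (fun=> 4 * r)).
- by move=> _; rewrite mulr_gt0.
- by move=> x [].
- by move=> x i [_ Fx] _; have := lvl_coord_le (inord i) Fx; rewrite ler_norml; lra.
Qed.

(** In the body, the bump only matters close to the surface.  Cutting the cylinder at
    this height leaves two caps of thickness dl^2 / r, whose volume is smaller than
    that of the cylinder by a factor of order (dl / r)^2. *)
Definition polar_cylinder : set E :=
  [set x | tailsq x < dl ^+ 2 /\ r ^+ 2 - dl ^+ 2 < x 0 ord0 ^+ 2].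

Let depth : R := dl ^+ 2 / r.
Let depth_gt0 : 0 < depth. Proof. by rewrite divr_gt0// exprn_gt0. Qed.
Let depthE : depth * r = dl ^+ 2. Proof. by rewrite /depth divfK// gt_eqF. Qed.
Let depth_sq : depth ^+ 2 <= dl ^+ 2 / 4.
Proof.
have r20 : 0 < r ^+ 2 by rewrite exprn_gt0.
rewrite -(ler_pM2r r20) -exprMn depthE.
have -> : (dl ^+ 2) ^+ 2 = dl ^+ 2 * dl ^+ 2 by ring.
have -> : dl ^+ 2 / 4 * r ^+ 2 = dl ^+ 2 * (r ^+ 2 / 4) by field.
apply: ler_wpM2l; first exact: sqr_ge0.
by have := dl2r2; lra.
Qed.
Let depthr : depth <= r / 4.
Proof. by rewrite -(ler_pM2r r0) depthE; have := dl2r2; lra. Qed.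

Definition slab_size (q q' : R) (i : nat) : R := if i is 0 then q else q'.

Let prod_slab (q q' : R) : \prod_(i < n.+1) slab_size q q' i = q * q' ^+ n.
Proof. by rewrite big_ord_recl/= prod_const. Qed.

Lemma body_cap_upper : (hausdorff_measure n.+1 (body n.+1 c dl r `&` polar_cylinder) <=
  (2 * (w n.+1 * (2 * m) ^+ n.+1 * (2 * depth * (2 * dl) ^+ n)))%:E)%E.
Proof.
have m0 : 0 < m by exact: lt_le_trans m1.
pose P (b : bool) : set E := [set x |
  [/\ body n.+1 c dl r x, polar_cylinder x & 0 <= sgn b * x 0 ord0]].
have -> : 2 * (w n.+1 * (2 * m) ^+ n.+1 * (2 * depth * (2 * dl) ^+ n)) =
    #|{: bool}|%:R * (w n.+1 * (2 * m) ^+ n.+1 * (2 * depth * (2 * dl) ^+ n)).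
  by rewrite card_bool.
apply: (@finite_union_upper _ _ P).
- apply: mulr_ge0; first by apply: mulr_ge0; [exact: w_ge0|exact/exprn_ge0/mulr_ge0].
  apply: mulr_ge0; first exact: mulr_ge0 (ltW depth_gt0).
  by apply/exprn_ge0/mulr_ge0 => //; exact: ltW.
- move=> x [Bx Cx]; have [b xb] := sgn_norm (x 0 ord0); exists b => //; split=> //.
  by rewrite xb.
move=> b; rewrite -prod_slab.
apply: (@flat_box_upper _
  (slab_size (sgn b * r - depth) (- dl)) (slab_size (2 * depth) (2 * dl))).
- by case=> [|i] /=; rewrite mulr_gt0.
- by move=> x [[]].
move=> x i [[fx Fx] [Nx x0] xb] i_n.
case: i i_n => [|i] i_n /=; last first.
  have : `|x 0 (inord i.+1)| <= dl.
    rewrite -(@ler_pXn2r _ 2)// ?nnegrE ?(ltW dl0)//.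
    rewrite real_normK ?num_real//; apply: le_trans (ltW Nx).
    rewrite /tailsq (bigD1 (inord i.+1))//=; last by rewrite -val_eqE/= inordn.
    by rewrite lerDl sumr_ge0// => *; exact: sqr_ge0.
  by rewrite ler_norml; lra.
have -> : inord 0 = ord0 :> 'I_D.+1 by apply: val_inj; rewrite /= inordn.
set t := x 0 ord0 in x0 xb *.
have hi : t ^+ 2 <= r ^+ 2 + dl ^+ 2.
  have h : dotv x x <= r ^+ 2 + 2 * c * dl ^+ 2 by exact: lvl_norm_le.
  have : c * dl ^+ 2 <= 1 / 280 * dl ^+ 2 by rewrite ler_wpM2r// exprn_ge0// ltW.
  move: h; rewrite dotv_split -/t -mulrA.
  by have := tailsq_ge0 x; have := sqr_ge0 dl; lra.
have : r - depth <= sgn b * t <= r + depth.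
  have st : (sgn b * t) ^+ 2 = t ^+ 2 by rewrite exprMn expr2 sgn_sq mul1r.
  apply/andP; split; rewrite -(@ler_pXn2r _ 2)// ?nnegrE ?st//.
  - by rewrite sqrrB mulr2n (mulrC r) depthE; move: depth_sq x0; have := sqr_ge0 dl; lra.
  - by move: depthr r0; lra.
  - by rewrite sqrrD mulr2n (mulrC r) depthE; move: hi; have := sqr_ge0 depth; have := sqr_ge0 dl; lra.
  - by move: depth_gt0 r0; lra.
by case: (b); rewrite /sgn; lra.
Qed.

(** The slab r - 3/8 depth <= x_0 <= r - 1/4 depth is high enough to lie in the polar
    cylinder, and low enough for a small box around the axis to stay in the round
    ball. *)
Lemma body_cap_lower : ((w n.+1 / 4 ^+ n.+1 * (depth / 8 * (dl / (2 * m)) ^+ n))%:E <=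
  hausdorff_measure n.+1 (body n.+1 c dl r `&` polar_cylinder))%E.
Proof.
have m0 : 0 < m by exact: lt_le_trans m1.
have b0 : 0 < dl / (2 * m) by rewrite divr_gt0// mulr_gt0.
rewrite -prod_slab; apply: (@flat_box_lower _
  (slab_size (r - 3 / 8 * depth) 0) (slab_size (depth / 8) (dl / (2 * m)))).
  by case=> [|i]//=; rewrite divr_gt0.
move=> x fx xbox.
have := xbox 0%N isT.
have -> : inord 0 = ord0 :> 'I_D.+1 by apply: val_inj; rewrite /= inordn.
rewrite /= => /andP[lo hi].
have Nx : tailsq x <= dl ^+ 2 / 4.
  apply: (@le_trans _ _ (n%:R * (dl / (2 * m)) ^+ 2)).
    apply: tailsq_flat_le => // [|i i_n]; first exact: ltW.
    have /andP[h1 h2] := xbox i.+1 i_n; rewrite ger0_norm//.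
    by rewrite -[leRHS]add0r.
  (* Sides dl / (2 m) keep the tail below dl^2 / 4. *)
  have -> : n%:R * (dl / (2 * m)) ^+ 2 = dl ^+ 2 / 4 * (n%:R / m ^+ 2).
    by field; rewrite gt_eqF.
  rewrite ler_piMr ?divr_ge0 ?sqr_ge0// ler_pdivrMr ?exprn_gt0// mul1r; exact: ltW.
set t := x 0 ord0 in lo hi *.
have t0 : 0 <= t by move: lo depthr r0; lra.
have d20 : 0 < dl ^+ 2 by rewrite exprn_gt0.
have lo2 : r ^+ 2 - dl ^+ 2 < t ^+ 2.
  apply: (@lt_le_trans _ _ ((r - 3 / 8 * depth) ^+ 2)); last first.
    by rewrite ler_pXn2r ?nnegrE//; move: depthr r0; lra.
  have -> : (r - 3 / 8 * depth) ^+ 2 = r ^+ 2 - 3 / 4 * (depth * r) + 9 / 64 * depth ^+ 2 by field.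
  by rewrite depthE; have := sqr_ge0 depth; move: d20; lra.
have hi2 : t ^+ 2 <= r ^+ 2 - dl ^+ 2 / 4.
  apply: (@le_trans _ _ ((r - 1 / 4 * depth) ^+ 2)).
    by rewrite ler_pXn2r ?nnegrE//; move: hi depthr r0; lra.
  have -> : (r - 1 / 4 * depth) ^+ 2 = r ^+ 2 - 1 / 2 * (depth * r) + 1 / 16 * depth ^+ 2 by field.
  by rewrite depthE; move: depth_sq d20; lra.
split; last by split=> //; move: Nx d20; lra.
split=> //; apply: lvl_center => //.
by rewrite dotv_split -/t; lra.
Qed.

Lemma body_rest_lower : ((w n.+1 / 4 ^+ n.+1 * (r / (2 * m)) ^+ n.+1)%:E <=
  hausdorff_measure n.+1 (body n.+1 c dl r `\` polar_cylinder))%E.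
Proof.
have m0 : 0 < m by exact: lt_le_trans m1.
have b0 : 0 < r / (2 * m) by rewrite divr_gt0// mulr_gt0.
rewrite -prod_const; apply: (@flat_box_lower _ (fun=> 0) (fun=> r / (2 * m))) => // x fx xbox.
have xb (i : 'I_D.+1) : (i < n.+1)%N -> `|x 0 i| <= r / (2 * m).
  move=> i_n; have := xbox i i_n; rewrite inord_val add0r => /andP[h1 h2].
  by rewrite ger0_norm.
have q : m * (r / (2 * m)) ^+ 2 <= r ^+ 2 / 4.
  have -> : m * (r / (2 * m)) ^+ 2 = r ^+ 2 / 4 / m by field; rewrite gt_eqF.
  by rewrite ler_pdivrMr// ler_peMr// divr_ge0 ?sqr_ge0.
have xx : dotv x x <= r ^+ 2 / 4.
  by apply: le_trans (flat_dotv_le fx (ltW b0) xb) _.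
split.
  by split=> //; apply: lvl_center => //; have := sqr_ge0 r; move: xx; lra.
move=> [_]; apply/negP; rewrite -leNgt.
by move: xx; rewrite dotv_split; have := tailsq_ge0 x; have := dl2r2; have := sqr_ge0 r; lra.
Qed.

Lemma lvl_far x : dl ^+ 2 <= tailsq x -> F x = lvl 0 dl r x.
Proof. by move=> Nx; rewrite /lvl !pbump_far. Qed.

Lemma surf_rest_eq : surf n.+1 c dl r `\` cylinder = surf n.+1 0 dl r `\` cylinder.
Proof.
apply/seteqP; split=> x [[fx Fx] Cx]; split=> //; split=> //.
- by rewrite -lvl_far// leNgt; apply/negP.
- by rewrite lvl_far// leNgt; apply/negP.
Qed.

(** Off the polar cylinder, either the bump vanishes or the point belongs to the round
    ball, which is contained in all of the bodies. *)
Lemma body_rest_eq :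
  body n.+1 c dl r `\` polar_cylinder = body n.+1 0 dl r `\` polar_cylinder.
Proof.
have lvl_le0 (c' : R) x : 0 <= c' -> tailsq x < dl ^+ 2 -> ~ polar_cylinder x -> lvl c' dl r x <= 0.
  move=> c'0 Nx Cx; rewrite /lvl dotv_split.
  have : 0 <= pbump c' dl (tailsq x) by exact: pbump_ge0.
  have : x 0 ord0 ^+ 2 <= r ^+ 2 - dl ^+ 2 by rewrite leNgt; apply/negP => h; apply: Cx.
  by move: Nx; lra.
apply/seteqP; split=> x [[fx Fx] Cx]; split=> //; split=> //;
  have [Nx|Nx] := leP (dl ^+ 2) (tailsq x).
- by rewrite -lvl_far.
- exact: lvl_le0.
- by rewrite lvl_far.
- exact: lvl_le0.
Qed.

(** * Local positivity of the measure, and the apex *)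

Lemma measurable_cylinder : measurable cylinder.
Proof.
apply: open_measurable_rV; apply: open_comp (@open_lt R (dl ^+ 2)) => x _.
exact: continuous_tailsq.
Qed.

Lemma measurable_polar_cylinder : measurable polar_cylinder.
Proof.
apply: open_measurable_rV; apply: openI.
  by apply: open_comp (@open_lt R (dl ^+ 2)) => x _; exact: continuous_tailsq.
apply: open_comp (@open_gt R (r ^+ 2 - dl ^+ 2)) => x _.
have : Ck 0 setT (fun x : E => x 0 ord0 * x 0 ord0).
  by apply: CkM; [exact: openT|exact/Ck_coord/openT..].
exact.
Qed.

Lemma continuous_hemi (s : R) : continuous (hemi_point c dl r s : E -> E).
Proof.
move=> y; suff : {for y, continuous (hemi_point c dl r s : E -> E)} by [].
apply: continuousD; first exact: cvg_id.
apply: continuousZl; apply: continuousM; first exact: cst_continuous.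
exact: continuous_cap_height.
Qed.

(** A box of half-side e r / m around (1 - e) y consists of barycentres, with weights
    1 - e and e, of y and of a point with coordinates at most r / m.  Convexity keeps
    it in the body when y is there, even when y is on the boundary; and it is close to
    y when e is small.  Here y and t are single coordinates. *)
Let shrink (e y t : R) : 0 < e <= 1 -> `|y| <= 2 * r ->
  (1 - e) * y - e * (r / m) <= t <= (1 - e) * y - e * (r / m) + 2 * (e * (r / m)) ->
  exists2 u, `|u| <= r / m & t = y + e * (u - y) /\ `|t - y| <= e * (3 * r).
Proof.
move=> /andP[ep e1] yr /andP[t1 t2]; have e0 := ltW ep; have m0 : 0 < m by exact: lt_le_trans m1.
have rm : r / m <= r by rewrite ler_pdivrMr// ler_peMr// ltW.
have rm0 : 0 <= r / m by rewrite divr_ge0 ?ltW.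
pose u := e^-1 * (t - (1 - e) * y).
have ut : e * u = t - (1 - e) * y by rewrite /u mulVKf ?gt_eqF.
have ur : `|u| <= r / m.
  rewrite -(ler_pM2l ep) -{1}(gtr0_norm ep) -normrM ut ler_norml.
  by move: t1 t2; move: ((1 - e) * y) (e * (r / m)) => A B; lra.
exists u => //; split; first by rewrite mulrBr ut; ring.
have -> : t - y = e * (u - y) by rewrite mulrBr ut; ring.
rewrite normrM (gtr0_norm ep) ler_wpM2l//.
apply: le_trans (ler_normB _ _) _; have -> : 3 * r = r + 2 * r by ring.
by rewrite lerD// (le_trans ur).
Qed.

Let small_scale (V : set E) y : open V -> V y ->
  exists2 e, 0 < e <= 1 & forall z, flat_model n.+1 (z - y) ->
    (forall i : 'I_D.+1, (i < n.+1)%N -> `|z 0 i - y 0 i| <= e * (3 * r)) -> V z.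
Proof.
move=> oV Vy; have m0 : 0 < m by exact: lt_le_trans m1.
have /nbhs_ballP[d /= d0 dV] : nbhs y V by exact: open_nbhs_nbhs.
have q0 : 0 < 12 * m * r by rewrite !mulr_gt0.
exists (Num.min 1 (d / (12 * m * r))); first by rewrite lt_min ltr01 divr_gt0//= ge_min lexx.
set e := Num.min _ _ => z fz zy.
have e0 : 0 <= e by rewrite le_min ler01 divr_ge0 ?ltW.
have ed : e * (12 * m * r) <= d by rewrite -ler_pdivlMr// ge_min lexx orbT.
apply: dV; rewrite -ball_normE/= -normrN opprB.
apply: le_lt_trans (norm_le_enorm _) _.
have er0 : 0 <= e * (3 * r) by rewrite mulr_ge0// mulr_ge0// ltW.
have zy' (i : 'I_D.+1) : (i < n.+1)%N -> `|(z - y) 0 i| <= e * (3 * r).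
  by move=> i_n; rewrite !mxE; exact: zy.
have := enorm_flat_le fz er0 (fun i i_n _ => zy' i i_n) (zy' ord0 isT).
have : e * (3 * r) <= m * (e * (3 * r)) by rewrite ler_peMl.
have : m * (e * (3 * r)) = e * (12 * m * r) / 4 by field.
by move: ed d0; lra.
Qed.

(** The point belongs to a hemisphere, a continuous graph over the equatorial ball: a
    small box of that ball near its projection lifts to the neighbourhood. *)
Lemma surf_locally_positive : (0 < n)%N ->
  locally_positive n (surf n.+1 c dl r : set E).
Proof.
move=> n0 p V Sp oV Vp; have m0 : 0 < m by exact: lt_le_trans m1.
have [s [y [ss fy y0 Ny pE]]] := surf_hemi dl0 dlltr Sp.
pose W := hemi_point c dl r s @^-1` V.
have oW : open W by apply: open_comp oV => z _; exact: continuous_hemi.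
have Wy : W y by rewrite /W /= -pE.
have [e e01 eW] := small_scale oW Wy.
have /andP[e0 e1] := e01.
have q0 : 0 < e * (r / m) by rewrite mulr_gt0// divr_gt0.
have yr (i : 'I_D.+1) : `|y 0 i| <= 2 * r.
  have [->|i0] := eqVneq i ord0; first by rewrite y0 normr0 mulr_ge0// ltW.
  apply: (@le_trans _ _ r); last by move: r0; lra.
  rewrite -(@ler_pXn2r _ 2)// ?nnegrE ?(ltW r0)// real_normK ?num_real//.
  apply: le_trans Ny.
  by rewrite /tailsq (bigD1 i)//= lerDl sumr_ge0// => *; exact: sqr_ge0.
pose a i := (1 - e) * y 0 (inord i.+1) - e * (r / m).
apply: lt_le_trans (@hemi_box_lower _ a (fun=> 2 * (e * (r / m))) s n0 _ _).
- by rewrite lte_fin mulr_gt0 ?divr_gt0 ?ball_volume_gt0 ?exprn_gt0// prodr_gt0// => i _; rewrite mulr_gt0.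
- by move=> i; rewrite mulr_gt0.
move=> z fz z0 zbox.
have zi (i : nat) (i_n : (i < n)%N) := shrink e01 (yr (inord i.+1)) (zbox i i_n).
split; last first.
  apply: eW; first exact: flatB.
  move=> i i_n; have [->|i0] := eqVneq i ord0.
    by rewrite z0 y0 subrr normr0 mulr_ge0 ?(ltW e0)// mulr_ge0// ltW.
  have iE : i = inord i.-1.+1 :> 'I_D.+1 by rewrite prednK ?inord_val// lt0n.
  have i1n : (i.-1 < n)%N by rewrite -ltnS prednK// lt0n.
  by have [u _ [_]] := zi _ i1n; rewrite -iE.
apply: hemi_surf => //.
suff : tailsq z <= r ^+ 2.
  by have : 0 <= pbump c dl (tailsq z) by [exact: pbump_ge0]; lra.
have le1 : tailsq z <= (1 - e) * tailsq y + e * (n%:R * (r / m) ^+ 2).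
  rewrite !tailsq_flat// -[n in n%:R]card_ord -sum1_card natr_sum !mulr_suml !mulr_sumr -big_split/=.
  apply: ler_sum => i _; have [u ur [-> _]] := zi i (ltn_ord i).
  rewrite mul1r; set t := y 0 _.
  have u2 : u ^+ 2 <= (r / m) ^+ 2.
    by rewrite -(real_normK (num_real u)) ler_pXn2r ?nnegrE// divr_ge0 ?ltW.
  apply: (@le_trans _ _ ((1 - e) * t ^+ 2 + e * u ^+ 2)); last by rewrite lerD2l ler_wpM2l// ltW.
  have : 0 <= e * (1 - e) * (u - t) ^+ 2.
    by rewrite mulr_ge0 ?sqr_ge0// mulr_ge0 ?(ltW e0)// subr_ge0.
  by rewrite -(subr_ge0 (_ ^+ 2)); have -> : (1 - e) * t ^+ 2 + e * u ^+ 2 - (t + e * (u - t)) ^+ 2 =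
    e * (1 - e) * (u - t) ^+ 2 by ring.
apply: le_trans le1 _.
have -> : r ^+ 2 = (1 - e) * r ^+ 2 + e * r ^+ 2 by ring.
rewrite lerD// ler_wpM2l ?(ltW e0) ?subr_ge0//.
have -> : n%:R * (r / m) ^+ 2 = r ^+ 2 * (n%:R / m ^+ 2) by field; rewrite gt_eqF.
by rewrite ler_piMr ?sqr_ge0// ler_pdivrMr ?exprn_gt0// mul1r ltW.
Qed.

(** By convexity the body contains, arbitrarily close to any of its points, a small box
    (see [shrink]). *)
Lemma body_locally_positive : locally_positive n.+1 (body n.+1 c dl r : set E).
Proof.
move=> p V Bp oV Vp; have m0 : 0 < m by exact: lt_le_trans m1.
have [fp Fp] := Bp.
have [e e01 eV] := small_scale oV Vp.
have /andP[e0 e1] := e01.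
have q0 : 0 < e * (r / m) by rewrite mulr_gt0// divr_gt0.
pose a i := (1 - e) * p 0 (inord i) - e * (r / m).
apply: lt_le_trans (@flat_box_lower _ a (fun=> 2 * (e * (r / m))) _ _).
- by rewrite lte_fin mulr_gt0 ?divr_gt0 ?ball_volume_gt0 ?exprn_gt0// prodr_gt0// => i _; rewrite mulr_gt0.
- by move=> i; rewrite mulr_gt0.
move=> z fz zbox.
have zi (i : 'I_D.+1) : (i < n.+1)%N ->
    exists2 u, `|u| <= r / m & z 0 i = p 0 i + e * (u - p 0 i) /\ `|z 0 i - p 0 i| <= e * (3 * r).
  move=> i_n; have := zbox i i_n; rewrite /a inord_val.
  by apply: shrink => //; exact: lvl_coord_le.
split; last by apply: eV; [exact: flatB|move=> i /zi[u _ []]].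
pose u := e^-1 *: (z - (1 - e) *: p).
have ei : e != 0 by rewrite gt_eqF.
have -> : z = p + e *: (u - p).
  rewrite /u scalerBr scalerA divff// scale1r scalerBl scale1r.
  by apply/rowP => i; rewrite !mxE; ring.
apply: body_star => //; last by rewrite (ltW e0).
split; first exact/flatZ/flatB/flatZ.
apply: lvl_center => //.
apply: (@le_trans _ _ (m * (r / m) ^+ 2)).
  apply: flat_dotv_le; [exact/flatZ/flatB/flatZ|by rewrite divr_ge0 ?ltW|].
  move=> i /zi[v vr [zE _]]; rewrite !mxE zE.
  by have -> : e^-1 * (p 0 i + e * (v - p 0 i) - (1 - e) * p 0 i) = v by field.
have -> : m * (r / m) ^+ 2 = r ^+ 2 / m by field; rewrite gt_eqF.
by rewrite ler_pdivrMr// ler_peMr// sqr_ge0.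
Qed.

(** The north pole of the bumped sphere. *)
Definition apex : E := hemi_point c dl r 1 0.

Lemma surf_apex : surf n.+1 c dl r apex.
Proof.
have tail0 : tailsq (0 : E) = 0 by apply: big1 => i _; rewrite mxE expr0n.
apply: hemi_surf; rewrite ?mulr1 ?mxE//; first by move=> i _; rewrite mxE.
rewrite tail0 addr_ge0 ?sqr_ge0// mulr_ge0//; exact: pbump_ge0.
Qed.

(** Comparing the coordinate 0 alone is enough: it is at most r on the round ball and
    sqrt (r^2 + 2 c dl^2) at the apex. *)
Lemma apex_edist (S : set E) : S `<=` [set x | dotv x x <= r ^+ 2] ->
  ((c * dl ^+ 2 / (2 * r))%:E <= Defs.edist apex S)%E.
Proof.
move=> Sr; apply: le_ereal_inf_tmp => _ [x Sx <-]; rewrite lee_fin.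
have tail0 : tailsq (0 : E) = 0 by apply: big1 => i _; rewrite mxE expr0n.
apply: le_trans (coord_le_enorm _ ord0); apply: le_trans (ler_norm _).
have -> : (apex - x) 0 ord0 = apex 0 ord0 - x 0 ord0 by rewrite !mxE.
rewrite /apex hemi_coord0 ?mxE// mul1r.
have xr : x 0 ord0 <= r.
  apply: le_trans (ler_norm _) _.
  rewrite -(@ler_pXn2r _ 2)// ?nnegrE ?(ltW r0)// real_normK ?num_real//.
  by have := Sr _ Sx; rewrite /= dotv_split; have := tailsq_ge0 x; lra.
pose h := c * dl ^+ 2 / (2 * r).
have hr : h * r = c * dl ^+ 2 / 2 by rewrite /h; field; rewrite gt_eqF.
have h0 : 0 <= h by rewrite divr_ge0 ?mulr_ge0 ?sqr_ge0// ltW.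
have hler : h <= r.
  by rewrite -(ler_pM2r r0) hr -expr2; move: cdl; have := sqr_ge0 r; rewrite -mulrA; lra.
have : r + h <= cap_height c dl r (tailsq (0 : E)).
  rewrite /cap_height tail0 pbump0 subr0 -[r + h]ger0_norm ?addr_ge0 ?(ltW r0)//.
  rewrite -sqrtr_sqr; apply: ler_wsqrtr.
  rewrite sqrrD mulr2n (mulrC r) hr.
  have : h ^+ 2 <= h * r by rewrite expr2 ler_wpM2l.
  by rewrite hr; have := mulr_ge0 c0 (sqr_ge0 dl); lra.
by rewrite -/h; move: xr; lra.
Qed.
End volumes.

(** * From volumes to rates *)

(** The geometric data of the two-point method: M1 deforms M0 inside B only, and one of
    its points is at distance h from M0.  The bounds lo and hi concern the volume of the
    common part, vlo and vhi that of the two caps. *)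
Definition perturbation (R : realType) (D k : nat) (t1 t2 : \bar R)
    (lo hi vlo vhi h : R) : Prop :=
  exists (M0 M1 B : set 'rV[R]_D) (x : 'rV[R]_D),
    [/\ manifold_class k t1 t2 M0, manifold_class k t1 t2 M1,
        locally_positive k M0 & locally_positive k M1] /\
    [/\ measurable B, M0 `\` B = M1 `\` B, M1 x & (h%:E <= Defs.edist x M0)%E] /\
    [/\ (lo%:E <= hausdorff_measure k (M0 `\` B) <= hi%:E)%E,
        (vlo%:E <= hausdorff_measure k (M0 `&` B) <= vhi%:E)%E &
        (vlo%:E <= hausdorff_measure k (M1 `&` B) <= vhi%:E)%E].

(** The solution is dl = kap tau min (1, X^(1/e)): the minimum makes the height
    saturate at order tau when X, the inverse of the effective sample size, is large. *)
Lemma perturbation_scale (R : realType) (e : nat) (kap tau X : R) : (0 < e)%N ->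
  0 < kap -> kap <= 1 -> 0 < tau -> 0 < X ->
  exists dl, [/\ 0 < dl, dl <= kap * tau, (dl / tau) ^+ e <= kap * X
    & dl ^+ 2 = kap ^+ 2 * tau ^+ 2 * Num.min 1 (X `^ (2 / e%:R))].
Proof.
move=> e0 k0 k1 t0 X0; pose q := X `^ (1 / e%:R).
have q0 : 0 < q by exact: powR_gt0.
have eR : e%:R != 0 :> R by rewrite pnatr_eq0 -lt0n.
have qe : q ^+ e = X.
  by rewrite -powR_mulrn ?ltW// -powRrM mul1r mulVf// powRr1// ltW.
have q2 : q ^+ 2 = X `^ (2 / e%:R).
  by rewrite -powR_mulrn ?ltW// -powRrM mulrAC mul1r.
have mq0 : 0 < Num.min 1 q by rewrite lt_min ltr01.
exists (kap * tau * Num.min 1 q); split.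
- by rewrite !mulr_gt0.
- by rewrite ler_piMr ?ge_min ?lexx// mulr_ge0 ?ltW.
- have -> : kap * tau * Num.min 1 q / tau = kap * Num.min 1 q by field; rewrite gt_eqF.
  rewrite exprMn -qe; apply: ler_pM; rewrite ?exprn_ge0 ?(ltW k0) ?(ltW mq0)//.
    by rewrite -(prednK e0) exprS ler_piMr ?exprn_ile1 ?(ltW k0).
  by rewrite lerXn2r ?nnegrE ?(ltW q0) ?(ltW mq0)// ge_min lexx orbT.
rewrite !exprMn -q2; congr (_ * _); case: (leP 1 q) => [q1|q1].
  by rewrite expr1n min_l// exprn_ege1.
by rewrite min_r// exprn_ile1// ltW.
Qed.

(** All volumes are of the expected order in tau, and the caps have volume of order
    tau^k (dl / tau)^e.  Then the best dl makes the mass fmin * vhi of a cap about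
    1 / n, and a height of order dl^2 / tau gives the exponent 2 / e. *)
Lemma minimax_rate (R : realType) (k e : nat) (m lo hi v rho c : R) : (0 < e)%N ->
  0 < m -> 0 < lo -> 0 < hi -> 0 < v -> 0 < rho -> 0 < c ->
  exists cd cd' Cd : R, [/\ 0 < cd, 0 < cd', 0 < Cd &
    forall (D : nat) (t1 t2 : \bar R) (tau fmin fmax : R) (n : nat),
      0 < tau -> 0 < fmin -> fmin <= cd / tau ^+ k -> cd' / tau ^+ k <= fmax ->
      (0 < n)%N ->
      (forall dl, 0 < dl -> m * dl <= tau ->
        perturbation D k t1 t2 (lo * tau ^+ k) (hi * tau ^+ k)
          (v * (tau ^+ k * (dl / tau) ^+ e)) (rho * (v * (tau ^+ k * (dl / tau) ^+ e)))
          (c * dl ^+ 2 / (4 * tau))) ->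
      ((Cd * tau * Num.min 1 ((1 / (fmin * tau ^+ k * n%:R)) `^ (2 / e%:R)))%:E <=
        minimax_risk n (@distribution_class R D k t1 t2 fmin fmax))%E].
Proof.
move=> e0 m0 lo0 hi0 v0 rho0 c0.
have rv0 : 0 < rho * v by rewrite mulr_gt0.
(* Small enough for dl <= tau / m, and for the mass of the cap to be at most
   1 / (2 n). *)
pose kap := (1 + m + 2 * (rho * v))^-1.
have den0 : 0 < 1 + m + 2 * (rho * v) by lra.
have kap0 : 0 < kap by rewrite invr_gt0.
have kapE : kap * (1 + m + 2 * (rho * v)) = 1 by rewrite mulVf// gt_eqF.
have km0 : 0 < kap * m by rewrite mulr_gt0.
have kv0 : 0 < kap * (rho * v) by rewrite mulr_gt0.
have [kap1 kapm kapv] : [/\ kap <= 1, kap * m <= 1 & kap * (rho * v) <= 1 / 2].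
  by move: kapE; rewrite !mulrDr mulr1 mulrCA; split; lra.
pose cd := (2 * hi)^-1; have cd0 : 0 < cd by rewrite invr_gt0 mulr_gt0.
have li0 : 0 < lo^-1 by rewrite invr_gt0.
have cr0 : 0 < cd * rho by rewrite mulr_gt0.
exists cd, (lo^-1 + cd * rho), (c * kap ^+ 2 / 16); split => //.
- exact: addr_gt0.
- by rewrite divr_gt0// mulr_gt0// exprn_gt0.
move=> D t1 t2 tau fmin fmax n t0 f0 fcd fmaxcd n0 pert.
have tk0 : 0 < tau ^+ k by rewrite exprn_gt0.
have nR : 0 < n%:R :> R by rewrite ltr0n.
set X := 1 / _; have X0 : 0 < X by rewrite divr_gt0// !mulr_gt0.
have [dl [dl0 dlk dle dl2]] := perturbation_scale e0 kap0 kap1 t0 X0.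
have mdl : m * dl <= tau.
  have : m * dl <= m * (kap * tau) by rewrite ler_wpM2l// ltW.
  have : kap * m * tau <= tau by rewrite ler_piMl// ltW.
  by rewrite mulrCA mulrA => h1 h2; exact: le_trans h2 h1.
have [M0 [M1 [B [x [[cl0 cl1 p0 p1] [[mB MB M1x hx] [b1 b2 b3]]]]]]] := pert dl dl0 mdl.
have dlt0 : 0 < dl / tau by rewrite divr_gt0.
set vol := tau ^+ k * (dl / tau) ^+ e in b2 b3.
have vol0 : 0 < vol by rewrite mulr_gt0// exprn_gt0.
have volX : fmin * vol <= kap / n%:R.
  rewrite /vol mulrA; apply: (@le_trans _ _ (fmin * tau ^+ k * (kap * X))).
    by rewrite ler_pM2l// mulr_gt0.
  by rewrite le_eqVlt; apply/orP; left; apply/eqP; rewrite /X; field; rewrite !gt_eqF.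
have -> : c * kap ^+ 2 / 16 * tau * Num.min 1 (X `^ (2 / e%:R)) = c * dl ^+ 2 / (4 * tau) / 4.
  by rewrite dl2; field; rewrite gt_eqF.
apply: (@two_point_risk R D k n t1 t2 fmin fmax M0 M1 B _ _ _ _ _ x _ _ _ _ _ _ _ _ _ _ _ b1 b2 b3) => //.
- exact: mulr_gt0.
- exact: mulr_gt0.
- exact: mulr_gt0.
- by rewrite mulr_gt0// mulr_gt0.
- by apply: le_trans fcd _; rewrite /cd mulrA [leRHS]invfM.
- apply: le_trans fmaxcd; rewrite invfM ler_pM2r ?invr_gt0//.
  by rewrite lerDl ltW.
- have -> : fmin * (rho * (v * vol)) = rho * v * (fmin * vol) by ring.
  apply: (@le_trans _ _ (rho * v * (kap / n%:R))); first by rewrite ler_pM2l.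
  rewrite mulrA invfM ler_pM2r ?invr_gt0// mulrC; lra.
- have -> : rho * (v * vol) / (v * vol) = rho by rewrite mulfK// gt_eqF// mulr_gt0.
  apply: le_trans fmaxcd; apply: (@le_trans _ _ (cd / tau ^+ k * rho)).
    by rewrite ler_pM2r.
  by rewrite mulrAC ler_pM2r ?invr_gt0// lerDr ltW.
- by rewrite divr_ge0 ?mulr_ge0 ?sqr_ge0// ltW.
Qed.

Section profile_perturbations.
Context (R : realType) (D : nat) (n : 'I_D.+1) (tau dl : R).
Context (tau0 : 0 < tau) (dl0 : 0 < dl) (mdl : n.+1%:R * dl <= tau).
Notation m := (n.+1%:R : R).
Notation w := (ball_volume R).
Let c1 : R := 1 / 280.

Let m0 : 0 < m. Proof. by rewrite ltr0n. Qed.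
Let c10 : 0 <= c1. Proof. by rewrite /c1; lra. Qed.
Let c1le : c1 <= 1 / 280. Proof. exact: lexx. Qed.
Let c0le : 0 <= 1 / 280 :> R. Proof. exact: c10. Qed.
Let dlr : 2 * m * dl <= 2 * tau.
Proof. by rewrite -mulrA ler_pM2l. Qed.
Let r0 : 0 < 2 * tau. Proof. by rewrite mulr_gt0. Qed.
Let dlltr : dl < 2 * tau.
Proof.
have : dl <= m * dl by rewrite ler_peMl ?ler1n// ltW.
by move: mdl tau0; lra.
Qed.
Let reach_ok : 3 * tau <= 2 * (2 * tau). Proof. by move: tau0; lra. Qed.
Let sphere_ball (x : 'rV[R]_D.+1) : lvl 0 dl (2 * tau) x <= 0 -> dotv x x <= (2 * tau) ^+ 2.
Proof. by rewrite /lvl /pbump !mul0r mulr0 subr0 subr_le0. Qed.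
Let heightE : c1 * dl ^+ 2 / (2 * (2 * tau)) = c1 * dl ^+ 2 / (4 * tau).
Proof. by congr (_ / _); ring. Qed.

(** Caps over an n-dimensional disc of radius dl, so that e = n in [minimax_rate]. *)
Lemma surf_perturbation : (0 < n)%N ->
  perturbation D.+1 n tau%:E +oo
    (w n / 4 ^+ n / m ^+ n * tau ^+ n)
    (2 * m * w n * (9 * m ^+ 2) ^+ n * 8 ^+ n * tau ^+ n)
    (w n / 4 ^+ n / m ^+ n * (tau ^+ n * (dl / tau) ^+ n))
    (2 * (4 * (9 * m ^+ 2) * 2 * m) ^+ n *
      (w n / 4 ^+ n / m ^+ n * (tau ^+ n * (dl / tau) ^+ n)))
    (c1 * dl ^+ 2 / (4 * tau)).
Proof.
move=> n0.
have volE : tau ^+ n * (dl / tau) ^+ n = dl ^+ n by rewrite -exprMn mulrC divfK// gt_eqF.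
have mn0 : m ^+ n != 0 by rewrite expf_neq0// gt_eqF.
have fn0 : 4 ^+ n != 0 :> R by rewrite expf_neq0.
have restE : w n / 4 ^+ n * (2 * tau / (2 * m)) ^+ n = w n / 4 ^+ n / m ^+ n * tau ^+ n.
  have -> : 2 * tau / (2 * m) = tau / m by field; rewrite gt_eqF.
  by rewrite expr_div_n; field; rewrite mn0 fn0.
have totE : 2 * m * (w n * (9 * m ^+ 2) ^+ n * (4 * (2 * tau)) ^+ n) =
    2 * m * w n * (9 * m ^+ 2) ^+ n * 8 ^+ n * tau ^+ n.
  have -> : 4 * (2 * tau) = 8 * tau by ring.
  by rewrite [(8 * tau) ^+ n]exprMn; ring.
have loE : w n / 4 ^+ n * (dl / m) ^+ n = w n / 4 ^+ n / m ^+ n * dl ^+ n.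
  by rewrite expr_div_n; field; rewrite mn0 fn0.
have hiE : 2 * (w n * (9 * m ^+ 2) ^+ n * (2 * dl) ^+ n) =
    2 * (4 * (9 * m ^+ 2) * 2 * m) ^+ n * (w n / 4 ^+ n / m ^+ n * dl ^+ n).
  move: (9 * m ^+ 2) => y; rewrite !exprMn; move: mn0 fn0.
  move: (4 ^+ n) (m ^+ n) (2 ^+ n) (dl ^+ n) => x4 xm x2 xd h1 h2.
  by field; rewrite h1 h2.
rewrite volE -restE -totE -hiE -loE.
exists (surf n.+1 0 dl (2 * tau)), (surf n.+1 c1 dl (2 * tau)), (cylinder dl), (apex D c1 dl (2 * tau)).
split; first split.
- by apply: surf_manifold.
- by apply: surf_manifold.
- exact: surf_locally_positive.
- exact: surf_locally_positive.
split; first split.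
- exact: measurable_cylinder.
- exact/esym/surf_rest_eq.
- exact: surf_apex.
- rewrite -heightE; apply: (apex_edist c10 c1le dl0 dlr) => x [_ Fx].
  by apply: sphere_ball; rewrite Fx.
split; apply/andP; split.
- exact: surf_rest_lower.
- apply: le_trans (surf_upper (lexx 0) c0le dl0 dlr n0).
  by apply: le_hausdorff_measure => x [].
- exact: surf_cap_lower.
- exact: surf_cap_upper.
- exact: surf_cap_lower.
- exact: surf_cap_upper.
Qed.

(** Caps over an n-dimensional disc of radius dl and of thickness dl^2 / tau, whose
    volume dl^(n+2) / tau gives e = n + 2 in dimension k = n + 1. *)
Lemma body_perturbation :
  perturbation D.+1 n.+1 +oo tau%:E
    (w n.+1 / 4 ^+ n.+1 / m ^+ n.+1 * tau ^+ n.+1)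
    (w n.+1 * (2 * m) ^+ n.+1 * 8 ^+ n.+1 * tau ^+ n.+1)
    (w n.+1 / 4 ^+ n.+1 / 16 / (2 * m) ^+ n * (tau ^+ n.+1 * (dl / tau) ^+ n.+2))
    (32 * (2 * m) ^+ n.+1 * (2 * 2 * m) ^+ n * 4 ^+ n.+1 *
      (w n.+1 / 4 ^+ n.+1 / 16 / (2 * m) ^+ n * (tau ^+ n.+1 * (dl / tau) ^+ n.+2)))
    (c1 * dl ^+ 2 / (4 * tau)).
Proof.
have t0 : tau != 0 by rewrite gt_eqF.
have volE : tau ^+ n.+1 * (dl / tau) ^+ n.+2 = dl ^+ 2 / tau * dl ^+ n.
  have tn0 : tau ^+ n != 0 by rewrite expf_neq0.
  rewrite -[n.+2]addn2 exprD exprS !expr_div_n; move: (tau ^+ n) tn0 => y y0.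
  by field; rewrite t0 y0.
have mn0 : m ^+ n.+1 != 0 by rewrite expf_neq0// gt_eqF.
have mmn0 : (2 * m) ^+ n != 0 by rewrite expf_neq0// gt_eqF// mulr_gt0.
have fn0 : 4 ^+ n.+1 != 0 :> R by rewrite expf_neq0.
have tn0 : 2 ^+ n != 0 :> R by rewrite expf_neq0.
have restE : w n.+1 / 4 ^+ n.+1 * (2 * tau / (2 * m)) ^+ n.+1 =
    w n.+1 / 4 ^+ n.+1 / m ^+ n.+1 * tau ^+ n.+1.
  have -> : 2 * tau / (2 * m) = tau / m by field; rewrite gt_eqF.
  by rewrite expr_div_n; move: (m ^+ n.+1) mn0 (4 ^+ n.+1) fn0 => x x0 y y0; field; rewrite x0 y0.
have totE : w n.+1 * (2 * m) ^+ n.+1 * (4 * (2 * tau)) ^+ n.+1 =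
    w n.+1 * (2 * m) ^+ n.+1 * 8 ^+ n.+1 * tau ^+ n.+1.
  have -> : 4 * (2 * tau) = 8 * tau by ring.
  by rewrite [(8 * tau) ^+ n.+1]exprMn mulrA.
have loE : w n.+1 / 4 ^+ n.+1 * (dl ^+ 2 / (2 * tau) / 8 * (dl / (2 * m)) ^+ n) =
    w n.+1 / 4 ^+ n.+1 / 16 / (2 * m) ^+ n * (dl ^+ 2 / tau * dl ^+ n).
  rewrite expr_div_n; move: ((2 * m) ^+ n) mmn0 (4 ^+ n.+1) fn0 => x x0 y y0.
  by field; rewrite x0 y0 t0.
have hiE : 2 * (w n.+1 * (2 * m) ^+ n.+1 * (2 * (dl ^+ 2 / (2 * tau)) * (2 * dl) ^+ n)) =
    32 * (2 * m) ^+ n.+1 * (2 * 2 * m) ^+ n * 4 ^+ n.+1 *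
      (w n.+1 / 4 ^+ n.+1 / 16 / (2 * m) ^+ n * (dl ^+ 2 / tau * dl ^+ n)).
  have -> : 2 * 2 * m = 2 * (2 * m) by ring.
  rewrite ![(2 * (2 * m)) ^+ n]exprMn ![(2 * dl) ^+ n]exprMn.
  move: ((2 * m) ^+ n) mmn0 (4 ^+ n.+1) fn0 ((2 * m) ^+ n.+1) (2 ^+ n) (dl ^+ n) => x x0 y y0 z u v.
  by field; rewrite x0 y0 t0.
rewrite volE -restE -totE -hiE -loE.
exists (body n.+1 0 dl (2 * tau)), (body n.+1 c1 dl (2 * tau)),
  (polar_cylinder dl (2 * tau)), (apex D c1 dl (2 * tau)).
split; first split.
- exact: body_manifold.
- exact: body_manifold.
- exact: body_locally_positive.
- exact: body_locally_positive.
split; first split.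
- exact: measurable_polar_cylinder.
- exact/esym/body_rest_eq.
- by have [fa Fa] := surf_apex n dl (2 * tau) c10; split=> //; rewrite Fa.
- by rewrite -heightE; apply: (apex_edist c10 c1le dl0 dlr) => x [_ Fx]; exact: sphere_ball.
split; apply/andP; split.
- exact: body_rest_lower.
- apply: le_trans (body_upper (lexx 0) c0le dl0 dlr).
  by apply: le_hausdorff_measure => x [].
- exact: body_cap_lower.
- exact: body_cap_upper.
- exact: body_cap_lower.
- exact: body_cap_upper.
Qed.
End profile_perturbations.

Theorem theorem3p16 (R : realType) (d : nat) (d_ge1 : (1 <= d)%N) :
  exists c_d c'_d C_d : R,
    [/\ 0 < c_d, 0 < c'_d, 0 < C_d
      & forall (D : nat) (fmin fmax : R),
        (d <= D)%N -> 0 < fmin -> fmin <= fmax ->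
        (forall tau_min : R, 0 < tau_min ->
          fmin <= c_d / tau_min ^+ d -> c'_d / tau_min ^+ d <= fmax ->
          (d <= D - 1)%N ->
          forall n : nat, (1 <= n)%N ->
          ((C_d * tau_min *
             Num.min 1 ((1 / (fmin * tau_min ^+ d * n%:R)) `^ (2 / d%:R)))%:E
           <= minimax_risk n
                (@distribution_class R D d tau_min%:E +oo fmin fmax))%E)
        /\
        (forall tau_bd_min : R, 0 < tau_bd_min ->
          fmin <= c_d / tau_bd_min ^+ d -> c'_d / tau_bd_min ^+ d <= fmax ->
          forall n : nat, (1 <= n)%N ->
          ((C_d * tau_bd_min *
             Num.min 1 ((1 / (fmin * tau_bd_min ^+ d * n%:R)) `^ (2 / d.+1%:R)))%:E
           <= minimax_risk n
                (@distribution_class R D d +oo tau_bd_min%:E fmin fmax))%E)].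
Proof.
case: d d_ge1 => // d' _; set d := d'.+1.
have w0 k : 0 < ball_volume R k := ball_volume_gt0 R k.
have m0 (k : nat) : 0 < k.+1%:R :> R by rewrite ltr0n.
have c0 : 0 < 1 / 280 :> R by rewrite divr_gt0.
(* Hypersurfaces of dimension d live in d + 1 flat coordinates. *)
have [a [a' [A [a0 a'0 A0 HA]]]] := @minimax_rate R d d d.+1%:R
  (ball_volume R d / 4 ^+ d / d.+1%:R ^+ d)
  (2 * d.+1%:R * ball_volume R d * (9 * d.+1%:R ^+ 2) ^+ d * 8 ^+ d)
  (ball_volume R d / 4 ^+ d / d.+1%:R ^+ d)
  (2 * (4 * (9 * d.+1%:R ^+ 2) * 2 * d.+1%:R) ^+ d) (1 / 280)
  isT (m0 _) ltac:(by rewrite !divr_gt0 ?exprn_gt0)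
  ltac:(by rewrite !mulr_gt0 ?exprn_gt0 ?mulr_gt0 ?exprn_gt0)
  ltac:(by rewrite !divr_gt0 ?exprn_gt0)
  ltac:(by rewrite mulr_gt0 ?exprn_gt0 ?mulr_gt0 ?exprn_gt0) c0.
(* Bodies of dimension d only need d flat coordinates, hence D = d is allowed. *)
have [b [b' [B [b0 b'0 B0 HB]]]] := @minimax_rate R d d.+1 d%:R
  (ball_volume R d / 4 ^+ d / d%:R ^+ d)
  (ball_volume R d * (2 * d%:R) ^+ d * 8 ^+ d)
  (ball_volume R d / 4 ^+ d / 16 / (2 * d%:R) ^+ d')
  (32 * (2 * d%:R) ^+ d * (2 * 2 * d%:R) ^+ d' * 4 ^+ d) (1 / 280)
  isT (m0 _) ltac:(by rewrite !divr_gt0 ?exprn_gt0)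
  ltac:(by rewrite !mulr_gt0 ?exprn_gt0 ?mulr_gt0)
  ltac:(by rewrite !divr_gt0 ?exprn_gt0 ?mulr_gt0)
  ltac:(by rewrite !mulr_gt0 ?exprn_gt0 ?mulr_gt0) c0.
exists (Num.min a b), (Num.max a' b'), (Num.min A B); split.
- by rewrite lt_min a0.
- by rewrite lt_max a'0.
- by rewrite lt_min A0.
move=> [//|D] fmin fmax dD f0 _.
have rate (u v q t : R) : 0 < t -> u <= v -> 0 <= q -> ((u * t * q)%:E <= (v * t * q)%:E)%E.
  by move=> t0 uv q0; rewrite lee_fin ler_wpM2r// ler_wpM2r// ltW.
have min1_ge0 (q z : R) : 0 <= Num.min 1 (q `^ z) by rewrite le_min ler01 powR_ge0.
have weaken (t u u' v v' : R) : 0 < t -> u <= v -> v' <= u' ->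
    fmin <= u / t ^+ d -> u' / t ^+ d <= fmax -> fmin <= v / t ^+ d /\ v' / t ^+ d <= fmax.
  move=> t0 uv vu h1 h2; split.
    by apply: le_trans h1 _; rewrite ler_pM2r ?invr_gt0 ?exprn_gt0.
  by apply: le_trans h2; rewrite ler_pM2r ?invr_gt0 ?exprn_gt0.
split=> tau t0 hmin hmax.
  rewrite subn1 /= => dD1 n n1.
  have [h1 h2] : fmin <= a / tau ^+ d /\ a' / tau ^+ d <= fmax.
    by apply: weaken hmin hmax => //; rewrite ?ge_min ?le_max lexx.
  have pert dl (dl0 : 0 < dl) (mdl : d.+1%:R * dl <= tau) :=
    @surf_perturbation R D (Ordinal (dD1 : (d < D.+1)%N)) tau dl t0 dl0 mdl isT.
  apply: le_trans (HA _ _ _ _ _ _ n t0 f0 h1 h2 n1 pert).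
  by apply: rate => //; rewrite ge_min lexx.
move=> n n1.
have [h1 h2] : fmin <= b / tau ^+ d /\ b' / tau ^+ d <= fmax.
  by apply: weaken hmin hmax => //; rewrite ?ge_min ?le_max lexx orbT.
have pert dl (dl0 : 0 < dl) (mdl : d%:R * dl <= tau) :=
  @body_perturbation R D (Ordinal (dD : (d' < D.+1)%N)) tau dl t0 dl0 mdl.
apply: le_trans (HB _ _ _ _ _ _ n t0 f0 h1 h2 n1 pert).
by apply: rate => //; rewrite ge_min lexx orbT.
Qed.
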